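(* Let $m\ge0$, $c\ge1$, $1\le k\le\ell$ and $0\le p\le\ell$ be integers, and put $d_i=m$ for $1\le i\le p$ and $d_i=m+1$ for $p<i\le\ell$. Let $\mathcal{R}^{p,k}_\ell(c,m)$ be the arrangement in $\mathbb{R}^\ell$ consisting of the hyperplanes: $x_i-x_j=0$ for $1\le i<j\le\ell$; $x_i-x_j=1$ and $x_i-x_j=-1$ for $1\le i<j\le\ell-k+1$; and $x_i=s$ for $1\le i\le\ell$ and integers $1-\mu_i-c\le s\le d_i+\mu_i-1$, where $\mu_i=\min\{\ell-i+1,k\}$. For $k\le\ell-1$, let $\widehat{\mathcal{R}}^{p,k}_\ell(c,m)$ be the arrangement in $\mathbb{R}^\ell$ consisting of the hyperplanes: $x_i-x_j=0$ for $1\le i<j\le\ell$; $x_i-x_j=\pm1$ for $1\le i<j\le\ell-k$; $x_{\ell-k+1}-x_i=1$ for $1\le i\le\ell-k$; and $x_i=s$ for $1\le i\le\ell$ and integers $-c-\min\{k,\ell-i\}\le s\le d_i+\min\{k-1,\ell-i\}$. Then the cones $\mathbf{c}\mathcal{R}^{p,k}_\ell(c,m)$ and (for $k\le\ell-1$) $\mathbf{c}\widehat{\mathcal{R}}^{p,k}_\ell(c,m)$ are ind-flag-accurate, both with exponents $$\big(1,\ q+\ell-p+1,\ q+2,\ q+3,\dots,\ q+\ell\big),\qquad q=m+\ell+c-1.$$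
   Context: For an affine arrangement $\mathcal{A}$ in $\mathbb{R}^\ell$, its cone $\mathbf{c}\mathcal{A}$ is the central arrangement in $V'=\mathbb{R}^{\ell+1}$ (extra coordinate $z$) consisting of the hyperplanes $a_1x_1+\dots+a_\ell x_\ell=dz$ for each hyperplane $a_1x_1+\dots+a_\ell x_\ell=d$ of $\mathcal{A}$, together with $z=0$. For a central arrangement $\mathcal{A}$ in $W=\mathbb{R}^N$: $L(\mathcal{A})$ is the set of intersections of subsets of $\mathcal{A}$ (including $W$); $\mathcal{A}^X=\{H\cap X:H\in\mathcal{A},X\not\subseteq H\}$; $\mathcal{A}$ is free if $D(\mathcal{A})=\{\theta\in\mathrm{Der}(S):\theta(\alpha_H)\in\alpha_HS\ \forall H\}$ is free over $S=\mathbb{R}[x_1,\dots,x_N]$, exponents being degrees of a homogeneous basis. Inductively free arrangements: smallest class containing empty arrangements and containing $\mathcal{A}$ whenever some $H\in\mathcal{A}$ has $\mathcal{A}\setminus\{H\}$ and $\mathcal{A}^H$ in the class with $\exp(\mathcal{A}^H)\subseteq\exp(\mathcal{A}\setminus\{H\})$. $\mathcal{A}$, free with exponents $e_1\le\dots\le e_N$, is ind-flag-accurate if it is inductively free and there is a flag $X_1\subseteq\dots\subseteq X_N=W$ in $L(\mathcal{A})$ with $\dim X_d=d$ and each $\mathcal{A}^{X_d}$ inductively free with exponents $(e_1,\dots,e_d)$. *)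

(* Defs.v *)
From HB Require Import structures.
From mathcomp Require Import all_boot all_order all_algebra.
From mathcomp Require Import finmap mpoly.

Set Implicit Arguments.
Unset Strict Implicit.
Unset Printing Implicit Defensive.

Import Order.TTheory GRing.Theory Num.Theory.

Local Open Scope ring_scope.

(* A central arrangement in a subspace W of V is a finite set A of subspaces of
   W of codimension 1 in W.  Carrying W along with A makes a restriction again
   an arrangement (in X) inside the same V. *)

Section CentralArrangements.
Variables (F : fieldType) (V : vectType F).
Implicit Types (W X H : {vspace V}) (A : {fset {vspace V}}).

Definition central_arrangement W A : Prop :=
  forall H, H \in A -> (H <= W)%VS /\ (\dim H).+1 = \dim W.

Definition flat W A X : Prop :=
  exists2 B : {fset {vspace V}},
    (B `<=` A)%fset & X = (W :&: \bigcap_(H <- B) H)%VS.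

Definition restriction A X : {fset {vspace V}} :=
  [fset (H :&: X)%VS | H in A & ~~ (X <= H)%VS]%fset.

(* Linear coordinates on W are given by a basis b of W; the coordinate ring S
   is the ring of polynomials in these coordinates. *)

Definition linear_form n (a : 'I_n -> F) : {mpoly F[n]} :=
  \sum_(i < n) a i *: 'X_i.

Definition defining_form W (b : (\dim W).-tuple V) H (a : 'I_(\dim W) -> F) :
    Prop :=
  forall v, (v \in H) = (v \in W) && (\sum_i a i * coord b i v == 0).

Definition derivation n (theta : {mpoly F[n]} -> {mpoly F[n]}) : Prop :=
  linear theta /\ forall f g, theta (f * g) = theta f * g + f * theta g.

(* Membership in D(A).  The form alpha_H is unique up to a nonzero scalar, so
   quantifying over all choices of it is harmless. *)
Definition log_derivation W (b : (\dim W).-tuple V) A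
    (theta : {mpoly F[\dim W]} -> {mpoly F[\dim W]}) : Prop :=
  derivation theta /\
  forall H a, H \in A -> defining_form b H a ->
    exists g, theta (linear_form a) = g * linear_form a.

Definition log_basis W (b : (\dim W).-tuple V) A r
    (theta : 'I_r -> {mpoly F[\dim W]} -> {mpoly F[\dim W]}) : Prop :=
  (forall i, log_derivation b A (theta i)) /\
  (forall eta, log_derivation b A eta ->
     exists! c : {ffun 'I_r -> {mpoly F[\dim W]}},
       forall f, eta f = \sum_(i < r) c i * theta i f).

Definition homogeneous_derivation n (d : nat)
    (theta : {mpoly F[n]} -> {mpoly F[n]}) : Prop :=
  forall j : 'I_n, theta 'X_j \is d.-homog.

(* D(A) is a free S-module with a homogeneous basis of degrees e (a multiset:
   the order of e is immaterial, since bases may be reordered).  The choice of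
   the coordinates b does not matter. *)
Definition free_with_exponents W A (e : seq nat) : Prop :=
  exists (b : (\dim W).-tuple V)
         (theta : 'I_(size e) -> {mpoly F[\dim W]} -> {mpoly F[\dim W]}),
    [/\ basis_of W b,
        log_basis b A theta
      & forall i : 'I_(size e), homogeneous_derivation (nth 0%N e i) (theta i)].

Definition multiset_incl (s t : seq nat) : Prop :=
  forall x, (count_mem x s <= count_mem x t)%N.

(* The exponents of a free arrangement are unique up to order, so e' and e'' are
   determined as multisets. *)
Inductive inductively_free : {vspace V} -> {fset {vspace V}} -> Prop :=
| InductivelyFree_empty W : inductively_free W fset0
| InductivelyFree_add W A H e' e'' :
    H \in A ->
    inductively_free W (A `\ H)%fset ->
    inductively_free H (restriction A H) ->
    free_with_exponents W (A `\ H)%fset e' ->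
    free_with_exponents H (restriction A H) e'' ->
    multiset_incl e'' e' ->
    inductively_free W A.

Definition ind_flag_accurate W A : Prop :=
  exists e : seq nat,
    [/\ central_arrangement W A, sorted leq e, free_with_exponents W A e,
        inductively_free W A &
        exists X : nat -> {vspace V},
          [/\ X (\dim W) = W,
              forall d, (1 <= d < \dim W)%N -> (X d <= X d.+1)%VS &
              forall d, (1 <= d <= \dim W)%N ->
                [/\ flat W A (X d), \dim (X d) = d,
                    inductively_free (X d) (restriction A (X d)) &
                    free_with_exponents (X d) (restriction A (X d)) (take d e)]]].

End CentralArrangements.

Section Cones.
Variables (F : fieldType) (l : nat).

(* The pair (a, d) stands for the affine hyperplane a_1 x_1 + ... + a_l x_l = d;
   an affine arrangement is a finite list of such equations. *)
Definition affine_equation : Type := ('rV[F]_l * F)%type.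

Definition normal_hyperplane N (a : 'rV[F]_N) : {vspace 'rV[F]_N} :=
  lker (linfun (mulmxr a^T : 'rV[F]_N -> 'rV[F]_1)).

(* The extra coordinate z is the last one. *)
Definition cone_hyperplane (h : affine_equation) : {vspace 'rV[F]_(l + 1)} :=
  normal_hyperplane (row_mx h.1 (- h.2)%:M).

Definition hyperplane_at_infinity : {vspace 'rV[F]_(l + 1)} :=
  normal_hyperplane (row_mx 0 1%:M).

Definition cone (s : seq affine_equation) : {fset {vspace 'rV[F]_(l + 1)}} :=
  [fset H in hyperplane_at_infinity :: map cone_hyperplane s]%fset.

Lemma mem_normal_hyperplane N (a v : 'rV[F]_N) :
  (v \in normal_hyperplane a) = (\sum_i v 0 i * a 0 i == 0).
Proof.
have -> : \sum_i v 0 i * a 0 i = (v *m a^T) 0 0.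
  by rewrite mxE; apply: eq_bigr => i _; rewrite mxE.
rewrite memv_ker lfunE /=; apply/eqP/eqP => [-> | h]; first by rewrite mxE.
by apply/matrixP => i j; rewrite !ord1 h mxE.
Qed.

Lemma mem_cone_hyperplane (h : affine_equation) (x : 'rV[F]_l) (z : F) :
  (row_mx x z%:M \in cone_hyperplane h) = (\sum_i h.1 0 i * x 0 i == h.2 * z).
Proof.
rewrite mem_normal_hyperplane big_split_ord /= big_ord1 !row_mxEr !mxE !mulr1n.
rewrite mulrN subr_eq0 [z * _]mulrC; congr (_ == _).
by apply: eq_bigr => i _; rewrite !row_mxEl mulrC.
Qed.

Lemma mem_hyperplane_at_infinity (x : 'rV[F]_l) (z : F) :
  (row_mx x z%:M \in hyperplane_at_infinity) = (z == 0).
Proof.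
rewrite mem_normal_hyperplane big_split_ord /= big_ord1 !row_mxEr !mxE !mulr1n.
rewrite mulr1 big1 ?add0r // => i _.
by rewrite !row_mxEl mxE mulr0.
Qed.

End Cones.

Definition int_range (lo hi : int) : seq int :=
  [seq lo + n%:Z | n <- iota 0 (if lo <= hi then `|hi - lo|%N.+1 else 0%N)].

Lemma mem_int_range lo hi s : (s \in int_range lo hi) = (lo <= s <= hi).
Proof.
apply/mapP/andP => [[n]|[h1 h2]].
  rewrite mem_iota /= add0n; case: ifP => // hl hn ->.
  rewrite lerDl -lerBrDl; split => //.
  by rewrite -[hi - lo]gez0_abs ?subr_ge0 // lez_nat -ltnS.
have hs : 0 <= s - lo by rewrite subr_ge0.
exists `|s - lo|%N; last by rewrite gez0_abs // [RHS]addrC subrK.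
rewrite mem_iota /= add0n (le_trans h1 h2) ltnS -lez_nat !gez0_abs ?lerD2r //.
by rewrite subr_ge0 (le_trans h1 h2).
Qed.

Section ShiArrangements.
Variables (F : fieldType) (l : nat).

(* Coordinates are indexed from 0: i : 'I_l stands for x_(i + 1), whence the
   i.+1 below. *)

Definition eq_diff (i j : 'I_l) (t : F) : affine_equation F l :=
  (delta_mx 0 i - delta_mx 0 j, t).

Definition eq_coord (i : 'I_l) (s : int) : affine_equation F l :=
  (delta_mx 0 i, s%:~R).

(* All pairs i < j, in 1-based numbering, with j <= b. *)
Definition pairs_upto (b : nat) : seq ('I_l * 'I_l) :=
  [seq ij : 'I_l * 'I_l <- enum {: 'I_l * 'I_l} | (ij.1 < ij.2)%N && (ij.2.+1 <= b)%N].

Definition d_ (p m : nat) (i : nat) : nat := if (i <= p)%N then m else m.+1.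

Definition mu_ (k : nat) (i : nat) : nat := minn (l - i + 1) k.

Definition arrR (p k c m : nat) : seq (affine_equation F l) :=
  [seq eq_diff ij.1 ij.2 0 | ij <- pairs_upto l] ++
  [seq eq_diff ij.1 ij.2 1 | ij <- pairs_upto (l - k + 1)] ++
  [seq eq_diff ij.1 ij.2 (- 1) | ij <- pairs_upto (l - k + 1)] ++
  [seq eq_coord i s | i : 'I_l <- enum 'I_l,
     s <- int_range (1 - (mu_ k i.+1)%:Z - c%:Z)
                    ((d_ p m i.+1)%:Z + (mu_ k i.+1)%:Z - 1)].

Definition arrRhat (p k c m : nat) : seq (affine_equation F l) :=
  [seq eq_diff ij.1 ij.2 0 | ij <- pairs_upto l] ++
  [seq eq_diff ij.1 ij.2 1 | ij <- pairs_upto (l - k)] ++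
  [seq eq_diff ij.1 ij.2 (- 1) | ij <- pairs_upto (l - k)] ++
  [seq eq_diff ji.1 ji.2 1 | ji : 'I_l * 'I_l <- enum {: 'I_l * 'I_l}
     & (ji.1.+1 == l - k + 1)%N && (ji.2.+1 <= l - k)%N] ++
  [seq eq_coord i s | i : 'I_l <- enum 'I_l,
     s <- int_range (- c%:Z - (minn k (l - i.+1))%:Z)
                    ((d_ p m i.+1)%:Z + (minn (k - 1) (l - i.+1))%:Z)].

End ShiArrangements.

(* Main.v *)
(* By Terao's addition theorem (if A \ {H} and A^H are free and exp(A^H) is contained in
   exp(A \ {H}), then A is free) everything reduces to building the arrangements up
   hyperplane by hyperplane, the ambient space V and the linear forms being fixed while
   the subspace carrying the arrangement shrinks.

   Addition theorem: let d be the degree lost, and (T_i) a homogeneous basis of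
   D(A \ {H}).  Modulo alpha_H each T_i(alpha_H) is c_i B for a fixed form B of degree d.
   If c_i is a nonzero constant for some T_i of degree d, then T_j - (c_j / c_i) T_i
   (j <> i) and alpha_H T_i form a basis of D(A).  Otherwise all T_i of degree at most d
   restrict to D(A^H), and there are too many of them to be independent.

   Combinatorics: only hyperplanes x_i - x_j = t z occur.  The "Catalan part" consists of
   the vertices joined to each other by x_i - x_j = 0, z, -z, and to the origin by an
   interval of values of x_i.  Adding the next value to one vertex restricts to the Catalan
   part on the other vertices with an interval enlarged by two, and with empty intervals
   one may take a vertex as the origin; this gives all exponents by induction.  Every
   vertex outside of the Catalan part is simplicial, that is, its hyperplanes restrict to
   ones already present, with one exception in the second family: the vertex x_(l-k+1),
   when p <= l - k, is simplicial up to its last value.  The flag is obtained by setting x_1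
   to its least value lo, then x_2 to lo - 1, and so on, and the remaining vertices to
   values which the later ones do not take. *)

From HB Require Import structures.
Require Import Defs.
From mathcomp Require Import all_boot all_order all_fingroup all_algebra.
From mathcomp Require Import finmap mpoly reals ring zify.

Set Implicit Arguments.
Unset Strict Implicit.
Unset Printing Implicit Defensive.

Import Order.TTheory GRing.Theory Num.Theory.

Local Open Scope ring_scope.

(** * Polynomials and linear forms *)

Section Polynomials.
Variable F : fieldType.

Lemma mpoly_alg_ind n (Q : {mpoly F[n]} -> Prop) :
  (forall c, Q c%:MP) -> (forall i, Q 'X_i) ->
  (forall p q, Q p -> Q q -> Q (p + q)) ->
  (forall p q, Q p -> Q q -> Q (p * q)) -> forall p, Q p.
Proof.
move=> QC QX QD QM p; have Q1 : Q 1 by rewrite -mpolyC1.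
rewrite [p]mpolyE; apply: (big_ind Q) => [||m _]; [by rewrite -(mpolyC0 n F)|exact: QD|].
rewrite -mul_mpolyC; apply: (QM) => //.
rewrite mpolyXE_id; apply: (big_ind Q) => [||i _]; [exact: Q1|exact: QM|].
by elim: (m i) => [|k IH]; rewrite ?expr0 // exprS; apply: QM.
Qed.

Definition msub n k (g : 'I_n -> {mpoly F[k]}) (p : {mpoly F[n]}) : {mpoly F[k]} :=
  p \mPo [tuple g i | i < n].

HB.instance Definition _ n k g := GRing.Linear.copy (@msub n k g) (comp_mpoly [tuple g i | i < n]).
HB.instance Definition _ n k g := GRing.RMorphism.copy (@msub n k g) (comp_mpoly [tuple g i | i < n]).

Lemma msubX n k (g : 'I_n -> {mpoly F[k]}) i : msub g 'X_i = g i.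
Proof. by rewrite /msub comp_mpolyXU -tnth_nth tnth_mktuple. Qed.

Lemma msubC n k (g : 'I_n -> {mpoly F[k]}) c : msub g c%:MP = c%:MP.
Proof. exact: comp_mpolyC. Qed.

Lemma msub_comp n k l (g : 'I_n -> {mpoly F[k]}) (h : 'I_k -> {mpoly F[l]}) p :
  msub h (msub g p) = msub (fun i => msub h (g i)) p.
Proof.
elim/mpoly_alg_ind: p => [c|i|p q IHp IHq|p q IHp IHq].
- by rewrite !msubC.
- by rewrite !msubX.
- by rewrite !linearD /= IHp IHq.
- by rewrite !rmorphM /= IHp IHq.
Qed.

Lemma msub_id n (g : 'I_n -> {mpoly F[n]}) p : (forall i, g i = 'X_i) -> msub g p = p.
Proof.
move=> gE; rewrite -[RHS](comp_mpoly_id p) /msub; congr (_ \mPo _).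
by apply: eq_from_tnth => i; rewrite !tnth_mktuple gE.
Qed.

Lemma msub_homog n k (g : 'I_n -> {mpoly F[k]}) d p :
  (forall i, g i \is 1.-homog) -> p \is d.-homog -> msub g p \is d.-homog.
Proof.
move=> hg hp; rewrite /msub comp_mpolyEX big_seq; apply: rpred_sum => m mp.
apply: rpredZ; rewrite comp_mpolyX -(dhomog_mf hp mp) /= mdegE.
apply: (big_ind2 (fun (q : {mpoly F[k]}) e => q \is e.-homog)) => [|x1 y1 x2 y2|i _].
- exact: dhomog1.
- exact: dhomogM.
- by have := dhomogMn (m i) (hg i); rewrite mul1n tnth_mktuple.
Qed.

Lemma homogX n i : ('X_i : {mpoly F[n]}) \is 1.-homog.
Proof. by rewrite dhomogX /= mdeg1. Qed.

Lemma linear_form_homog n (a : 'I_n -> F) : linear_form a \is 1.-homog.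
Proof. by apply: rpred_sum => i _; rewrite rpredZ // homogX. Qed.

Lemma msub_linear_form n k (g : 'I_n -> {mpoly F[k]}) a :
  msub g (linear_form a) = \sum_i a i *: g i.
Proof. by rewrite linear_sum; apply: eq_bigr => i _; rewrite linearZ /= msubX. Qed.

Lemma linear_form_coef n (a : 'I_n -> F) i : (linear_form a)@_U_(i) = a i.
Proof.
rewrite linear_sum (bigD1 i) //= mcoeffZ mcoeffXU eqxx mulr1 big1 ?addr0 //.
by move=> j ji; rewrite mcoeffZ mcoeffXU (negbTE ji) mulr0.
Qed.

Definition mdvd n (p q : {mpoly F[n]}) := exists g, q = g * p.

Lemma mdvdD n (p q r : {mpoly F[n]}) : mdvd p q -> mdvd p r -> mdvd p (q + r).
Proof. by move=> [g ->] [h ->]; exists (g + h); rewrite mulrDl. Qed.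

Lemma mdvdMl n (p q r : {mpoly F[n]}) : mdvd p q -> mdvd p (r * q).
Proof. by move=> [g ->]; exists (r * g); rewrite mulrA. Qed.

Lemma mdvd0 n (p : {mpoly F[n]}) : mdvd p 0.
Proof. by exists 0; rewrite mul0r. Qed.

Lemma mdvd_sum n (p : {mpoly F[n]}) (I : finType) (f : I -> {mpoly F[n]}) :
  (forall i, mdvd p (f i)) -> mdvd p (\sum_i f i).
Proof. by move=> h; apply: big_ind => // [|x y]; [exact: mdvd0 | exact: mdvdD]. Qed.

Lemma mdvdZ n c (p q : {mpoly F[n]}) : c != 0 -> mdvd (c *: p) q <-> mdvd p q.
Proof.
move=> c0; split=> -[g ->]; first by exists (c *: g); rewrite -scalerAl -scalerAr.
by exists (c^-1 *: g); rewrite -scalerAl -scalerAr scalerA mulVf // scale1r.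
Qed.

Lemma mdvdZr n c (p q : {mpoly F[n]}) : mdvd p q -> mdvd p (c *: q).
Proof. by rewrite -mul_mpolyC; apply: mdvdMl. Qed.

Lemma msub_congr n (g : 'I_n -> {mpoly F[n]}) l p :
  (forall i, mdvd l ('X_i - g i)) -> mdvd l (p - msub g p).
Proof.
move=> gl; elim/mpoly_alg_ind: p => [c|i|p q IHp IHq|p q IHp IHq].
- by rewrite msubC subrr; apply: mdvd0.
- by rewrite msubX.
- by rewrite linearD /= opprD addrACA; apply: mdvdD.
- have -> : p * q - msub g (p * q) = q * (p - msub g p) + msub g p * (q - msub g q).
    rewrite rmorphM /= !mulrBr addrA [q * p]mulrC [q * msub g p]mulrC.
    by rewrite subrK.
  by apply: mdvdD; apply: mdvdMl.
Qed.

(* Substitution onto the hyperplane [linear_form a = 0], solved for 'X_j. *)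
Definition solve n (a : 'I_n -> F) (j : 'I_n) (i : 'I_n) : {mpoly F[n]} :=
  'X_i - ((i == j)%:R / a j) *: linear_form a.

Lemma solve_root n (a : 'I_n -> F) j : a j != 0 -> msub (solve a j) (linear_form a) = 0.
Proof.
move=> aj; have e : \sum_i a i *: (((i == j)%:R / a j) *: linear_form a) = linear_form a.
  rewrite (bigD1 j) //= eqxx scalerA div1r mulfV // scale1r big1 ?addr0 // => i /negbTE ->.
  by rewrite mul0r scale0r scaler0.
by rewrite msub_linear_form /solve; under eq_bigr do rewrite scalerBr; rewrite sumrB e subrr.
Qed.

Lemma mdvd_linear n (a : 'I_n -> F) j p : a j != 0 ->
  mdvd (linear_form a) p <-> msub (solve a j) p = 0.
Proof.
move=> aj; split=> [[g ->]|h]; first by rewrite rmorphM /= solve_root ?mulr0.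
rewrite -[p]subr0 -h; apply: msub_congr => i.
by rewrite /solve opprB addrC subrK; apply: mdvdZr; exists 1; rewrite mul1r.
Qed.

Lemma linear_prime n (a : 'I_n -> F) j p q : a j != 0 ->
  mdvd (linear_form a) (p * q) -> mdvd (linear_form a) p \/ mdvd (linear_form a) q.
Proof.
move=> aj /(mdvd_linear _ aj) /eqP; rewrite rmorphM /= mulf_eq0.
by case/orP=> /eqP h; [left|right]; apply/(mdvd_linear _ aj).
Qed.

Lemma mdvd_linear_form n (a b : 'I_n -> F) : mdvd (linear_form a) (linear_form b) ->
  forall j, a j != 0 -> forall i, b i = b j / a j * a i.
Proof.
move=> ab j aj i; have /(mdvd_linear _ aj) := ab.
rewrite msub_linear_form /solve; under eq_bigr do rewrite scalerBr.
rewrite sumrB [X in _ - X](bigD1 j) //= eqxx scalerA div1r [X in _ - (_ + X)]big1 ?addr0; last first.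
  by move=> k /negbTE ->; rewrite mul0r scale0r scaler0.
move/eqP; rewrite subr_eq0 => /eqP /(congr1 (mcoeff U_(i))).
by rewrite mcoeffZ !linear_form_coef.
Qed.

Definition not_prop n (a b : 'I_n -> F) :=
  forall c, ~ (forall i, b i = c * a i).

Lemma not_prop_ndvd n (a b : 'I_n -> F) j : a j != 0 -> not_prop a b ->
  ~ mdvd (linear_form a) (linear_form b).
Proof. by move=> aj ab /mdvd_linear_form /(_ j aj) h; apply: (ab _ h). Qed.

Lemma linear_coprime_exp n (a : 'I_n -> F) j m p q : a j != 0 ->
  ~ mdvd (linear_form a) q -> mdvd (linear_form a ^+ m) (p * q) ->
  mdvd (linear_form a ^+ m) p.
Proof.
move=> aj aq; have a0 : linear_form a != 0.
  by apply: contraNneq aj => a0; rewrite -linear_form_coef a0 mcoeff0.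
elim: m p => [|m IH] p; first by exists p; rewrite expr0 mulr1.
move=> [g]; rewrite exprSr mulrA => h.
have : mdvd (linear_form a) (p * q) by exists (g * linear_form a ^+ m).
case/(linear_prime aj) => // -[p' pE]; move: h; rewrite pE.
rewrite mulrAC => /(mulIf a0) /(fun h => IH p' (ex_intro _ g h)) [g' ->].
by exists g'; rewrite mulrA.
Qed.

Lemma mdvd_prod n (I : eqType) (s : seq I) (a : I -> 'I_n -> F) (m : I -> nat) p :
  uniq s -> (forall i, i \in s -> exists j, a i j != 0) ->
  (forall i k, i \in s -> k \in s -> i != k -> not_prop (a i) (a k)) ->
  (forall i, i \in s -> mdvd (linear_form (a i) ^+ m i) p) ->
  mdvd (\prod_(i <- s) linear_form (a i) ^+ m i) p.
Proof.
elim: s => [|i s IH] /=; first by exists p; rewrite big_nil mulr1.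
case/andP=> is_ us an ap ad.
have [j aj] := an i (mem_head _ _).
have [|||p' pE] := IH us.
- by move=> k ks; apply: an; rewrite in_cons ks orbT.
- by move=> k l ks ls; apply: ap; rewrite in_cons ?ks ?ls orbT.
- by move=> k ks; apply: ad; rewrite in_cons ks orbT.
have [p'' p'E] : mdvd (linear_form (a i) ^+ m i) p'.
  apply: (linear_coprime_exp (q := \prod_(j <- s) linear_form (a j) ^+ m j) aj).
    have: forall k, k \in s -> not_prop (a i) (a k).
      move=> k ks; apply: ap; rewrite ?mem_head ?in_cons ?ks ?orbT //.
      by apply: contraNneq is_ => ->.
    elim: (s) => [|k t IHt] ip.
      rewrite big_nil => -[g] /(congr1 (msub (solve (a i) j))).
      rewrite rmorphM rmorph1 /= solve_root // mulr0 => /eqP.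
      by rewrite oner_eq0.
    rewrite big_cons => /(linear_prime aj) [|]; last first.
      by apply: IHt => l lt; apply: ip; rewrite in_cons lt orbT.
    have := not_prop_ndvd aj (ip k (mem_head _ _)).
    elim: (m k) => [|r IHr] nd.
      rewrite expr0 => -[g] /(congr1 (msub (solve (a i) j))).
      rewrite rmorphM rmorph1 /= solve_root // mulr0 => /eqP.
      by rewrite oner_eq0.
    by rewrite exprS => /(linear_prime aj) [|]; [exact: nd | exact: IHr].
  by rewrite -pE; apply: ad; rewrite mem_head.
by exists p''; rewrite big_cons pE p'E mulrA.
Qed.

Lemma pihomogM n d e (p B : {mpoly F[n]}) : B \is d.-homog ->
  pihomog mdeg e (p * B) = if (d <= e)%N then pihomog mdeg (e - d) p * B else 0.
Proof.
move=> hB; elim/mpolyind: p => [|c m p _ _ IH].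
  by rewrite mul0r !pihomog0 mul0r; case: ifP.
have hX : 'X_[m] * B \is (mdeg m + d).-homog by rewrite dhomogM ?dhomogX.
rewrite mulrDl -scalerAl !pihomogD IH !linearZ /= pihomogX.
have -> : pihomog mdeg e ('X_[m] * B) = if mdeg m + d == e then 'X_[m] * B else 0.
  by case: eqP => [<-|/eqP ne]; rewrite ?(pihomog_dE hX) // (pihomog_ne0 ne hX).
case: leqP => de.
  rewrite -(eqn_add2r d (mdeg m)) subnK //; case: eqP => _.
    by rewrite mulrDl scalerAl.
  by rewrite !scaler0 !add0r.
rewrite addr0; case: eqP => [me|_]; last by rewrite scaler0.
by move: de; rewrite -me ltnNge leq_addl.
Qed.

End Polynomials.

(** * The addition theorem for vector fields *)

Section VectorFields.
Variable F : fieldType.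

Definition pairing n (a : 'I_n -> F) (t : 'I_n -> {mpoly F[n]}) := \sum_i a i *: t i.

Definition log_field n (P : ('I_n -> F) -> Prop) (t : 'I_n -> {mpoly F[n]}) :=
  forall a, P a -> mdvd (linear_form a) (pairing a t).

Definition free_fields n (P : ('I_n -> F) -> Prop) r (dg : 'I_r -> nat) :=
  exists T : 'I_r -> 'I_n -> {mpoly F[n]},
    [/\ forall i, log_field P (T i),
        forall i j, T i j \is (dg i).-homog,
        forall t, log_field P t -> exists c, forall j, t j = \sum_i c i * T i j
      & forall c, (forall j, \sum_i c i * T i j = 0) -> forall i, c i = 0].

Lemma log_field_sum n (P : ('I_n -> F) -> Prop) (I : finType)
    (c : I -> {mpoly F[n]}) (T : I -> 'I_n -> {mpoly F[n]}) :
  (forall i, log_field P (T i)) -> log_field P (fun j => \sum_i c i * T i j).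
Proof.
move=> hT a Pa; have -> : pairing a (fun j => \sum_i c i * T i j) =
    \sum_i c i * pairing a (T i).
  rewrite /pairing; under eq_bigr do rewrite scaler_sumr.
  rewrite exchange_big; apply: eq_bigr => i _; rewrite mulr_sumr.
  by apply: eq_bigr => j _; rewrite scalerAr.
by apply: mdvd_sum => i; apply/mdvdMl/hT.
Qed.

Lemma log_field_eq n (P : ('I_n -> F) -> Prop) t t' :
  t =1 t' -> log_field P t -> log_field P t'.
Proof.
move=> e h a /h; rewrite /pairing => -[g gE]; exists g; rewrite -gE.
by apply: eq_bigr => i _; rewrite e.
Qed.

Lemma free_fields_eq n (P Q : ('I_n -> F) -> Prop) r (dg : 'I_r -> nat) :
  (forall t, log_field P t <-> log_field Q t) -> free_fields P dg -> free_fields Q dg.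
Proof.
move=> e [T [T1 T2 T3 T4]]; exists T; split=> // [i|t]; first exact/e.
by move/e/T3.
Qed.

Lemma nontrivial_relation (D : idomainType) (I K : finType) (A : {pred I}) (B : {pred K})
    (M : I -> K -> D) : (#|B| < #|A|)%N ->
  exists f : I -> D, [/\ exists i, f i != 0, forall i, i \notin A -> f i = 0
    & forall k, k \in B -> \sum_i f i * M i k = 0].
Proof.
move=> BA; pose col (j : 'I_#|A|) : option K := nth None (map Some (enum B)) j.
pose N := \matrix_(i < #|A|, j < #|A|) oapp (M (enum_val i)) 0 (col j).
have dN : \det N = 0.
  rewrite (expand_det_col _ (Ordinal BA)) big1 // => i _.
  by rewrite mxE /col /= nth_default ?mul0r // size_map -cardE.
have /det0P[v v0 vN] : \det N == 0 by rewrite dN.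
exists (fun i => \sum_(j < #|A| | enum_val j == i) v 0 j); split.
- have /rV0Pn[j vj] := v0; exists (enum_val j).
  rewrite (bigD1 j) //= big1 ?addr0 // => j' /andP[/eqP/enum_val_inj ->].
  by rewrite eqxx.
- move=> i iA; rewrite big_pred0 // => j; apply: contraNF iA => /eqP <-.
  exact: enum_valP.
- move=> k kB; have kI : (index k (enum B) < #|A|)%N.
    by apply: ltn_trans BA; rewrite cardE index_mem mem_enum.
  have /matrixP/(_ 0 (Ordinal kI)) := vN; rewrite !mxE => e; rewrite -[RHS]e.
  under [LHS]eq_bigr do rewrite mulr_suml.
  rewrite (exchange_big_dep predT) //=; apply: eq_bigr => j _.
  rewrite (big_pred1 (enum_val j)) => [|i]; last by rewrite eq_sym.
  rewrite mxE /col /= (nth_map k) ?nth_index ?mem_enum //.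
  by rewrite index_mem mem_enum.
Qed.

Definition restrict_var m (i : 'I_m.+1) : {mpoly F[m]} := oapp (fun j => 'X_j) 0 (unlift ord0 i).
Definition shift_var m (j : 'I_m) : {mpoly F[m.+1]} := 'X_(lift ord0 j).

Lemma restrict_var0 m : restrict_var ord0 = 0 :> {mpoly F[m]}.
Proof. by rewrite /restrict_var unlift_none. Qed.

Lemma restrict_var_lift m (j : 'I_m) : restrict_var (lift ord0 j) = 'X_j.
Proof. by rewrite /restrict_var liftK. Qed.

Lemma shift_varK m : cancel (msub (@shift_var m)) (msub (@restrict_var m)).
Proof. by move=> p; rewrite msub_comp msub_id // => i; rewrite /shift_var msubX restrict_var_lift. Qed.

Lemma restrict_var_kernel m (p : {mpoly F[m.+1]}) : mdvd 'X_ord0 p <-> msub (@restrict_var m) p = 0.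
Proof.
split=> [[g ->]|h]; first by rewrite rmorphM /= msubX restrict_var0 mulr0.
suff: mdvd 'X_ord0 (p - msub (@shift_var m) (msub (@restrict_var m) p)) by rewrite h rmorph0 subr0.
rewrite msub_comp; apply: msub_congr => i; case: (unliftP ord0 i) => [j|] ->.
  by rewrite restrict_var_lift msubX subrr; apply: mdvd0.
by rewrite restrict_var0 rmorph0 subr0; exists 1; rewrite mul1r.
Qed.

Lemma linear_form_ord0 m (a : 'I_m.+1 -> F) :
  linear_form a = a ord0 *: 'X_ord0 + msub (@shift_var m) (linear_form (fun j => a (lift ord0 j))).
Proof. by rewrite msub_linear_form /linear_form big_ord_recl. Qed.

Lemma pairing_ord0 m (a : 'I_m.+1 -> F) t :
  pairing a t = a ord0 *: t ord0 + \sum_j a (lift ord0 j) *: t (lift ord0 j).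
Proof. exact: big_ord_recl. Qed.

Lemma restrict_var_linear_form m (a : 'I_m.+1 -> F) :
  msub (@restrict_var m) (linear_form a) = linear_form (fun j => a (lift ord0 j)).
Proof.
rewrite linear_form_ord0 linearD /= shift_varK linearZ /= msubX restrict_var0 scaler0.
by rewrite add0r.
Qed.

Section Addition.
Variables (m : nat) (J J'' : eqType) (s : seq J) (s'' : seq J'').
Variables (a : J -> 'I_m.+1 -> F) (c : J'' -> 'I_m -> F) (pr : J -> J'') (la : J -> F).
Hypotheses (us : uniq s) (us'' : uniq s'').
Hypothesis la0 : forall K, K \in s -> la K != 0.
Hypothesis aE : forall K, K \in s -> forall i, a K (lift ord0 i) = la K * c (pr K) i.
Hypothesis pr_s : forall K, K \in s -> pr K \in s''.
Hypothesis s_pr : forall x, x \in s'' -> exists2 K, K \in s & pr K = x.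
Hypothesis c0 : forall x, x \in s'' -> exists j, c x j != 0.
Hypothesis a_np : forall K L, K \in s -> L \in s -> K != L -> not_prop (a K) (a L).
Hypothesis c_np : forall x y, x \in s'' -> y \in s'' -> x != y -> not_prop (c x) (c y).

Let P' (v : 'I_m.+1 -> F) := exists2 K, K \in s & v = a K.
Let P'' (v : 'I_m -> F) := exists2 x, x \in s'' & v = c x.

Definition fiber x := count (fun K => pr K == x) s.

Definition Bpoly := \prod_(x <- s'') linear_form (c x) ^+ (fiber x).-1.

Lemma fiber_dvd t x : x \in s'' -> log_field P' t ->
  mdvd (linear_form (c x) ^+ (fiber x).-1) (msub (@restrict_var m) (t ord0)).
Proof.
move=> xs ht; pose G := [seq K <- s | pr K == x].
pose b K i := (la K)^-1 * a K i.
have GE K : K \in G -> K \in s /\ pr K = x.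
  by rewrite mem_filter => /andP[/eqP <-].
have bE K j : K \in G -> b K (lift ord0 j) = c x j.
  by move=> /GE [Ks <-]; rewrite /b aE // mulrA mulVf ?mul1r // la0.
have lfb K : K \in G -> linear_form (b K) = (la K)^-1 *: linear_form (a K).
  by move=> _; rewrite /linear_form scaler_sumr; apply: eq_bigr => i _; rewrite scalerA.
have pb K : pairing (b K) t = (la K)^-1 *: pairing (a K) t.
  by rewrite /pairing scaler_sumr; apply: eq_bigr => i _; rewrite scalerA.
pose f := \sum_j c x j *: t (lift ord0 j).
(* Write X for c x, y for 'X_ord0, and theta for the derivation t.  Up to a scalar the
   forms over x are X + b y with distinct b, and each divides theta X + b theta y,
   hence also D = y theta X - X theta y, in which b does not occur. *)
pose D := 'X_ord0 * f - msub (@shift_var m) (linear_form (c x)) * t ord0.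
have dD : mdvd (\prod_(K <- G) linear_form (b K) ^+ 1) D.
  apply: mdvd_prod => [|K KG|K L KG LG KL|K KG].
  - exact: filter_uniq.
  - have [j cj] := c0 xs; by exists (lift ord0 j); rewrite bE.
  - have [Ks Kx] := GE _ KG; have [Ls Lx] := GE _ LG => e h.
    apply: (a_np Ks Ls KL (c := la L * e / la K)) => i.
    have := h i; rewrite /b => /(congr1 (fun z => la L * z)).
    rewrite /= mulVKf ?la0 // => ->.
    by rewrite !mulrA.
  - have [Ks Kx] := GE _ KG; rewrite expr1.
    have -> : D = 'X_ord0 * pairing (b K) t + (- t ord0) * linear_form (b K).
      rewrite pairing_ord0 (linear_form_ord0 (b K)) /D.
      under [X in _ = _ * (_ + X) + _]eq_bigr do rewrite bE //.
      have -> : linear_form (fun j => b K (lift ord0 j)) = linear_form (c x).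
        by apply: eq_bigr => j _; rewrite bE.
      by rewrite -/f -!mul_mpolyC; ring.
    apply: mdvdD; last by exists (- t ord0).
    apply: mdvdMl; rewrite lfb // mdvdZ ?invr_neq0 ?la0 // pb.
    by apply/mdvdZr/ht; exists K.
case: dD => g /(congr1 (msub (@restrict_var m))).
rewrite /D rmorphB !rmorphM /= shift_varK msubX restrict_var0 mul0r sub0r rmorph_prod /=.
have -> : \prod_(K <- G) msub (@restrict_var m) (linear_form (b K) ^+ 1) = linear_form (c x) ^+ fiber x.
  rewrite /fiber -size_filter -/G big_seq.
  rewrite (eq_bigr (fun=> linear_form (c x))) => [|K KG].
    by rewrite -big_seq big_const_seq count_predT -Monoid.iteropE.
  rewrite expr1 restrict_var_linear_form; apply: eq_bigr => j _; by rewrite bE.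
have : (0 < fiber x)%N.
  have [K Ks Kx] := s_pr xs; rewrite /fiber -has_count; apply/hasP; exists K => //.
  exact/eqP.
case: (fiber x) => // k _; rewrite exprSr /= mulrA => h.
have [j cj] := c0 xs.
have l0 : linear_form (c x) != 0.
  by apply: contraNneq cj => a0; rewrite -linear_form_coef a0 mcoeff0.
exists (- msub (@restrict_var m) g); apply: (mulIf l0).
by rewrite !mulNr -h opprK mulrC.
Qed.

Lemma Bpoly_dvd t : log_field P' t -> mdvd Bpoly (msub (@restrict_var m) (t ord0)).
Proof. by move=> ht; apply: mdvd_prod => // x xs; apply: fiber_dvd. Qed.

Lemma Bpoly_homog : Bpoly \is (size s - size s'').-homog.
Proof.
have -> : (size s - size s'' = \sum_(x <- s'') (fiber x).-1)%N.
  have -> : size s = (\sum_(x <- s'') fiber x)%N.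
    rewrite /fiber; under eq_bigr do rewrite -sum1_count big_mkcond.
    rewrite exchange_big -sum1_size big_seq [in RHS]big_seq.
    apply: eq_bigr => K Ks; rewrite (bigD1_seq (pr K)) ?pr_s //= eqxx big1 ?addn0 // => x.
    by rewrite eq_sym => /negbTE ->.
  rewrite -(sum1_size s'') -[RHS](addnK (\sum_(x <- s'') 1)%N) -big_split /=.
  congr (_ - _)%N; apply: eq_big_seq => x xs; rewrite addn1 prednK //.
  have [K Ks <-] := s_pr xs.
  by rewrite /fiber -has_count; apply/hasP; exists K.
rewrite /Bpoly; apply: (big_ind2 (fun (q : {mpoly F[m]}) e => q \is e.-homog)).
- exact: dhomog1.
- by move=> x1 y1 x2 y2; apply: dhomogM.
- move=> x _; have := dhomogMn (fiber x).-1 (linear_form_homog (c x)).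
  by rewrite mul1n.
Qed.

Lemma Bpoly_neq0 : Bpoly != 0.
Proof.
rewrite /Bpoly prodf_seq_neq0; apply/allP => x xs /=.
have [j cj] := c0 xs; rewrite expf_neq0 //.
by apply: contraNneq cj => a0; rewrite -linear_form_coef a0 mcoeff0.
Qed.

Lemma restrict_log t : log_field P' t -> msub (@restrict_var m) (t ord0) = 0 ->
  log_field P'' (fun j => msub (@restrict_var m) (t (lift ord0 j))).
Proof.
move=> ht t0 _ [x xs ->]; have [K Ks Kx] := s_pr xs.
have /ht[g] : P' (a K) by exists K.
rewrite pairing_ord0 => /(congr1 (msub (@restrict_var m))).
rewrite linearD linearZ /= t0 scaler0 add0r rmorphM /= restrict_var_linear_form.
have -> : linear_form (fun j => a K (lift ord0 j)) = la K *: linear_form (c x).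
  rewrite /linear_form scaler_sumr; apply: eq_bigr => j _.
  by rewrite aE // Kx scalerA.
have -> : msub (@restrict_var m) (\sum_j a K (lift ord0 j) *: t (lift ord0 j)) =
    la K *: pairing (c x) (fun j => msub (@restrict_var m) (t (lift ord0 j))).
  rewrite linear_sum /pairing scaler_sumr; apply: eq_bigr => j _.
  by rewrite linearZ /= aE // Kx scalerA.
rewrite -scalerAr => /(scalerI (la0 Ks)) ->.
by exists (msub (@restrict_var m) g).
Qed.

Lemma log_field_divX t : log_field P' (fun i => t i * 'X_ord0) -> log_field P' t.
Proof.
move=> ht _ [K Ks ->]; have /ht : P' (a K) by exists K.
have -> : pairing (a K) (fun i => t i * 'X_ord0) = pairing (a K) t * 'X_ord0.
  by rewrite /pairing mulr_suml; apply: eq_bigr => i _; rewrite scalerAl.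
have [j cj] := c0 (pr_s Ks).
have aj : a K (lift ord0 j) != 0 by rewrite aE // mulf_neq0 // la0.
case/(linear_prime aj) => //; rewrite (mdvd_linear _ aj) msubX /solve.
rewrite (negbTE (neq_lift _ _)) mul0r scale0r subr0.
move/(congr1 (mcoeff U_(ord0)))/eqP.
by rewrite mcoeffXU eqxx mcoeff0 oner_eq0.
Qed.

Lemma log_fieldDM n (P : ('I_n -> F) -> Prop) t h t' :
  log_field P t -> log_field P t' -> log_field P (fun j => t j + h * t' j).
Proof.
move=> ht ht' v Pv.
have -> : pairing v (fun j => t j + h * t' j) = pairing v t + h * pairing v t'.
  rewrite /pairing mulr_sumr -big_split; apply: eq_bigr => i _.
  by rewrite scalerDr scalerAr.
by apply: mdvdD; [exact: ht | apply/mdvdMl/ht'].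
Qed.

Lemma restrict_var_homog k (i : 'I_k.+1) : restrict_var i \is 1.-homog.
Proof.
case: (unliftP ord0 i) => [j|] ->; first by rewrite restrict_var_lift homogX.
by rewrite restrict_var0 dhomog0.
Qed.

Lemma homog0C n (p : {mpoly F[n]}) : p \is 0.-homog -> p = (p@_0)%:MP.
Proof.
move=> hp; apply: msize1_polyC; rewrite msizeE; apply/bigmax_leqP_seq => k kp _.
by rewrite (dhomog_mf hp kp).
Qed.

Lemma exists_coef n r dp (dg : 'I_r -> nat) (T : 'I_r -> 'I_n -> {mpoly F[n]}) t c1 :
  (forall i j, T i j \is (dg i).-homog) -> (forall j, t j \is dp.-homog) ->
  (forall j, t j = \sum_i c1 i * T i j) ->
  exists c2 : 'I_r -> {mpoly F[n]}, [/\ forall i, c2 i \is (dp - dg i).-homog,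
    forall i, (dp < dg i)%N -> c2 i = 0 & forall j, t j = \sum_i c2 i * T i j].
Proof.
move=> hT ht tE.
exists (fun i => if (dg i <= dp)%N then pihomog mdeg (dp - dg i) (c1 i) else 0); split.
- by move=> i; case: ifP => _; rewrite ?pihomogP ?dhomog0.
- by move=> i; rewrite ltnNge => /negbTE ->.
- move=> j; rewrite -[LHS](pihomog_dE (ht j)) tE raddf_sum /=; apply: eq_bigr => i _.
  by rewrite (pihomogM _ _ (hT i j)); case: ifP; rewrite ?mul0r.
Qed.

Variable d : nat.
Hypothesis size_s : size s = (size s'' + d)%N.
Variables (r r'' : nat) (dg : 'I_r -> nat) (dg'' : 'I_r'' -> nat).
Hypothesis dg_count : (#|[pred i | (dg i <= d)%N]| = #|[pred k | (dg'' k <= d)%N]|.+1)%N.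
Variable P : ('I_m.+1 -> F) -> Prop.
Hypothesis PE : forall t, log_field P t <-> log_field P' t /\ mdvd 'X_ord0 (t ord0).

Lemma exchange_step (T : 'I_r -> 'I_m.+1 -> {mpoly F[m.+1]}) (c1 : 'I_r -> {mpoly F[m]}) i0 :
  (forall i, log_field P' (T i)) -> (forall i j, T i j \is (dg i).-homog) ->
  (forall t, log_field P' t -> exists c, forall j, t j = \sum_i c i * T i j) ->
  (forall c, (forall j, \sum_i c i * T i j = 0) -> forall i, c i = 0) ->
  (forall i, c1 i \is (dg i - d).-homog) -> (forall i, (dg i < d)%N -> c1 i = 0) ->
  (forall i, msub (@restrict_var m) (T i ord0) = c1 i * Bpoly) ->
  dg i0 = d -> c1 i0 != 0 ->
  free_fields P (fun i => if i == i0 then d.+1 else dg i).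
Proof.
move=> T1 T2 T3 T4 c1h c1s c1E di0 ci0.
have [u u0 cu] : exists2 u, u != 0 & c1 i0 = u%:MP.
  have := c1h i0; rewrite di0 subnn => /homog0C h.
  exists (c1 i0)@_0 => //; apply: contraNneq ci0 => e.
  by rewrite h e mpolyC0.
pose w j := msub (@shift_var m) (u^-1 *: c1 j).
have wi0 : w i0 = 1.
  by rewrite /w cu -mul_mpolyC -mpolyCM mulVf // mpolyC1 rmorph1.
pose T' j k := T j k - w j * T i0 k + ((j == i0)%:R * 'X_ord0) * T i0 k.
have sumT' c2 k : \sum_j c2 j * T' j k =
   \sum_j c2 j * T j k + (c2 i0 * 'X_ord0 - \sum_j c2 j * w j) * T i0 k.
  have -> : \sum_j c2 j * T' j k = \sum_j c2 j * T j k - (\sum_j c2 j * w j) * T i0 k +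
     \sum_j c2 j * ((j == i0)%:R * 'X_ord0) * T i0 k.
    rewrite mulr_suml -sumrB -big_split; apply: eq_bigr => j _ /=.
    by rewrite /T'; ring.
  rewrite [X in _ + X](bigD1 i0) //= eqxx [X in _ + (_ + X)]big1 => [|j /negbTE ->]; last first.
    by rewrite mul0r mulr0 mul0r.
  by rewrite mul1r; ring.
exists T'; split.
- move=> i; apply/PE; split.
    apply: log_fieldDM => //; rewrite -/(w i).
    apply: log_field_eq (log_fieldDM (- w i) (T1 i) (T1 i0)) => j.
    by rewrite mulNr.
  apply/restrict_var_kernel; rewrite /T' linearD linearB /= !rmorphM /= msubX restrict_var0 mulr0 mul0r addr0.
  by rewrite shift_varK !c1E cu mul_mpolyC -scalerAr -scalerAl scalerA mulfV // scale1r subrr.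
- move=> i j; case: eqP => [->|ne]; rewrite /T'.
    rewrite wi0 mul1r subrr add0r eqxx mul1r.
    by have := dhomogM (homogX F (@ord0 m)) (T2 i0 j); rewrite di0.
  have /eqP/negbTE -> := ne; rewrite !mul0r addr0; apply: rpredB; first exact: T2.
  case: (leqP d (dg i)) => [le|lt]; last first.
    by rewrite /w c1s // scaler0 rmorph0 mul0r dhomog0.
  have e : (dg i = (dg i - d) + dg i0)%N by rewrite di0 subnK.
  rewrite e; apply: dhomogM; last exact: T2.
  apply: msub_homog => [k|]; first exact: homogX.
  by apply: dhomogZ; apply: c1h.
- move=> t /PE[/T3 [g gE]] /restrict_var_kernel t0.
  have : \sum_j msub (@restrict_var m) (g j) * c1 j = 0.
    apply: (mulIf Bpoly_neq0); rewrite mul0r -[RHS]t0 gE linear_sum /= mulr_suml.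
    by apply: eq_bigr => j _; rewrite rmorphM /= c1E mulrA.
  move=> gc; have /restrict_var_kernel[h hE] : msub (@restrict_var m) (\sum_j g j * w j) = 0.
    rewrite linear_sum /= -[RHS](scaler0 _ u^-1) -[in RHS]gc scaler_sumr.
    by apply: eq_bigr => j _; rewrite rmorphM /= shift_varK scalerAr.
  pose c' j := if j == i0 then h else g j.
  have c'E X : \sum_j c' j * X j = \sum_j g j * X j + (h - g i0) * X i0.
    rewrite (bigD1 i0) //= [in RHS](bigD1 i0) //= /c' eqxx mulrBl.
    rewrite addrAC subrKC ?addrCA; congr (_ + _).
    by apply: eq_bigr => j /negbTE ->.
  exists c' => k; rewrite sumT' !c'E /= {1}/c' eqxx hE wi0 gE; ring.
- move=> c2 c2E.
  pose e j := c2 j + (j == i0)%:R * (c2 i0 * 'X_ord0 - \sum_j c2 j * w j).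
  have e0 : forall i, e i = 0.
    apply: T4 => k; rewrite -[RHS](c2E k) sumT' /e.
    under eq_bigr do rewrite mulrDl.
    rewrite big_split /=; congr (_ + _).
    rewrite [LHS](bigD1 i0) //= eqxx [X in _ + X = _]big1 => [|j /negbTE ->]; last by rewrite !mul0r.
    by rewrite mul1r addr0.
  have cj j : j != i0 -> c2 j = 0.
    by move=> /negbTE ji; have := e0 j; rewrite /e ji mul0r addr0.
  have ci : c2 i0 = 0.
    have := e0 i0; rewrite /e eqxx mul1r (bigD1 i0) //= big1 => [|j /cj ->]; last by rewrite mul0r.
    rewrite wi0 mulr1 addr0 addrC subrK => /eqP; rewrite mulf_eq0 => /orP[/eqP //|].
    move/eqP/(congr1 (mcoeff U_(ord0)))/eqP.
    by rewrite mcoeffXU eqxx mcoeff0 oner_eq0.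
  by move=> i; have [->|/cj] := eqVneq i i0.
Qed.

(* Otherwise the basis fields of degree at most [d] restrict to the hyperplane; there is
   one more of them than of basis fields of degree at most [d] there, so they satisfy
   a relation, which lifts to a multiple of 'X_ord0. *)
Lemma no_drop (T : 'I_r -> 'I_m.+1 -> {mpoly F[m.+1]}) :
  (forall i, log_field P' (T i)) -> (forall i j, T i j \is (dg i).-homog) ->
  (forall t, log_field P' t -> exists c, forall j, t j = \sum_i c i * T i j) ->
  (forall c, (forall j, \sum_i c i * T i j = 0) -> forall i, c i = 0) ->
  free_fields P'' dg'' ->
  ~ (forall i, (dg i <= d)%N -> msub (@restrict_var m) (T i ord0) = 0).
Proof.
move=> T1 T2 T3 T4 [U [U1 U2 U3 U4]] T0.
have /fin_all_exists[M hM] (i : 'I_r) : exists M : 'I_r'' -> {mpoly F[m]},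
    (dg i <= d)%N -> (forall k, (dg i < dg'' k)%N -> M k = 0) /\
      forall j, msub (@restrict_var m) (T i (lift ord0 j)) = \sum_k M k * U k j.
  case: (leqP (dg i) d) => le; last by exists (fun=> 0).
  have [M ME] := U3 _ (restrict_log (T1 i) (T0 i le)).
  have ht j : msub (@restrict_var m) (T i (lift ord0 j)) \is (dg i).-homog.
    by apply: msub_homog => //; apply: restrict_var_homog.
  by have [M' [_ M'0 M'E]] := exists_coef U2 ht ME; exists M'.
have [|f [[i0 fi0] fA fB]] := nontrivial_relation (A := [pred i | (dg i <= d)%N])
    (B := [pred k | (dg'' k <= d)%N]) M; first by rewrite dg_count.
pose t j := \sum_i msub (@shift_var m) (f i) * T i j.
have rt j : msub (@restrict_var m) (t j) = 0.
  have -> : msub (@restrict_var m) (t j) = \sum_i f i * msub (@restrict_var m) (T i j).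
    by rewrite linear_sum; apply: eq_bigr => i _; rewrite rmorphM /= shift_varK.
  case: (unliftP ord0 j) => [j'|] ->; last first.
    rewrite big1 // => i _; case: (leqP (dg i) d) => le; first by rewrite T0 // mulr0.
    by rewrite fA ?mul0r // inE -ltnNge.
  have -> : \sum_i f i * msub (@restrict_var m) (T i (lift ord0 j')) =
      \sum_k (\sum_i f i * M i k) * U k j'.
    under [RHS]eq_bigr do rewrite mulr_suml.
    rewrite exchange_big; apply: eq_bigr => i _ /=.
    case: (leqP (dg i) d) => le.
      by rewrite (hM i le).2 mulr_sumr; apply: eq_bigr => k _; rewrite mulrA.
    rewrite fA ?inE -?ltnNge // mul0r big1 // => k _.
    by rewrite !mul0r.
  rewrite big1 // => k _; case: (leqP (dg'' k) d) => le; first by rewrite fB ?mul0r.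
  rewrite big1 ?mul0r // => i _; case: (leqP (dg i) d) => le'; last first.
    by rewrite fA ?mul0r // inE -ltnNge.
  by rewrite (hM i le').1 ?mulr0 // (leq_ltn_trans le' le).
have /fin_all_exists[q qE] j : exists q, t j = q * 'X_ord0 by apply/restrict_var_kernel.
have /T3[g gE] : log_field P' q.
  apply: log_field_divX; apply: (log_field_eq qE).
  exact: log_field_sum.
have /(_ i0)/eqP : forall i, msub (@shift_var m) (f i) - g i * 'X_ord0 = 0.
  apply: T4 => j; under eq_bigr do rewrite mulrBl.
  rewrite sumrB -/(t j) qE gE mulr_suml -sumrB big1 // => i _.
  by rewrite mulrAC subrr.
rewrite subr_eq0 => /eqP /(congr1 (msub (@restrict_var m))).
rewrite shift_varK rmorphM /= msubX restrict_var0 mulr0 => f0.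
by rewrite f0 eqxx in fi0.
Qed.

Theorem addition : free_fields P' dg -> free_fields P'' dg'' ->
  exists2 i0, dg i0 = d & free_fields P (fun i => if i == i0 then d.+1 else dg i).
Proof.
move=> [T [T1 T2 T3 T4]] fU.
have /fin_all_exists[c1 hc1] (i : 'I_r) : exists c : {mpoly F[m]},
    [/\ c \is (dg i - d).-homog, (dg i < d)%N -> c = 0
      & msub (@restrict_var m) (T i ord0) = c * Bpoly].
  have [C CE] := Bpoly_dvd (T1 i).
  exists (if (d <= dg i)%N then pihomog mdeg (dg i - d) C else 0); split.
  - by case: ifP => _; rewrite ?pihomogP ?dhomog0.
  - by rewrite ltnNge => /negbTE ->.
  - have h : msub (@restrict_var m) (T i ord0) \is (dg i).-homog.
      by apply: msub_homog => //; apply: restrict_var_homog.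
    have hB : Bpoly \is d.-homog by have := Bpoly_homog; rewrite size_s addKn.
    by rewrite -(pihomog_dE h) CE (pihomogM _ _ hB); case: ifP; rewrite ?mul0r.
have [/existsP[i0 /andP[/eqP di0 ci0]]|/existsPn no] :=
    boolP [exists i, (dg i == d) && (c1 i != 0)].
  exists i0 => //; apply: (exchange_step T1 T2 T3 T4 (c1 := c1)) => // i;
    by case: (hc1 i).
case: (no_drop T1 T2 T3 T4 fU) => i; rewrite leq_eqVlt => le.
have [_ lt0 ->] := hc1 i; case/orP: le => [di|/lt0 ->]; last by rewrite mul0r.
by have := no i; rewrite di /= negbK => /eqP ->; rewrite mul0r.
Qed.

End Addition.
End VectorFields.

(** * Derivations and change of coordinates *)

Section Derivations.
Variable F : fieldType.

Definition field_derivation n (t : 'I_n -> {mpoly F[n]}) (f : {mpoly F[n]}) :=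
  \sum_i f^`M(i) * t i.

Lemma field_derivationP n (t : 'I_n -> {mpoly F[n]}) : derivation (field_derivation t).
Proof.
rewrite /field_derivation; split=> [k f g|f g].
  rewrite scaler_sumr -big_split; apply: eq_bigr => i _ /=.
  by rewrite mderivD mderivZ mulrDl scalerAl.
rewrite mulr_suml mulr_sumr -big_split; apply: eq_bigr => i _ /=.
by rewrite mderivM; ring.
Qed.

Lemma field_derivationX n (t : 'I_n -> {mpoly F[n]}) j : field_derivation t 'X_j = t j.
Proof.
rewrite /field_derivation (bigD1 j) //= big1 ?addr0 => [|i ij].
  rewrite mderivX mnm1E eqxx; have -> : (U_(j) - U_(j) = 0)%MM by apply/mnmP => k; rewrite mnmBE subnn mnm0E.
  by rewrite mpolyX0 scale1r mul1r.
by rewrite mderivX mnm1E eq_sym (negbTE ij) scale0r mul0r.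
Qed.

Lemma derivationE n (theta : {mpoly F[n]} -> {mpoly F[n]}) : derivation theta ->
  theta =1 field_derivation (fun i => theta 'X_i).
Proof.
move=> [lin leib]; have [lin' leib'] := field_derivationP (fun i => theta 'X_i).
have addE (eta : {mpoly F[n]} -> {mpoly F[n]}) : linear eta -> forall f g, eta (f + g) = eta f + eta g.
  by move=> l f g; have := l 1 f g; rewrite !scale1r.
have oneE (eta : {mpoly F[n]} -> {mpoly F[n]}) : derivation eta -> forall c, eta c%:MP = 0.
  move=> [l m] c.
  have e0 : eta 0 = 0 by have /eqP := addE _ l 0 0; rewrite addr0 -subr_eq subrr => /eqP <-.
  have e1 : eta 1 = 0.
    by have /eqP := m 1 1; rewrite mulr1 mul1r mulr1 -subr_eq subrr => /eqP <-.
  by have := l c 1 0; rewrite addr0 e0 e1 scaler0 addr0 -mul_mpolyC mulr1.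
elim/mpoly_alg_ind => [c|i|p q IHp IHq|p q IHp IHq].
- by rewrite !oneE // ; split.
- by rewrite field_derivationX.
- by rewrite !addE // IHp IHq.
- by rewrite leib leib' IHp IHq.
Qed.

Lemma field_derivation_linear n (t : 'I_n -> {mpoly F[n]}) a :
  field_derivation t (linear_form a) = pairing a t.
Proof.
have [lin _] := field_derivationP t; rewrite /linear_form /pairing.
have add0 : field_derivation t 0 = 0.
  by rewrite /field_derivation big1 // => i _; rewrite mderiv0 mul0r.
elim: (index_enum _) => [|i s IH]; first by rewrite !big_nil.
by rewrite !big_cons lin IH field_derivationX.
Qed.

Lemma free_fields_perm n (P : ('I_n -> F) -> Prop) r (dg : 'I_r -> nat) e :
  perm_eq e [seq dg i | i <- enum 'I_r] -> free_fields P dg ->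
  free_fields P (fun i : 'I_(size e) => nth 0%N e i).
Proof.
move=> pe; have er : r = size e by rewrite (perm_size pe) size_map size_enum_ord.
subst r; have pe' : perm_eq (in_tuple e) [tuple dg i | i < size e].
  exact: pe.
have /tuple_permP[p pE] := pe'.
have eE (i : 'I_(size e)) : nth 0%N e i = dg (p i).
  have /(congr1 (fun s => nth 0%N s i)) := pE.
  by rewrite /= => ->; rewrite (nth_map i) ?size_enum_ord // tnth_mktuple nth_ord_enum.
move=> [T [T1 T2 T3 T4]]; exists (fun i => T (p i)); split.
- by move=> i; apply: T1.
- by move=> i j; rewrite eE; apply: T2.
- move=> t /T3[c cE]; exists (fun i => c (p i)) => j.
  by rewrite cE (reindex_inj (@perm_inj _ p)).
- move=> c cE i; rewrite -(permK p i) ; apply: (T4 (fun i => c ((p^-1)%g i))) => j.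
  rewrite (reindex_inj (@perm_inj _ p)) -[RHS](cE j); apply: eq_bigr => k _ /=.
  by rewrite permK.
Qed.

End Derivations.

Section Coordinates.
Variables (F : fieldType) (V : vectType F).
Implicit Types (W H K X : {vspace V}) (A : {fset {vspace V}}).

Definition has_form W n (b : n.-tuple V) H (a : 'I_n -> F) : Prop :=
  forall v, (v \in H) = (v \in W) && (\sum_i a i * coord b i v == 0).

Definition forms W A n (b : n.-tuple V) (a : 'I_n -> F) : Prop :=
  exists2 H, H \in A & has_form W b H a.

Definition free_arr W A (e : seq nat) :=
  forall n (b : n.-tuple V), basis_of W b ->
    free_fields (forms W A b) (fun i : 'I_(size e) => nth 0%N e i).

Lemma free_arrW W A e : free_arr W A e -> free_with_exponents W A e.
Proof.
move=> /(_ _ _ (vbasisP W)) [T [T1 T2 T3 T4]].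
exists (vbasis W), (fun i => field_derivation (T i)); split.
- exact: vbasisP.
- split=> [i|eta [deta eta_log]].
    split; first exact: field_derivationP.
    move=> H a HA Ha; rewrite field_derivation_linear.
    by apply: T1; exists H.
  have [c cE] : exists c, forall j, eta 'X_j = \sum_i c i * T i j.
    apply: T3 => a [H HA Ha]; rewrite -field_derivation_linear -derivationE //.
    exact: eta_log Ha.
  exists [ffun i => c i]; split.
    move=> f; rewrite derivationE // /field_derivation.
    under eq_bigr do rewrite cE mulr_sumr.
    rewrite exchange_big; apply: eq_bigr => i _ /=.
    by rewrite ffunE mulr_sumr; apply: eq_bigr => j _; ring.
  move=> c' c'E; apply/ffunP => i; rewrite ffunE.
  apply/eqP; rewrite -subr_eq0; apply/eqP.
  apply: (T4 (fun i => c i - c' i)) => j.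
  under eq_bigr do rewrite mulrBl.
  rewrite sumrB -cE c'E; apply/eqP; rewrite subr_eq0; apply/eqP.
  by apply: eq_bigr => k _; rewrite field_derivationX.
- by move=> i j; rewrite field_derivationX.
Qed.

Definition coord_map n (b b' : n.-tuple V) (i : 'I_n) :=
  linear_form (fun j : 'I_n => coord b i b'`_j).

Definition transport n (b b' : n.-tuple V) (t : 'I_n -> {mpoly F[n]}) (j : 'I_n) : {mpoly F[n]} :=
  \sum_(i < n) coord b' j b`_i *: msub (coord_map b b') (t i).

Lemma mem_basis W n (b : n.-tuple V) (i : 'I_n) : basis_of W b -> b`_i \in W.
Proof. by move=> bW; apply: (basis_mem bW); rewrite mem_nth // size_tuple. Qed.

Lemma coord_change W n (b b' : n.-tuple V) (i : 'I_n) v :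
  basis_of W b' -> v \in W -> coord b i v = \sum_j coord b' j v * coord b i b'`_j.
Proof.
move=> b'W vW; rewrite {1}(coord_basis b'W vW) linear_sum.
by apply: eq_bigr => j _; rewrite linearZ.
Qed.

Lemma coord_delta W n (b b' : n.-tuple V) (i k : 'I_n) : basis_of W b -> basis_of W b' ->
  \sum_j coord b' j b`_k * coord b i b'`_j = (k == i)%:R.
Proof.
move=> bW b'W; rewrite -(coord_change b i b'W); last by apply: (mem_basis k bW).
by rewrite coord_free ?(basis_free bW).
Qed.

Lemma coord_mapK W n (b b' : n.-tuple V) : basis_of W b -> basis_of W b' ->
  cancel (msub (coord_map b b')) (msub (coord_map b' b)).
Proof.
move=> bW b'W p; rewrite msub_comp msub_id // => i.
rewrite /coord_map msub_linear_form /linear_form.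
under eq_bigr do rewrite scaler_sumr.
rewrite exchange_big (bigD1 i) //= [X in _ + X]big1 => [|k ki].
  under eq_bigr do rewrite scalerA mulrC.
  by rewrite -scaler_suml (coord_delta _ _ bW b'W) eqxx scale1r addr0.
under eq_bigr do rewrite scalerA mulrC.
by rewrite -scaler_suml (coord_delta _ _ bW b'W) (negbTE ki) scale0r.
Qed.

Lemma transportK W n (b b' : n.-tuple V) t : basis_of W b -> basis_of W b' ->
  transport b' b (transport b b' t) =1 t.
Proof.
move=> bW b'W i; rewrite /transport.
under eq_bigr do rewrite [msub _ _]linear_sum scaler_sumr /=.
rewrite exchange_big (bigD1 i) //= [X in _ + X]big1 => [|k ki].
  under eq_bigr do rewrite [msub _ _]linearZ /= (coord_mapK bW b'W) scalerA mulrC.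
  by rewrite -scaler_suml (coord_delta _ _ bW b'W) eqxx scale1r addr0.
under eq_bigr do rewrite [msub _ _]linearZ /= (coord_mapK bW b'W) scalerA mulrC.
by rewrite -scaler_suml (coord_delta _ _ bW b'W) (negbTE ki) scale0r.
Qed.

Lemma transport_sum n (b b' : n.-tuple V) r (c : 'I_r -> {mpoly F[n]}) T j :
  transport b b' (fun j => \sum_i c i * T i j) j =
  \sum_i msub (coord_map b b') (c i) * transport b b' (T i) j.
Proof.
rewrite /transport; under eq_bigr do rewrite [msub _ _]linear_sum scaler_sumr /=.
rewrite exchange_big; apply: eq_bigr => i _; rewrite mulr_sumr.
by apply: eq_bigr => k _; rewrite rmorphM scalerAr.
Qed.

Lemma transport_eq n (b b' : n.-tuple V) t t' :
  t =1 t' -> transport b b' t =1 transport b b' t'.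
Proof. by move=> e j; apply: eq_bigr => i _; rewrite e. Qed.

Lemma transport_log W A n (b b' : n.-tuple V) t : basis_of W b -> basis_of W b' ->
  log_field (forms W A b) t -> log_field (forms W A b') (transport b b' t).
Proof.
move=> bW b'W ht a' [H HA Ha'].
pose a (i : 'I_n) := \sum_j a' j * coord b' j b`_i.
have aE (j : 'I_n) : \sum_i a i * coord b i b'`_j = a' j.
  rewrite /a; under eq_bigr do rewrite mulr_suml.
  rewrite exchange_big (bigD1 j) //= [X in _ + X]big1 => [|k kj].
    under eq_bigr do rewrite -mulrA [coord b' _ _ * _]mulrC.
    by rewrite -mulr_sumr (coord_delta _ _ b'W bW) eqxx mulr1 addr0.
  under eq_bigr do rewrite -mulrA [coord b' _ _ * _]mulrC.
  by rewrite -mulr_sumr (coord_delta _ _ b'W bW) eq_sym (negbTE kj) mulr0.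
have /ht[g gE] : forms W A b a.
  exists H => // v; rewrite Ha'; case vW: (v \in W) => //=; congr (_ == _).
  rewrite /a; under [RHS]eq_bigr do rewrite mulr_suml.
  rewrite exchange_big; apply: eq_bigr => j _ /=.
  rewrite (coord_change b' j bW vW) mulr_sumr; apply: eq_bigr => i _.
  by rewrite -mulrA [coord b' _ _ * _]mulrC.
exists (msub (coord_map b b') g).
have -> : linear_form a' = msub (coord_map b b') (linear_form a).
  rewrite msub_linear_form /coord_map /linear_form.
  under [RHS]eq_bigr do rewrite scaler_sumr.
  rewrite exchange_big; apply: eq_bigr => j _ /=.
  by under eq_bigr do rewrite scalerA; rewrite -scaler_suml aE.
rewrite -rmorphM -gE /= [msub _ _]linear_sum /=.
rewrite /pairing /transport; under [LHS]eq_bigr do rewrite scaler_sumr.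
rewrite exchange_big; apply: eq_bigr => i _ /=.
by under [LHS]eq_bigr do rewrite scalerA; rewrite -scaler_suml [msub _ (_ *: _)]linearZ.
Qed.

Lemma transport_homog n (b b' : n.-tuple V) d t :
  (forall i, t i \is d.-homog) -> forall j, transport b b' t j \is d.-homog.
Proof.
move=> ht j; apply: rpred_sum => i _; apply: dhomogZ.
by apply: msub_homog => // k; apply: linear_form_homog.
Qed.

Lemma free_fields_basis W A n (b b' : n.-tuple V) r (dg : 'I_r -> nat) :
  basis_of W b -> basis_of W b' ->
  free_fields (forms W A b) dg -> free_fields (forms W A b') dg.
Proof.
move=> bW b'W [T [T1 T2 T3 T4]].
exists (fun i => transport b b' (T i)); split.
- by move=> i; apply: (transport_log bW b'W).
- by move=> i; apply: transport_homog.
- move=> t /(transport_log b'W bW)/T3[c cE].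
  exists (fun i => msub (coord_map b b') (c i)) => j.
  rewrite -transport_sum -(transportK t b'W bW) .
  exact: transport_eq.
- move=> c cE i; rewrite -(coord_mapK b'W bW (c i)).
  rewrite (T4 (fun i => msub (coord_map b' b) (c i))) ?rmorph0 // => j.
  transitivity (transport b' b (fun j => \sum_i c i * transport b b' (T i) j) j).
    rewrite transport_sum; apply: eq_bigr => k _; congr (_ * _).
    by rewrite (transportK _ bW b'W).
  rewrite (transport_eq _ _ (cE : _ =1 fun=> 0)) /transport big1 // => k _.
  by rewrite rmorph0 scaler0.
Qed.

End Coordinates.

Lemma seq_choice (T : eqType) (U : Type) (P : T -> U -> Prop) (u0 : U) (s : seq T) :
  {in s, forall x, exists u, P x u} -> exists f, {in s, forall x, P x (f x)}.
Proof.
elim: s => [|x s IH] h; first by exists (fun=> u0).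
have [y ys|f fP] := IH; first by apply: h; rewrite in_cons ys orbT.
have [u Pu] := h x (mem_head _ _).
exists (fun y => if y == x then u else f y) => y.
by rewrite in_cons; case: eqP => [-> //|_] /= /fP.
Qed.

Section Hyperplanes.
Variables (F : fieldType) (V : vectType F).
Implicit Types (W H K X : {vspace V}) (A : {fset {vspace V}}) (g h : 'Hom(V, F^o)).

Definition hyperplane_of W K (g : 'Hom(V, F^o)) := K = (W :&: lker g)%VS /\ ~~ (W <= lker g)%VS.

Lemma hyperplane_witness W (g : 'Hom(V, F^o)) : ~~ (W <= lker g)%VS -> exists2 u, u \in W & g u != 0.
Proof. by case/subvPn => u uW; rewrite memv_ker => gu; exists u. Qed.

Lemma hyperplane_decomp W (g : 'Hom(V, F^o)) u v : u \in W -> g u != 0 -> v \in W ->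
  v - (g v / g u) *: u \in (W :&: lker g)%VS.
Proof.
move=> uW gu vW; rewrite memv_cap memvB ?memvZ //= memv_ker linearB linearZ /=.
by rewrite /GRing.scale /= divfK // subrr.
Qed.

Lemma hyperplane_dim W K g : hyperplane_of W K g -> (\dim K).+1 = \dim W.
Proof.
move=> [-> /hyperplane_witness[u uW gu]].
have WE : W = ((W :&: lker g) + <[u]>)%VS.
  apply/eqP; rewrite eqEsubv; apply/andP; split; last first.
    by rewrite subv_add capvSl -memvE.
  apply/subvP => v vW; rewrite -[v](subrK ((g v / g u) *: u)).
  by rewrite memv_add ?hyperplane_decomp // memvZ // memv_line.
rewrite [in RHS]WE dimv_disjoint_sum; last first.
  apply/eqP; rewrite -subv0; apply/subvP => v; rewrite !memv_cap => /andP[].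
  case/andP=> _; rewrite memv_ker => gv /vlineP[k vk]; move: gv.
  have -> : (g v == 0) = (k == 0) by rewrite vk linearZ mulf_eq0 (negbTE gu) orbF.
  by rewrite vk => /eqP ->; rewrite scale0r mem0v.
have u0 : u != 0 by apply: contraNneq gu => ->; rewrite linear0.
by rewrite dim_vline u0 addn1.
Qed.

Lemma hyperplane_sub W K L g h : hyperplane_of W K g -> hyperplane_of W L h ->
  (K <= L)%VS -> K = L.
Proof.
move=> hK hL KL; apply/eqP; rewrite eqEdim KL /= -ltnS.
by rewrite (hyperplane_dim hK) (hyperplane_dim hL).
Qed.

Lemma hyperplane_proportional W K g (h : V -> F) : hyperplane_of W K g ->
  linear (h : V -> F^o) -> (forall v, v \in K -> h v = 0) ->
  exists k, forall v, v \in W -> h v = k * g v.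
Proof.
move=> [-> /hyperplane_witness[u uW gu]] lh h0; exists (h u / g u) => v vW.
have := lh (- (g v / g u)) u v.
have -> : - (g v / g u) *: u + v = v - (g v / g u) *: u by rewrite scaleNr addrC.
rewrite h0 ?hyperplane_decomp // => /esym/eqP; rewrite addrC scaleNr subr_eq0 => /eqP ->.
by rewrite -[LHS]/(g v / g u * h u) mulrC mulrA mulrAC.
Qed.

Section Basis.
Variables (W : {vspace V}) (n : nat) (b : n.-tuple V).
Hypothesis bW : basis_of W b.

Definition values (g : 'Hom(V, F^o)) (i : 'I_n) : F := g b`_i.

Lemma valuesE g v : v \in W -> g v = \sum_i values g i * coord b i v.
Proof.
move=> vW; rewrite {1}(coord_basis bW vW) linear_sum; apply: eq_bigr => i _.
by rewrite linearZ mulrC.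
Qed.

Lemma values_form K g : hyperplane_of W K g -> has_form W b K (values g).
Proof.
move=> [-> _] v; rewrite memv_cap memv_ker; case vW: (v \in W) => //=.
by rewrite -valuesE.
Qed.

Lemma form_values K g a : hyperplane_of W K g -> has_form W b K a ->
  exists2 k, k != 0 & forall i, a i = k * values g i.
Proof.
move=> hK aK.
pose h v : F^o := \sum_i a i * coord b i v.
have lh : linear h.
  move=> k u v; rewrite /h scaler_sumr -big_split; apply: eq_bigr => i _ /=.
  by rewrite linearP /GRing.scale /=; ring.
have [v|k hk] := hyperplane_proportional hK lh.
  by rewrite aK => /andP[_ /eqP].
have hb (i : 'I_n) : h b`_i = a i.
  rewrite /h (bigD1 i) //= coord_free ?(basis_free bW) // eqxx mulr1 big1 ?addr0 // => j ji.
  by rewrite coord_free ?(basis_free bW) // eq_sym (negbTE ji) mulr0.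
exists k; last by move=> i; rewrite -hb hk // (mem_basis i bW).
apply/eqP => k0; have [KE /hyperplane_witness[u uW gu]] := hK.
have : u \in K by rewrite aK uW -/(h u) hk // k0 mul0r eqxx.
by rewrite KE memv_cap memv_ker (negbTE gu) andbF.
Qed.

Lemma form_log K g t : hyperplane_of W K g ->
  (forall a, has_form W b K a -> mdvd (linear_form a) (pairing a t)) <->
  mdvd (linear_form (values g)) (pairing (values g) t).
Proof.
move=> hK; split=> [h|h a /(form_values hK)[k k0 aE]]; first exact/h/values_form.
have -> : linear_form a = k *: linear_form (values g).
  by rewrite /linear_form scaler_sumr; apply: eq_bigr => i _; rewrite aE scalerA.
have -> : pairing a t = k *: pairing (values g) t.
  by rewrite /pairing scaler_sumr; apply: eq_bigr => i _; rewrite aE scalerA.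
by apply/mdvdZ => //; apply: mdvdZr.
Qed.

Lemma values_not_prop K L g h : hyperplane_of W K g -> hyperplane_of W L h -> K != L ->
  not_prop (values g) (values h).
Proof.
move=> hK hL KL k e; case/eqP: KL; apply: (hyperplane_sub hK hL).
have [-> _] := hK; have [-> _] := hL; apply/subvP => v; rewrite !memv_cap !memv_ker.
case/andP=> vW /eqP gv; rewrite vW valuesE //.
under eq_bigr do rewrite e -mulrA.
by rewrite -mulr_sumr -valuesE // gv mulr0 eqxx.
Qed.

Lemma values_neq0 K g : hyperplane_of W K g -> exists i, values g i != 0.
Proof.
move=> [_ /hyperplane_witness[u uW gu]]; apply/existsP; apply: contraNT gu => /existsPn g0.
rewrite valuesE // big1 // => i _; have := g0 i; rewrite negbK => /eqP ->.
by rewrite mul0r.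
Qed.

End Basis.

Definition hyperplanes W A := forall K, K \in A -> exists g, hyperplane_of W K g.

Lemma hyperplanesD1 W A H : hyperplanes W A -> hyperplanes W (A `\ H)%fset.
Proof. by move=> hA K; rewrite in_fsetD1 => /andP[_ /hA]. Qed.

Lemma restrictionP A X K :
  reflect (exists2 H, H \in A & ~~ (X <= H)%VS /\ K = (H :&: X)%VS) (K \in restriction A X).
Proof.
rewrite /restriction; apply: (iffP (imfsetP _ _ _ _)) => /=.
  by move=> [H]; rewrite !inE => /andP[HA HX] ->; exists H.
by move=> [H HA [HX ->]]; exists H; rewrite // !inE HA.
Qed.

Lemma hyperplanes_restriction W A H : (H <= W)%VS -> hyperplanes W A ->
  hyperplanes H (restriction A H).
Proof.
move=> HW hA _ /restrictionP[K KA [HK ->]]; have [g [KE gW]] := hA K KA.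
exists g; split.
  apply/vspaceP => v; rewrite KE !memv_cap; case vH: (v \in H); rewrite ?andbF //=.
  by rewrite (subvP HW) // andbT.
by apply: contra HK => h; rewrite KE subv_cap HW.
Qed.

Lemma basis_extend W H g u m (b : m.-tuple V) : hyperplane_of W H g ->
  u \in W -> g u != 0 -> basis_of H b -> basis_of W (cons_tuple u b).
Proof.
move=> hH uW gu bH; rewrite basisEdim size_tuple -(hyperplane_dim hH).
have -> : \dim H = m by rewrite (vector.size_basis bH).
rewrite span_cons (span_basis bH) leqnn andbT.
apply/subvP => v vW; rewrite -[v](subrK ((g v / g u) *: u)) addrC.
have [HE _] := hH; rewrite memv_add ?memvZ ?memv_line //.
by rewrite HE hyperplane_decomp.
Qed.

Lemma card_nth_leq (e : seq nat) d :
  #|[pred i : 'I_(size e) | (nth 0%N e i <= d)%N]| = count (fun x => (x <= d)%N) e.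
Proof.
by rewrite -sum1_card -sum1_count (big_nth 0%N) big_mkord.
Qed.

Lemma perm_exchange (e e'' : seq nat) d (i0 : 'I_(size e)) :
  perm_eq e (d :: e'') -> nth 0%N e i0 = d ->
  perm_eq (d.+1 :: e'') [seq if i == i0 then d.+1 else nth 0%N e i | i <- enum 'I_(size e)].
Proof.
move=> /seq.permP pe ei0; apply/seq.permP => p.
have cE : count p e = (\sum_(i < size e) p (nth 0 e i))%N.
  by rewrite -sum1_count (big_nth 0%N) big_mkord big_mkcond.
have := pe p; rewrite cE (bigD1 i0) //= ei0 => /eqP; rewrite eqn_add2l => /eqP <-.
rewrite count_map -sum1_count big_enum_cond [RHS]big_mkcond [RHS](bigD1 i0) //= eqxx.
congr (_ + _)%N.
by apply: eq_bigr => i /negbTE ->; case: (p _).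
Qed.

Lemma free_arr_addition W A H d e' e'' e :
  hyperplanes W A -> H \in A -> free_arr W (A `\ H)%fset e' ->
  free_arr H (restriction A H) e'' -> perm_eq e' (d :: e'') ->
  sumn e' = #|` (A `\ H)%fset| -> sumn e'' = #|` restriction A H| ->
  perm_eq e (d.+1 :: e'') -> free_arr W A e.
Proof.
move=> hA HA fA' fH pe' se' se'' pe.
have [gf gfP] : exists f, {in A, forall K, hyperplane_of W K (f K)}.
  by apply: (seq_choice (0 : 'Hom(V, F^o))) => K /hA.
have hH := gfP _ HA; have [HE /hyperplane_witness[u uW gu]] := hH.
have HW : (H <= W)%VS by rewrite HE capvSl.
have [hf hfP] : exists f, {in restriction A H, forall K, hyperplane_of H K (f K)}.
  by apply: (seq_choice (0 : 'Hom(V, F^o))); apply: hyperplanes_restriction hA.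
have gH0 v : v \in H -> gf H v = 0.
  by rewrite {1}HE memv_cap memv_ker => /andP[_ /eqP].
pose b2 := vbasis H; have bH : basis_of H b2 := vbasisP H.
pose b := cons_tuple u b2; have bW : basis_of W b := basis_extend hH uW gu bH.
have vb0 g : values b g ord0 = g u by [].
have vb1 g j : values b g (lift ord0 j) = values b2 g j by [].
have KH K : K \in (A `\ H)%fset -> K \in A /\ hyperplane_of H (K :&: H)%VS (gf K).
  rewrite in_fsetD1 => /andP[KneH KA]; split=> //.
  have [KE _] := gfP _ KA; split.
    apply/vspaceP => v; rewrite {1}KE !memv_cap; case vH: (v \in H); rewrite ?andbF //=.
    by rewrite (subvP HW) // andbT.
  apply: contra KneH => h; rewrite eq_sym; apply/eqP.
  by apply: (hyperplane_sub hH (gfP _ KA)); rewrite KE subv_cap HW.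
have KHr K : K \in (A `\ H)%fset -> (K :&: H)%VS \in restriction A H.
  move=> /KH[KA [KHE nH]]; apply/restrictionP; exists K => //; split=> //.
  apply: contra nH => HK; have : (H <= K :&: H)%VS by rewrite subv_cap HK subvv.
  by rewrite KHE subv_cap => /andP[].
have [la laP] : exists la : {vspace V} -> F, {in (A `\ H)%fset, forall K, la K != 0 /\
    forall j, values b2 (gf K) j = la K * values b2 (hf (K :&: H)%VS) j}.
  apply: (@seq_choice _ F (fun K k => k != 0 /\
    forall j, values b2 (gf K) j = k * values b2 (hf (K :&: H)%VS) j) 0
    (A `\ H)%fset) => K KA; have [_ hK] := KH _ KA.
  have [k k0 kE] := form_values bH (hfP _ (KHr _ KA)) (values_form bH hK).
  by exists k.
have dA : #|` (A `\ H)%fset| = (#|` restriction A H| + d)%N.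
  by rewrite -se' -se'' (perm_sumn pe') /= addnC.
pose s := enum_fset (A `\ H)%fset; pose s'' := enum_fset (restriction A H).
have sP K : K \in s -> K \in (A `\ H)%fset by [].
have hs K : K \in s -> hyperplane_of W K (gf K) by move=> /sP /KH [/gfP].
have formsE t : log_field (forms W (A `\ H)%fset b) t <->
    log_field (fun v => exists2 K, K \in s & v = values b (gf K)) t.
  split=> [h _ [K Ks ->]|h a [K Ks Ka]].
    by apply: h; exists K => //; apply: (values_form bW (hs K Ks)).
  by apply: ((form_log bW t (hs K Ks)).2 _ a Ka); apply: h; exists K.
have formsE'' t : log_field (forms H (restriction A H) b2) t <->
    log_field (fun v => exists2 K, K \in s'' & v = values b2 (hf K)) t.
  split=> [h _ [K Ks ->]|h a [K Ks Ka]].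
    by apply: h; exists K => //; apply: (values_form bH (hfP K Ks)).
  by apply: ((form_log bH t (hfP K Ks)).2 _ a Ka); apply: h; exists K.
have HX t : mdvd (linear_form (values b (gf H))) (pairing (values b (gf H)) t) <->
    mdvd 'X_ord0 (t ord0).
  have v0 (j : 'I_(\dim H)) : values b (gf H) (lift ord0 j) = 0.
    by apply: gH0; apply: mem_basis bH.
  have -> : linear_form (values b (gf H)) = gf H u *: 'X_ord0.
    rewrite /linear_form big_ord_recl big1 ?addr0 // => j _.
    by rewrite v0 scale0r.
  have -> : pairing (values b (gf H)) t = gf H u *: t ord0.
    rewrite /pairing big_ord_recl big1 ?addr0 // => j _.
    by rewrite v0 scale0r.
  rewrite mdvdZ //; split; last exact: mdvdZr.
  by move/(mdvdZr (gf H u)^-1); rewrite scalerA mulVf // scale1r.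
have PE t : log_field (forms W A b) t <->
    log_field (fun v => exists2 K, K \in s & v = values b (gf K)) t /\ mdvd 'X_ord0 (t ord0).
  split=> [h|[h1 h2] a [K KA Ka]].
    split; last first.
      by apply/HX; apply/(form_log bW t hH) => a Ha; apply: h; exists H.
    apply/formsE => a [K Ks Ka]; apply: h; exists K => //.
    by move: Ks; rewrite in_fsetD1 => /andP[].
  have [KH'|KH'] := eqVneq K H.
    by apply: ((form_log bW t hH).2 _ a); [exact/HX | move: Ka; rewrite KH'].
  by have /formsE := h1; apply; exists K => //; rewrite in_fsetD1 KH'.
have [|||||i0 ei0 fr] := addition (s := s) (s'' := s'') (a := fun K => values b (gf K))
  (c := fun K => values b2 (hf K)) (pr := fun K => (K :&: H)%VS) (fset_uniq _) (fset_uniq _)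
  (fun K KA => (laP K KA).1) (fun K KA => (laP K KA).2) KHr _ _ _ _ dA _ PE (free_fields_eq formsE (fA' _ _ bW)) (free_fields_eq formsE'' (fH _ _ bH)).
- move=> x /restrictionP[K KA [nH ->]]; exists K => //.
  by rewrite /s in_fsetD1 KA andbT; apply: contraNneq nH => ->.
- by move=> x xs; apply: values_neq0 bH _ _ (hfP x xs).
- by move=> K L Ks Ls KL; apply: (values_not_prop bW (hs K Ks) (hs L Ls)).
- by move=> K L Ks Ls KL; apply: (values_not_prop bH (hfP K Ks) (hfP L Ls)).
- rewrite !card_nth_leq; have /seq.permP -> := pe'.
  by rewrite /= leqnn.
move=> n b' b'W; have en : n = (\dim H).+1.
  by rewrite (hyperplane_dim hH) (vector.size_basis b'W).
subst n; apply: (free_fields_basis bW b'W).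
apply: free_fields_perm fr; apply: perm_trans pe _.
exact: perm_exchange.
Qed.

End Hyperplanes.

(** * Inductive freeness and flags *)

Section InductiveFreeness.
Variables (F : fieldType) (V : vectType F).
Implicit Types (W H K X : {vspace V}) (A : {fset {vspace V}}) (g h a b : 'Hom(V, F^o)).
Implicit Types (L : seq 'Hom(V, F^o)).

Inductive ifree : {vspace V} -> {fset {vspace V}} -> seq nat -> Prop :=
| ifree_empty W : ifree W fset0 (nseq (\dim W) 0%N)
| ifree_add W A H d e' e'' e : H \in A ->
    ifree W (A `\ H)%fset e' -> ifree H (restriction A H) e'' ->
    perm_eq e' (d :: e'') -> perm_eq e (d.+1 :: e'') -> ifree W A e.

Lemma ifree_perm W A e f : perm_eq f e -> ifree W A e -> ifree W A f.
Proof.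
move=> pf h; case: h pf => [W0|W0 A0 H d e' e'' e0 HA h1 h2 p1 p2] pf.
  have -> : f = nseq (\dim W0) 0%N.
    rewrite -(size_nseq (\dim W0) 0%N) -(perm_size pf); apply/all_pred1P.
    by rewrite (perm_all _ pf) all_nseq /= eqxx orbT.
  exact: ifree_empty.
by apply: (ifree_add HA h1 h2 p1); apply: perm_trans pf p2.
Qed.

Lemma free_arr0 W : free_arr W fset0 (nseq (\dim W) 0%N).
Proof.
move=> n b bW; have r0 : n = \dim W by rewrite (vector.size_basis bW).
apply: (@free_fields_perm _ _ _ n (fun=> 0%N)).
  have -> : [seq 0%N | _ <- enum 'I_n] = nseq (size (enum 'I_n)) 0%N.
    by elim: (enum _) => //= x s ->.
  by rewrite -r0 size_enum_ord.
exists (fun i j => (i == j)%:R); split.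
- by move=> i a [H]; rewrite inE.
- move=> i j; case: eqP => _; rewrite ?dhomog0 //; exact: dhomog1.
- move=> t _; exists t => j; rewrite (bigD1 j) //= eqxx mulr1 big1 ?addr0 // => i.
  by move=> /negbTE ->; rewrite mulr0.
- move=> c cE i; have := cE i; rewrite (bigD1 i) //= eqxx mulr1 big1 ?addr0 // => j.
  by move=> /negbTE ->; rewrite mulr0.
Qed.

Theorem ifreeP W A e : ifree W A e -> hyperplanes W A ->
  [/\ free_arr W A e, inductively_free W A & sumn e = #|` A|].
Proof.
elim=> {W A e} [W|W A H d e' e'' e HA _ IH' _ IH'' pe' pe] hA.
  split; [exact: free_arr0 | exact: InductivelyFree_empty | by rewrite sumn_nseq cardfs0].
have [g [HE _]] := hA H HA.
have [fA' iA' sA'] := IH' (@hyperplanesD1 _ _ _ _ H hA).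
have HW : (H <= W)%VS by rewrite HE capvSl.
have [fH iH sH] := IH'' (hyperplanes_restriction HW hA).
split.
- exact: free_arr_addition hA HA fA' fH pe' sA' sH pe.
- apply: (InductivelyFree_add HA iA' iH (free_arrW fA') (free_arrW fH)) => x.
  by have /seq.permP -> := pe'; rewrite /= leq_addl.
- by rewrite (perm_sumn pe) (cardfsD1 H A) HA -sA' (perm_sumn pe').
Qed.

Definition arr W L : {fset {vspace V}} :=
  [fset H in [seq (W :&: lker a)%VS | a <- L & ~~ (W <= lker a)%VS]]%fset.

Lemma arrP W L K : reflect (exists2 a, a \in L & hyperplane_of W K a) (K \in arr W L).
Proof.
rewrite inE; apply: (iffP mapP) => -[a].
  by rewrite mem_filter => /andP[h aL] ->; exists a.
by move=> aL [-> h]; exists a => //; rewrite mem_filter h.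
Qed.

Lemma arr_hyperplanes W L : hyperplanes W (arr W L).
Proof. by move=> K /arrP[a _ h]; exists a. Qed.

Lemma restriction_arr W L X : (X <= W)%VS -> restriction (arr W L) X = arr X L.
Proof.
move=> XW; apply/fsetP => K; apply/restrictionP/arrP.
  move=> [_ /arrP[a aL [-> na]] [nX ->]]; exists a => //; split.
    apply/vspaceP => v; rewrite !memv_cap; case vX: (v \in X); rewrite ?andbF ?andbT //=.
    by rewrite (subvP XW).
  by apply: contra nX => h; rewrite subv_cap XW.
move=> [a aL [-> na]]; exists (W :&: lker a)%VS.
  by apply/arrP; exists a => //; split=> //; apply: contra na; apply: subv_trans XW.
split; first by rewrite subv_cap negb_and na orbT.
apply/vspaceP => v; rewrite !memv_cap; case vX: (v \in X); rewrite ?andbF ?andbT //=.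
by rewrite (subvP XW).
Qed.

Definition sub_arr W L L' := forall a, a \in L ->
  (forall v, v \in W -> a v = 0) \/
  exists2 a', a' \in L' & exists2 k, k != 0 & forall v, v \in W -> a v = k * a' v.

Lemma arr_sub W L L' : sub_arr W L L' -> {subset arr W L <= arr W L'}.
Proof.
move=> h K /arrP[a aL [-> na]]; have [a0|[a' a'L [k k0 aE]]] := h a aL.
  by case/negP: na; apply/subvP => v vW; rewrite memv_ker a0.
have ka v : v \in W -> (v \in lker a) = (v \in lker a').
  by move=> vW; rewrite !memv_ker aE // mulf_eq0 (negbTE k0).
apply/arrP; exists a' => //; split.
  apply/vspaceP => v; rewrite !memv_cap; case vW: (v \in W) => //=; exact: ka.
by apply: contra na => /subvP h'; apply/subvP => v vW; rewrite ka // h'.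
Qed.

Lemma arr_eq W L L' : sub_arr W L L' -> sub_arr W L' L -> arr W L = arr W L'.
Proof.
by move=> h h'; apply/fsetP => K; apply/idP/idP; apply: arr_sub.
Qed.

Lemma sub_arr_incl W L L' : {subset L <= L'} -> sub_arr W L L'.
Proof.
move=> h a aL; right; exists a; first exact: h.
by exists 1; rewrite ?oner_neq0 // => v _; rewrite mul1r.
Qed.

Lemma sub_arr_cat W L1 L2 L : sub_arr W L1 L -> sub_arr W L2 L -> sub_arr W (L1 ++ L2) L.
Proof. by move=> h1 h2 a; rewrite mem_cat => /orP[/h1|/h2]. Qed.

Lemma sub_arr_trans W L1 L2 L3 : sub_arr W L1 L2 -> sub_arr W L2 L3 -> sub_arr W L1 L3.
Proof.
move=> h1 h2 a /h1[|[b /h2 hb [k k0 aE]]]; first by left.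
case: hb => [b0|[c cL [k' k'0 bE]]]; first by left=> v vW; rewrite aE // b0 // mulr0.
right; exists c => //; exists (k * k'); first by rewrite mulf_neq0.
by move=> v vW; rewrite aE // bE // mulrA.
Qed.

Lemma sub_arrS W X L L' : (X <= W)%VS -> sub_arr W L L' -> sub_arr X L L'.
Proof.
move=> XW h a /h[a0|[b bL [k k0 aE]]]; [left|right].
  by move=> v /(subvP XW)/a0.
by exists b => //; exists k => // v /(subvP XW)/aE.
Qed.

Lemma sub_arr_catr W L1 L2 L : sub_arr W L L1 -> sub_arr W L (L1 ++ L2).
Proof.
by move=> h; apply: sub_arr_trans h _; apply: sub_arr_incl => a aL; rewrite mem_cat aL.
Qed.

Lemma sub_arr_catl W L1 L2 L : sub_arr W L L2 -> sub_arr W L (L1 ++ L2).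
Proof.
by move=> h; apply: sub_arr_trans h _; apply: sub_arr_incl => a aL; rewrite mem_cat aL orbT.
Qed.

Definition ifr W L e := ifree W (arr W L) e.

Lemma ifr_add W L a d e' e'' e :
  ~~ (W <= lker a)%VS ->
  (forall b, b \in L -> (exists2 v, v \in W & b v != 0) ->
    exists2 u, u \in W & a u = 0 /\ b u != 0) ->
  ifr W L e' -> ifr (W :&: lker a) L e'' ->
  perm_eq e' (d :: e'') -> perm_eq e (d.+1 :: e'') -> ifr W (a :: L) e.
Proof.
move=> na hu h' h'' pe' pe.
have hH : hyperplane_of W (W :&: lker a)%VS a by [].
have HA : (W :&: lker a)%VS \in arr W (a :: L).
  by apply/arrP; exists a => //; rewrite mem_head.
apply: (ifree_add HA _ _ pe' pe).
  have -> : (arr W (a :: L) `\ (W :&: lker a)%VS)%fset = arr W L => //.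
  apply/fsetP => K; rewrite in_fsetD1; apply/andP/arrP.
    move=> [KH /arrP[b]]; rewrite in_cons => /orP[/eqP ->|bL] hK; last by exists b.
    by case/eqP: KH; case: hK.
  move=> [b bL hK]; split; last by apply/arrP; exists b; rewrite // in_cons bL orbT.
  have [KE /hyperplane_witness[v vW bv]] := hK.
  have [|u uW [au bu]] := hu b bL; first by exists v.
  apply: contraNneq bu => KH; have : u \in K by rewrite KH memv_cap uW memv_ker au eqxx.
  by rewrite KE memv_cap memv_ker => /andP[].
rewrite restriction_arr ?capvSl //.
have -> : arr (W :&: lker a) (a :: L) = arr (W :&: lker a) L => //.
apply: arr_eq; last by apply: sub_arr_incl => b bL; rewrite in_cons bL orbT.
move=> b; rewrite in_cons => /orP[/eqP ->|bL].
  by left=> v; rewrite memv_cap memv_ker => /andP[_ /eqP].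
by right; exists b => //; exists 1; rewrite ?oner_neq0 // => v _; rewrite mul1r.
Qed.

Lemma ifr_eq W L L' e : sub_arr W L L' -> sub_arr W L' L -> ifr W L' e -> ifr W L e.
Proof. by move=> h h'; rewrite /ifr (arr_eq h h'). Qed.

Lemma ifr_perm W L e f : perm_eq f e -> ifr W L e -> ifr W L f.
Proof. exact: ifree_perm. Qed.

Inductive flag_free L : {vspace V} -> seq nat -> Prop :=
| flag_free_line W : \dim W = 1%N -> ifr W L [:: 1%N] -> flag_free L W [::]
| flag_free_cons W a e E : a \in L -> ~~ (W <= lker a)%VS ->
    ifr W L (1%N :: e :: E) -> flag_free L (W :&: lker a)%VS E -> flag_free L W (e :: E).

Lemma flag_freeW L W E : flag_free L W E -> ifr W L (1%N :: E).
Proof. by case. Qed.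

Lemma flag_free_dim L W E : flag_free L W E -> \dim W = (size E).+1.
Proof.
elim=> {W E} [W -> //|W a e E _ na _ _ dW] /=.
by rewrite -dW (@hyperplane_dim _ _ W (W :&: lker a)%VS a).
Qed.

Lemma flag_free_flag L W E : flag_free L W E -> exists X : nat -> {vspace V},
  [/\ X (\dim W) = W,
      forall d, (1 <= d < \dim W)%N -> (X d <= X d.+1)%VS &
      forall d, (1 <= d <= \dim W)%N ->
        [/\ exists2 s : seq 'Hom(V, F^o), {subset s <= [seq a <- L | ~~ (W <= lker a)%VS]} &
              X d = (W :&: \bigcap_(a <- s) lker a)%VS,
            \dim (X d) = d & ifr (X d) L (1%N :: drop (\dim W - d) E)]].
Proof.
elim=> {W E} [W dW hW|W a e E aL na hW fE [X [XW Xle XP]]].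
  exists (fun=> W); rewrite dW; split=> [//|d _|d]; first exact: subvv.
  move=> /andP[d1 d2]; have -> : d = 1%N by apply/eqP; rewrite eqn_leq d1 d2.
  by split=> //; exists [::]; rewrite // big_nil capvf.
have dW : \dim W = (\dim (W :&: lker a)).+1.
  by rewrite (@hyperplane_dim _ _ W (W :&: lker a)%VS a).
exists (fun d => if (d < \dim W)%N then X d else W); rewrite ltnn; split=> //.
  move=> d /andP[d1 dlt]; rewrite dlt; case: ifP => [d2|_].
    by apply: Xle; rewrite d1 -ltnS -dW.
  move: dlt; rewrite dW ltnS => dle.
  have [|[s _ ->] _ _] := XP d; first by rewrite d1.
  by rewrite -capvA capvSl.
move=> d /andP[d1 d2]; case: ifP => [dlt|/negbT]; last first.
  rewrite -leqNgt => d3; have -> : d = \dim W by apply/eqP; rewrite eqn_leq d2 d3.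
  rewrite subnn drop0; split=> //; by exists [::]; rewrite // big_nil capvf.
move: dlt; rewrite dW ltnS => dle.
have [|[s sL XE] dX hX] := XP d; first by rewrite d1.
split=> //; last by rewrite subSn.
exists (a :: s).
  move=> b; rewrite in_cons => /orP[/eqP ->|/sL]; rewrite !mem_filter ?na //.
  by move=> /andP[nb ->]; rewrite andbT; apply: contra nb; apply: subv_trans; apply: capvSl.
by rewrite big_cons capvA XE.
Qed.

Lemma memv_bigcap (I : Type) (s : seq I) (U : I -> {vspace V}) v :
  (v \in \bigcap_(i <- s) U i)%VS = all (fun i => v \in U i) s.
Proof. by elim: s => [|i s IH]; rewrite ?big_nil ?memvf // big_cons memv_cap IH. Qed.

Theorem flag_free_accurate L W E : flag_free L W E -> sorted leq (1%N :: rev E) ->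
  ind_flag_accurate W (arr W L) /\
  forall e, perm_eq e (1%N :: E) -> free_with_exponents W (arr W L) e.
Proof.
move=> fE sE; have hW := flag_freeW fE; have dW := flag_free_dim fE.
have pr : perm_eq (1%N :: rev E) (1%N :: E) by rewrite perm_cons perm_rev.
have ifX X e : ifr X L e -> free_with_exponents X (arr X L) e /\ inductively_free X (arr X L).
  by move=> /ifreeP/(_ (@arr_hyperplanes _ _))[/free_arrW].
split; last by move=> e pe; apply: (ifX _ _ (ifr_perm pe hW)).1.
exists (1%N :: rev E); split=> //.
- move=> H /arrP[a aL hH]; split; first by case: hH => -> _; rewrite capvSl.
  exact: hyperplane_dim hH.
- exact: (ifX _ _ (ifr_perm pr hW)).1.
- exact: (ifX _ _ hW).2.
have [X [XW Xle XP]] := flag_free_flag fE; exists X; split=> // d hd.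
have [[s sL XE] dX hX] := XP d hd.
have XsubW : (X d <= W)%VS by rewrite XE capvSl.
rewrite restriction_arr //.
have pd : perm_eq (take d (1%N :: rev E)) (1%N :: drop (\dim W - d) E).
  case: d hd {dX hX XE XsubW} => [|d]; first by [].
  rewrite dW ltnS => /andP[_ dle] /=; rewrite perm_cons subSS.
  by rewrite take_rev perm_rev.
have [h1 h2] := ifX _ _ (ifr_perm pd hX); split=> //.
exists [fset H in [seq (W :&: lker a)%VS | a <- s]]%fset.
  apply/fsubsetP => H; rewrite inE => /mapP[a /sL]; rewrite mem_filter => /andP[na aL] ->.
  by apply/arrP; exists a.
apply/vspaceP => v; rewrite XE !memv_cap; case vW: (v \in W) => //=.
rewrite !memv_bigcap; apply/allP/allP => h x.
  by rewrite inE => /mapP[a /h va ->]; rewrite memv_cap vW.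
move=> xs; have : (W :&: lker x)%VS \in [fset H in [seq (W :&: lker a)%VS | a <- s]]%fset.
  by rewrite inE; apply: map_f.
by move/h; rewrite memv_cap => /andP[].
Qed.

End InductiveFreeness.

(** * Gain graphs *)

Section GainGraphs.
Variables (F : numFieldType) (V : vectType F) (z : 'Hom(V, F^o)).
Implicit Types (W X : {vspace V}) (y a b g h : 'Hom(V, F^o)).
Implicit Types (L ys : seq 'Hom(V, F^o)).

Definition indep W ys := uniq ys /\
  forall (z0 : F) (c : 'Hom(V, F^o) -> F),
    exists2 v, v \in W & z v = z0 /\ {in ys, forall y, y v = c y}.

Definition span_of ys g := forall v, z v = 0 -> {in ys, forall y, y v = 0} -> g v = 0.

Definition free_over ys L e := forall W n0, indep W ys -> \dim W = (n0 + size ys).+1 ->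
  ifr W L (1%N :: nseq n0 0%N ++ e).

Definition point_form y (s : int) := y - s%:~R *: z.
Definition diff_form y y' (t : int) := y - y' - t%:~R *: z.

Lemma ptE y s v : point_form y s v = y v - s%:~R * z v.
Proof. by rewrite /point_form add_lfunE opp_lfunE scale_lfunE. Qed.

Lemma dfE y y' t v : diff_form y y' t v = y v - y' v - t%:~R * z v.
Proof. by rewrite /diff_form !(add_lfunE, opp_lfunE, scale_lfunE). Qed.

Lemma indep_perm W ys ys' : perm_eq ys ys' -> indep W ys -> indep W ys'.
Proof.
move=> p [u h]; split; first by rewrite -(perm_uniq p).
move=> z0 c; have [v vW [zv yv]] := h z0 c; exists v => //; split=> // y.
by rewrite -(perm_mem p); apply: yv.
Qed.

Lemma free_over_perm ys ys' L L' e e' : perm_eq ys ys' -> L =i L' -> perm_eq e' e ->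
  free_over ys L e -> free_over ys' L' e'.
Proof.
move=> p q pe h W n0 /(indep_perm (_ : perm_eq ys' ys)) iW dW.
apply: ifr_perm (_ : perm_eq _ (1%N :: nseq n0 0%N ++ e)) _.
  by rewrite perm_cons perm_cat2l.
apply: (ifr_eq (L' := L)); try by apply: sub_arr_incl => a; rewrite q.
by apply: h; [apply: iW; rewrite perm_sym | rewrite (perm_size p)].
Qed.



Section NewVertex.
Variables (W : {vspace V}) (ys : seq 'Hom(V, F^o)) (y : 'Hom(V, F^o)).
Hypothesis iW : indep W (y :: ys).

Lemma indep_tail : indep W ys.
Proof.
have [/=/andP[_ u] h] := iW; split=> // z0 c; have [v vW [zv yv]] := h z0 c.
by exists v => //; split=> // x xs; apply: yv; rewrite in_cons xs orbT.
Qed.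

Lemma vertex_vector : exists2 u, u \in W &
  y u = 1 /\ (forall g, span_of ys g -> g u = 0).
Proof.
have [/=/andP[yys u] h] := iW; have [v vW [zv yv]] := h 0 (fun x => (x == y)%:R).
exists v => //; split; first by rewrite yv ?mem_head // eqxx.
move=> g; apply=> // x xs; rewrite yv ?in_cons ?xs ?orbT //.
by case: eqP => // xy; rewrite -xy xs in yys.
Qed.

Lemma vertex_adjust g v : span_of ys g -> v \in W ->
  exists2 u, u \in W & (y - g) u = 0 /\ forall h, span_of ys h -> h u = h v.
Proof.
move=> gs vW; have [e eW [ye he]] := vertex_vector.
exists (v + (g v - y v) *: e); first by rewrite memvD ?memvZ.
have hE h : span_of ys h -> h (v + (g v - y v) *: e) = h v.
  by move=> hs; rewrite linearD linearZ /= he // scaler0 addr0.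
split=> //; rewrite add_lfunE opp_lfunE (hE g) // linearD linearZ /= ye.
by rewrite /GRing.scale /= mulr1 [y v + _]addrC subrK subrr.
Qed.

Lemma vertex_not_sub g : span_of ys g -> ~~ (W <= lker (y - g))%VS.
Proof.
move=> gs; have [u uW [yu hu]] := vertex_vector; apply/subvPn; exists u => //.
by rewrite memv_ker add_lfunE opp_lfunE (hu g) // yu subr0 oner_eq0.
Qed.

Lemma indep_restrict g : span_of ys g -> indep (W :&: lker (y - g)) ys.
Proof.
move=> gs; have [/=/andP[_ u] h] := iW; split=> // z0 c.
have [v vW [zv yv]] := h z0 c; have [w wW [yw hw]] := vertex_adjust gs vW.
exists w; first by rewrite memv_cap wW memv_ker yw eqxx.
split; first by rewrite hw // => x.
move=> x xs; rewrite hw ?yv ?in_cons ?xs ?orbT // => x' _; exact.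
Qed.

Lemma dim_restrict g : span_of ys g -> (\dim (W :&: lker (y - g))).+1 = \dim W.
Proof. by move=> gs; apply: (@hyperplane_dim _ _ _ _ (y - g)); split=> //; apply: vertex_not_sub. Qed.

End NewVertex.

Lemma span_z ys : span_of ys z. Proof. by move=> v. Qed.

Lemma span_vertex ys y : y \in ys -> span_of ys y.
Proof. by move=> yys v _; apply. Qed.

Lemma span_comb ys g h (k : F) : span_of ys g -> span_of ys h -> span_of ys (g + k *: h).
Proof. by move=> hg hh v zv yv; rewrite add_lfunE scale_lfunE hg // hh // scaler0 addr0. Qed.

Lemma span_subset ys ys' g : {subset ys <= ys'} -> span_of ys g -> span_of ys' g.
Proof. by move=> s h v zv yv; apply: h => // y /s/yv. Qed.

Lemma span_pt ys y s : y \in ys -> span_of ys (point_form y s).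
Proof.
by move=> yys; rewrite /point_form -scaleNr; apply: span_comb; [exact: span_vertex | exact: span_z].
Qed.

Lemma span_df ys y y' t : y \in ys -> y' \in ys -> span_of ys (diff_form y y' t).
Proof.
move=> yys y's; rewrite /diff_form -scaleNr -[- y']scaleN1r; apply: span_comb; last exact: span_z.
by apply: span_comb; apply: span_vertex.
Qed.

Definition present L a :=
  (forall v, a v = 0) \/ exists2 b, b \in L & exists2 k : F, k != 0 & forall v, a v = k * b v.

Lemma present_mem L a : a \in L -> present L a.
Proof. by move=> aL; right; exists a => //; exists 1; rewrite ?oner_neq0 // => v; rewrite mul1r. Qed.

Lemma present_opp L a b : (forall v, a v = - b v) -> present L b -> present L a.
Proof.
move=> ab [b0|[c cL [k k0 bE]]]; [left=> v|right]; first by rewrite ab b0 oppr0.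
by exists c => //; exists (- k); rewrite ?oppr_eq0 // => v; rewrite ab bE mulNr.
Qed.

Lemma present_eq L a b : (forall v, a v = b v) -> present L b -> present L a.
Proof.
move=> ab [b0|[c cL [k k0 bE]]]; [left=> v|right]; first by rewrite ab b0.
by exists c => //; exists k => // v; rewrite ab bE.
Qed.

Lemma present_subset L L' a : {subset L <= L'} -> present L a -> present L' a.
Proof. by move=> s [|[b /s bL h]]; [left|right; exists b]. Qed.

Lemma present_scale L a (k : F) : z \in L -> (forall v, a v = k * z v) -> present L a.
Proof.
move=> zL aE; have [k0|k0] := eqVneq k 0; first by left=> v; rewrite aE k0 mul0r.
by right; exists z => //; exists k.
Qed.

Lemma new_edge W ys L y g E v : indep W (y :: ys) -> {in L, forall b, span_of ys b} ->
  span_of ys g -> {in E, forall g', span_of ys g'} -> v \in W ->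
  {in E, forall g', (g v : F) != g' v} ->
  forall b, b \in [seq y - g' | g' <- E] ++ L -> (exists2 w, w \in W & b w != 0) ->
    exists2 u, u \in W & (y - g) u = 0 /\ b u != 0.
Proof.
move=> iW Ls gs Es vW Ev b; rewrite mem_cat => /orP[/mapP[g' g'E ->]|bL] [w wW bw].
  have [u uW [yu hu]] := vertex_adjust iW gs vW.
  exists u => //; split=> //; move: yu; rewrite !add_lfunE !opp_lfunE.
  move/eqP; rewrite subr_eq0 => /eqP ->; rewrite !hu ?subr_eq0; [|exact: Es|exact: gs].
  exact: Ev.
have [u uW [yu hu]] := vertex_adjust iW gs wW.
by exists u => //; split=> //; rewrite hu //; apply: Ls.
Qed.

Lemma free_over_add ys L y E e :
  free_over ys L e -> {in L, forall b, span_of ys b} ->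
  {in E, forall g, span_of ys g} ->
  (forall W, indep W ys -> exists2 v, v \in W & uniq [seq g v : F | g : 'Hom(V, F^o) <- E]) ->
  {in E &, forall g g', present L (g - g')} ->
  free_over (y :: ys) ([seq y - g | g <- E] ++ L) (size E :: e).
Proof.
move=> hL Ls Es Eu Ep W n0 iW dW.
have hX g : g \in E -> ifr (W :&: lker (y - g)) L (1%N :: nseq n0 0%N ++ e).
  move=> gE; apply: hL; first by apply: indep_restrict => //; apply: Es.
  by have := dim_restrict iW (Es g gE); rewrite dW /= addnS => -[].
have hW : ifr W L (1%N :: nseq n0.+1 0%N ++ e).
  by apply: hL; [exact: indep_tail iW | rewrite dW /= addSnnS].
have [v vW vu] := Eu W (indep_tail iW).
suff h E' : {subset E' <= E} -> uniq [seq g v : F | g : 'Hom(V, F^o) <- E'] ->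
    ifr W ([seq y - g | g <- E'] ++ L) (1%N :: nseq n0 0%N ++ size E' :: e) by apply: h.
elim: E' => [|g E' IH] /= E'E {}vu.
  by apply: ifr_perm hW; apply/seq.permP => q /=; rewrite !count_cat /=; lia.
have gE : g \in E by apply: E'E; rewrite mem_head.
have E'E' : {subset E' <= E} by move=> x xE; apply: E'E; rewrite in_cons xE orbT.
case/andP: vu => gv vu.
apply: (ifr_add (d := size E') _ _ (IH E'E' vu) _ (e'' := 1%N :: nseq n0 0%N ++ e)).
- exact: vertex_not_sub (Es g gE).
- apply: (new_edge iW Ls (Es g gE) _ vW) => g' g'E; first exact/Es/E'E'.
  by apply: contraNneq gv => ->; apply: (map_f (fun g : 'Hom(V, F^o) => g v : F)).
- apply: (ifr_eq (L' := L)) (hX g gE); last by apply: sub_arr_catl; apply: sub_arr_incl.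
  apply: sub_arr_cat; last exact: sub_arr_incl.
  move=> _ /mapP[g' g'E ->].
  have yX w : w \in (W :&: lker (y - g))%VS -> (y - g') w = (g - g') w.
    rewrite memv_cap memv_ker => /andP[_ /eqP]; rewrite !add_lfunE !opp_lfunE.
    by move/eqP; rewrite subr_eq0 => /eqP ->.
  have [g0|[b bL [k k0 gE']]] := Ep g g' gE (E'E' _ g'E).
    by left=> w /yX ->; rewrite g0.
  by right; exists b => //; exists k => // w /yX ->; rewrite gE'.
- by apply/seq.permP => q /=; rewrite !count_cat /=; lia.
- apply/seq.permP => p; rewrite /= !count_cat /=; lia.
Qed.

End GainGraphs.

(** * Catalan arrangements *)

Lemma int_bound (s : seq int) : exists M : int, forall x, x \in s -> x < M.
Proof.
elim: s => [|x s [M hM]]; first by exists 0.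
exists (`|x| + `|M| + 1) => y; rewrite in_cons => /orP[/eqP ->|/hM]; lia.
Qed.

Section Catalan.
Variables (F : numFieldType) (V : vectType F) (z : 'Hom(V, F^o)).
Implicit Types (W X : {vspace V}) (y a b g h : 'Hom(V, F^o)).
Implicit Types (L ys : seq 'Hom(V, F^o)) (S : 'Hom(V, F^o) -> seq int).
Local Notation pt := (point_form z).
Local Notation df := (diff_form z).
Local Notation indep := (indep z).
Local Notation free_over := (free_over z).

Definition G ys S : seq 'Hom(V, F^o) :=
  z :: [seq df p.1 p.2 t | p <- [seq (y, y') | y <- ys, y' <- ys], t <- int_range (-1) 1] ++
  [seq pt y s | y <- ys, s <- S y].

Variant G_spec ys S a : Prop :=
| G_z of a = z
| G_df y y' (t : int) of y \in ys & y' \in ys & (-1 <= t <= 1) & a = df y y' t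
| G_pt y s of y \in ys & s \in S y & a = pt y s.

Lemma GP ys S a : a \in G ys S -> G_spec ys S a.
Proof.
rewrite in_cons mem_cat => /or3P[/eqP ->|/allpairsP|/allpairsPdep]; first exact: G_z.
  move=> [[p t]] /= [/allpairsP[[y y'] /= [yys y's ->]]].
  by rewrite mem_int_range => tt -> /=; exact: (G_df _ yys y's tt erefl).
by move=> [y [s [yys ss ->]]]; exact: (G_pt yys ss erefl).
Qed.

Lemma G_memz ys S : z \in G ys S. Proof. exact: mem_head. Qed.

Lemma G_memdf ys S y y' (t : int) : y \in ys -> y' \in ys -> -1 <= t <= 1 -> df y y' t \in G ys S.
Proof.
move=> yys y's tt; rewrite in_cons mem_cat; apply/or3P/Or32.
apply/allpairsP; exists ((y, y'), t) => /=; rewrite mem_int_range; split=> //.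
by apply/allpairsP; exists (y, y').
Qed.

Lemma G_mempt ys S y s : y \in ys -> s \in S y -> pt y s \in G ys S.
Proof.
move=> yys ss; rewrite in_cons mem_cat; apply/or3P/Or33.
by apply/allpairsPdep; exists y, s.
Qed.

Lemma G_subset ys ys' S S' : {subset ys <= ys'} ->
  (forall y, y \in ys -> {subset S y <= S' y}) -> {subset G ys S <= G ys' S'}.
Proof.
move=> s h a /GP[->|y y' t yys y's tt ->|y t yys ts ->].
- exact: G_memz.
- by apply: G_memdf => //; apply: s.
- by apply: G_mempt; [apply: s | apply: h].
Qed.

Lemma G_span ys S : {in G ys S, forall b, span_of z ys b}.
Proof.
move=> a /GP[->|y y' t yys y's tt ->|y t yys ts ->].
- exact: span_z.
- exact: span_df.
- exact: span_pt.
Qed.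

Lemma vanish_or_z X L a (k : F) : z \in L -> (forall v, v \in X -> a v = k * z v) ->
  (forall v, v \in X -> a v = 0) \/
  exists2 a', a' \in L & exists2 k : F, k != 0 & forall v, v \in X -> a v = k * a' v.
Proof.
move=> zL aE; have [k0|k0] := eqVneq k 0; first by left=> v vX; rewrite aE // k0 mul0r.
by right; exists z => //; exists k.
Qed.

Lemma vanish_or_mem X L a b (k : F) : k != 0 -> b \in L ->
  (forall v, v \in X -> a v = k * b v) ->
  (forall v, v \in X -> a v = 0) \/
  exists2 a', a' \in L & exists2 k : F, k != 0 & forall v, v \in X -> a v = k * a' v.
Proof. by move=> k0 bL aE; right; exists b => //; exists k. Qed.

Lemma G_restrict X y0 ys S S'' (t : int) :
  (forall v, v \in X -> y0 v = t%:~R * z v) ->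
  (forall y s, y \in ys -> (s \in S'' y) = (s \in S y) || (`|s - t| <= 1)) ->
  sub_arr X (G (y0 :: ys) S) (G ys S'') /\ sub_arr X (G ys S'') (G (y0 :: ys) S).
Proof.
move=> y0E hS; have n1 : (-1 : F) != 0 by rewrite oppr_eq0 oner_neq0.
have p1 := oner_neq0 F.
split=> a /GP[->|y y' t' yys y's tt ->|y s yys ss ->].
- by apply: (vanish_or_mem p1 (G_memz _ _)) => v _; rewrite mul1r.
- move: yys y's; rewrite !in_cons => /orP[/eqP ->|yys] /orP[/eqP ->|y's].
  + apply: (vanish_or_z (k := - t'%:~R)); first exact: G_memz.
    by move=> v vX; rewrite dfE; ring.
  + apply: (vanish_or_mem (b := pt y' (t - t')) n1).
      by apply: G_mempt => //; rewrite hS //; lia.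
    by move=> v vX; rewrite dfE ptE y0E // intrB; ring.
  + apply: (vanish_or_mem (b := pt y (t + t')) p1).
      by apply: G_mempt => //; rewrite hS //; lia.
    by move=> v vX; rewrite dfE ptE y0E // intrD; ring.
  + by apply: (vanish_or_mem p1 (G_memdf _ yys y's tt)) => v _; rewrite mul1r.
- move: yys; rewrite in_cons => /orP[/eqP ye|yys].
    apply: (vanish_or_z (k := (t - s)%:~R)); first exact: G_memz.
    by move=> v vX; rewrite ptE ye y0E // intrB; ring.
  apply: (vanish_or_mem (b := pt y s) p1) => [|v _]; last by rewrite mul1r.
  by apply: G_mempt; rewrite // hS // ss.
- by apply: (vanish_or_mem p1 (G_memz _ _)) => v _; rewrite mul1r.
- apply: (vanish_or_mem (b := df y y' t') p1) => [|v _]; last by rewrite mul1r.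
  by apply: G_memdf; rewrite // in_cons ?yys ?y's orbT.
- move: ss; rewrite hS // => /orP[ss|st].
    apply: (vanish_or_mem (b := pt y s) p1) => [|v _]; last by rewrite mul1r.
    by apply: G_mempt; rewrite // in_cons yys orbT.
  apply: (vanish_or_mem (b := df y y0 (s - t)) p1) => [|v vX].
    by apply: G_memdf; rewrite ?in_cons ?eqxx ?yys ?orbT //; lia.
  by rewrite ptE dfE y0E // intrB; ring.
Qed.

Lemma G_add W y0 ys S S' S'' (t : int) d e' e'' e :
  indep W (y0 :: ys) -> t \notin S y0 -> S' y0 =i t :: S y0 ->
  (forall y, y \in ys -> S' y =i S y) ->
  (forall y s, y \in ys -> (s \in S'' y) = (s \in S y) || (`|s - t| <= 1)) ->
  ifr W (G (y0 :: ys) S) e' -> ifr (W :&: lker (pt y0 t)) (G ys S'') e'' ->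
  perm_eq e' (d :: e'') -> perm_eq e (d.+1 :: e'') -> ifr W (G (y0 :: ys) S') e.
Proof.
move=> iW tS S'0 S'E S''E h' h'' pe' pe.
have tz : span_of z ys (t%:~R *: z) by move=> v zv _; rewrite scale_lfunE zv scaler0.
have GE : G (y0 :: ys) S' =i pt y0 t :: G (y0 :: ys) S.
  move=> a; apply/idP/idP.
    move=> /GP[->|y y' t' yys y's tt ->|y s yys ss ->].
    - by rewrite in_cons G_memz orbT.
    - by rewrite in_cons G_memdf ?orbT.
    - move: yys; rewrite in_cons => /orP[/eqP ye|yys].
        move: ss; rewrite ye S'0 in_cons => /orP[/eqP ->|ss]; first by rewrite mem_head.
        by rewrite in_cons G_mempt ?mem_head ?orbT.
      by rewrite in_cons G_mempt ?orbT // -?S'E // in_cons yys orbT.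
  rewrite in_cons => /orP[/eqP ->|]; first by rewrite G_mempt ?mem_head // S'0 mem_head.
  apply: G_subset => // y; rewrite in_cons => /orP[/eqP -> s ss|yys s ss].
    by rewrite S'0 in_cons ss orbT.
  by rewrite S'E.
apply: (ifr_eq (L' := pt y0 t :: G (y0 :: ys) S)); try by apply: sub_arr_incl => a; rewrite GE.
apply: (ifr_add (d := d) _ _ h' _ pe' pe).
- by rewrite /point_form; apply: vertex_not_sub iW _ tz.
- have [uy hW] := iW; have [M hM] := int_bound (t + 1 :: flatten [seq S y | y <- y0 :: ys]).
  pose val y : int := if y == y0 then t else M + (index y (y0 :: ys)).*2%:Z.
  have [u uW [zu yu]] := hW 1 (fun y => (val y)%:~R).
  move=> b bG [w _ bw]; exists u => //; rewrite ptE zu yu ?mem_head // /val eqxx mulr1 subrr.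
  split=> //; move: bw; case/GP: bG => [->|y y' t' yys y's tt ->|y s yys ss ->].
  + by rewrite zu oner_eq0.
  + rewrite !dfE zu !yu // mulr1 -!rmorphB /= intr_eq0 => bw.
    have [ye|ye] := eqVneq y y'.
      rewrite ye; apply: contraNneq bw => t0.
      by have -> : t' = 0; [lia | rewrite ye subrr mul0r subrr].
    have Mt := hM _ (mem_head _ _).
    have iy : index y (y0 :: ys) != index y' (y0 :: ys).
      by apply: contraNneq ye => /(index_inj _) ->.
    rewrite /val; case: (y =P y0) => [y0'|_]; case: (y' =P y0) => [y'0|_].
    * by rewrite y0' y'0 eqxx in ye.
    * by clear -Mt tt; lia.
    * by clear -Mt tt; lia.
    * by clear -iy tt; lia.
  + rewrite !ptE zu yu // mulr1 -rmorphB /= intr_eq0 => _.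
    have sM : s < M.
      by apply: hM; rewrite in_cons; apply/orP; right; apply/flattenP; exists (S y) => //; apply: map_f.
    rewrite /val; case: (y =P y0) => [ye|_]; last by lia.
    by apply: contraNneq tS => ts; have -> : t = s; [lia | rewrite -ye].
- have [s1 s2] : sub_arr (W :&: lker (pt y0 t)) (G (y0 :: ys) S) (G ys S'') /\
      sub_arr (W :&: lker (pt y0 t)) (G ys S'') (G (y0 :: ys) S).
    apply: (G_restrict (t := t)) => // v; rewrite memv_cap memv_ker ptE subr_eq0.
    by case/andP=> _ /eqP.
  exact: ifr_eq s1 s2 h''.
Qed.

End Catalan.

Section CatalanExponents.
Variables (F : numFieldType) (V : vectType F) (z : 'Hom(V, F^o)).
Implicit Types (W X : {vspace V}) (y a b g h : 'Hom(V, F^o)).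
Implicit Types (L ys : seq 'Hom(V, F^o)) (S : 'Hom(V, F^o) -> seq int).
Local Notation pt := (point_form z).
Local Notation df := (diff_form z).
Local Notation indep := (indep z).
Local Notation free_over := (free_over z).
Local Notation G := (G z).

Lemma G_eq ys ys' S S' : ys =i ys' -> (forall y, y \in ys -> S y =i S' y) ->
  G ys S =i G ys' S'.
Proof.
by move=> e h a; apply/idP/idP; apply: G_subset => y; rewrite ?e // => yys s; rewrite ?h ?e .
Qed.

Lemma ifr_eqi W L L' e : L =i L' -> ifr W L' e -> ifr W L e.
Proof. by move=> h; apply: ifr_eq; apply: sub_arr_incl => a; rewrite h. Qed.

Definition bound (lo hi : int) ys1 y := int_range lo (if y \in ys1 then hi else hi + 1).

Lemma raise_chain ys (lo hi : int) d e'' : lo <= hi + 1 ->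
  free_over ys (G ys (fun=> int_range lo hi)) (d :: e'') ->
  (forall y ys', perm_eq ys (y :: ys') ->
    free_over ys' (G ys' (fun=> int_range (if lo <= hi then lo else hi) (hi + 2))) e'') ->
  forall ys2 ys1, perm_eq ys (ys1 ++ ys2) ->
    free_over ys (G ys (bound lo hi ys1)) ((d + size ys2)%N :: e'').
Proof.
move=> lohi h0 h''; elim=> [|y ys2 IH] ys1 p W n0 iW dW.
  rewrite addn0; apply: ifr_eqi (h0 W n0 iW dW); apply: G_eq => // y.
  by rewrite (perm_mem p) cats0 /bound => ->.
have p' : perm_eq ys (y :: ys1 ++ ys2) by rewrite (perm_trans p) // perm_catC /= perm_cons perm_catC.
have iW' := indep_perm p' iW; have [/= /andP[yn un] _] := iW'.
have /IH/(_ W n0 iW dW) h' : perm_eq ys ((y :: ys1) ++ ys2) by [].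
apply: (ifr_eqi (L' := G (y :: ys1 ++ ys2) (bound lo hi ys1))).
  by apply: G_eq => // x; rewrite (perm_mem p').
have tz : span_of z (ys1 ++ ys2) ((hi + 1)%:~R *: z).
  by move=> v zv _; rewrite scale_lfunE zv scaler0.
apply: (@G_add _ _ z W y (ys1 ++ ys2) (bound lo hi (y :: ys1)) _
    (fun=> int_range (if lo <= hi then lo else hi) (hi + 2)) (hi + 1) (d + size ys2)
    (1%N :: nseq n0 0%N ++ (d + size ys2)%N :: e'') (1%N :: nseq n0 0%N ++ e'') _ iW').
- by rewrite /bound mem_head mem_int_range; lia.
- move=> s; rewrite in_cons /bound mem_head !mem_int_range.
  have -> : y \in ys1 = false by apply: contraNF yn; rewrite mem_cat => ->.
  by apply/idP/idP; lia.
- move=> x xys; rewrite /bound in_cons; have -> // : (x == y) = false.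
  by apply: contraNF yn => /eqP <-.
- move=> x s xys; rewrite /bound !mem_int_range; case: (lerP lo hi) => lh;
  by case: (x \in y :: ys1); apply/idP/idP; lia.
- apply: ifr_eqi h'; apply: G_eq => // x; rewrite ?(perm_mem p') //.
- apply: (h'' _ _ p' _ _ (indep_restrict iW' tz)).
  have := dim_restrict iW' tz; rewrite dW (perm_size p') /= addnS => -[].
  by move=> ->.
- by apply/seq.permP => q /=; rewrite !count_cat /=; lia.
- by apply/seq.permP => q /=; rewrite !count_cat /= addnS; lia.
Qed.

Lemma indep_diff W y ys : indep W (y :: ys) -> indep W [seq x - y | x <- ys].
Proof.
move=> [/= /andP[yn un] h]; split.
  by rewrite map_inj_uniq // => a b /addIr.
move=> z0 c; have [v vW [zv yv]] := h z0 (fun x => if x == y then 0 else c (x - y)).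
exists v => //; split=> // _ /mapP[x xys ->].
rewrite add_lfunE opp_lfunE !yv ?mem_head ?eqxx ?subr0 ?in_cons ?xys ?orbT //.
by case: eqP => // xy; rewrite -xy xys in yn.
Qed.

(* Without points, a Catalan arrangement becomes one with points [-1, 1] upon
   taking one of its vertices as the origin. *)
Lemma catalan_origin X y ys S S' : (forall x, S x = [::]) -> (forall x, S' x = int_range (-1) 1) ->
  sub_arr X (G (y :: ys) S) (G [seq x - y | x <- ys] S') /\
  sub_arr X (G [seq x - y | x <- ys] S') (G (y :: ys) S).
Proof.
move=> S0 S1; have n1 : (-1 : F) != 0 by rewrite oppr_eq0 oner_neq0.
have p1 := oner_neq0 F.
split=> a /GP[->|x x' t xys x's tt ->|x s xys ss ->].
- by apply: (vanish_or_mem p1 (G_memz _ _ _)) => v _; rewrite mul1r.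
- move: xys x's; rewrite !in_cons => /orP[/eqP ->|xys] /orP[/eqP ->|x's].
  + apply: (vanish_or_z (k := - t%:~R)); first exact: G_memz.
    by move=> v vX; rewrite dfE; ring.
  + apply: (vanish_or_mem (b := pt (x' - y) (- t)) n1).
      by apply: G_mempt; [exact: map_f | rewrite S1 mem_int_range; lia].
    by move=> v vX; rewrite dfE ptE add_lfunE opp_lfunE intrN; ring.
  + apply: (vanish_or_mem (b := pt (x - y) t) p1).
      by apply: G_mempt; [exact: map_f | rewrite S1 mem_int_range].
    by move=> v vX; rewrite dfE; ring.
  + apply: (vanish_or_mem (b := df (x - y) (x' - y) t) p1).
      by apply: G_memdf => //; apply: (map_f (fun x => x - y)).
    by move=> v vX; rewrite !dfE !add_lfunE !opp_lfunE; ring.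
- by rewrite S0 in ss.
- by apply: (vanish_or_mem p1 (G_memz _ _ _)) => v _; rewrite mul1r.
- move: xys x's => /mapP[w wys ->] /mapP[w' w's ->].
  apply: (vanish_or_mem (b := df w w' t) p1).
    by apply: G_memdf; rewrite // in_cons ?wys ?w's orbT.
  by move=> v vX; rewrite !dfE !add_lfunE !opp_lfunE; ring.
- move: xys => /mapP[w wys ->]; move: ss; rewrite S1 mem_int_range => ss.
  apply: (vanish_or_mem (b := df w y s) p1).
    by apply: G_memdf; rewrite // in_cons ?wys ?eqxx ?orbT.
  by move=> v vX; rewrite dfE; ring.
Qed.

Lemma free_over_nil S : free_over [::] (G [::] S) [::].
Proof.
move=> W n0 iW dW; rewrite cats0.
have [_ /(_ 1 (fun=> 0)) [v vW [zv _]]] := iW.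
have nz : ~~ (W <= lker z)%VS.
  by apply/subvPn; exists v => //; rewrite memv_ker zv oner_eq0.
have e0 X : ifr X [::] (nseq (\dim X) 0%N).
  by rewrite /ifr (_ : arr X [::] = fset0); [exact: ifree_empty | apply/fsetP => H; rewrite !inE].
apply: (ifr_add (d := 0) (e' := nseq (\dim W) 0%N) (e'' := nseq n0 0%N) nz) => //.
- exact: e0.
- have <- : \dim (W :&: lker z) = n0.
    have := @hyperplane_dim _ _ W (W :&: lker z)%VS z (conj erefl nz).
    by rewrite dW addn0 => -[].
  exact: e0.
- by rewrite dW addn0.
Qed.

Lemma catalan_full r ys : size ys = r -> forall N lo hi, hi - lo + 1 = N.+1%:Z ->
  free_over ys (G ys (fun=> int_range lo hi)) (iota (N + r) r).
Proof.
elim: r ys => [|r IH] ys sys.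
  move=> N lo hi _; rewrite (size0nil sys); exact: free_over_nil.
have C lo : free_over ys (G ys (fun=> int_range lo (lo - 1))) (0%N :: iota (r.+2) r).
  case: ys sys => // y ys [sys] W n0 iW dW.
  have e0 : int_range lo (lo - 1) = [::].
    by rewrite /int_range; case: ifP => //; lia.
  have [s1 s2] := @catalan_origin W y ys (fun=> int_range lo (lo - 1)) (fun=> int_range (-1) 1)
    (fun=> e0) (fun=> erefl).
  apply: (ifr_eq s1 s2).
  have sys' : size [seq x - y | x <- ys] = r by rewrite size_map.
  have := IH _ sys' 2%N (-1) 1 erefl W n0.+1 (indep_diff iW).
  rewrite dW sys' /= sys addSnnS => /(_ erefl).
  by apply: ifr_perm; apply/seq.permP => q /=; rewrite !count_cat /= add2n; lia.
have full_eq ys0 lo hi : bound lo hi [::] =1 (fun=> int_range lo (hi + 1)) by [].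
have start lo : free_over ys (G ys (fun=> int_range lo lo)) (iota r.+1 r.+1).
  have := @raise_chain ys lo (lo - 1) 0%N (iota r.+2 r) _ (C lo) _ ys [::] (perm_refl _).
  rewrite sys /bound /= subrK => h; apply: h; first by [].
  move=> y ys' p; have -> : (lo <= lo - 1) = false by lia.
  by apply: (IH ys' _ 2%N); [have := perm_size p; rewrite sys => -[] | lia].
elim=> [|N IHN] lo hi lohi.
  by have -> : hi = lo by [lia]; apply: start.
have h0 : free_over ys (G ys (fun=> int_range lo (hi - 1))) ((N + r.+1)%N :: iota (N + r.+2) r).
  by have := IHN lo (hi - 1); rewrite /= -addnS; apply; lia.
have := @raise_chain ys lo (hi - 1) (N + r.+1)%N (iota (N + r.+2) r) _ _ _ ys [::] (perm_refl _).
rewrite /bound /= subrK => h W n0 iW dW; apply: ifr_perm (h _ _ _ W n0 iW dW).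
- rewrite perm_cons perm_cat2l sys -[X in perm_eq X _]/(iota (N.+1 + r.+1) r.+1).
  have -> : iota (N.+1 + r.+1) r.+1 = iota (N + r.+2) r ++ [:: (N + r.+1 + r.+1)%N].
    have -> : (N.+1 + r.+1 = N + r.+2)%N by lia.
    transitivity (iota (N + r.+2) (r + 1)); first by rewrite addn1.
    by rewrite iotaD; congr (_ ++ [:: _]); lia.
  by rewrite -cat1s perm_catC.
- by lia.
- exact: h0.
- move=> y ys' p; have -> : (lo <= hi - 1) = true by lia.
  have -> : (N + r.+2 = N.+2 + r)%N by lia.
  by apply: IH; [have := perm_size p; rewrite sys => -[] | lia].
Qed.

Lemma catalan_part ys1 ys2 N lo hi r : hi - lo + 1 = N.+1%:Z -> (size ys1 + size ys2)%N = r.+1 ->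
  free_over (ys1 ++ ys2) (G (ys1 ++ ys2) (bound lo hi ys1))
    ((N + r.+1 + size ys2)%N :: iota (N + r.+2) r).
Proof.
move=> lohi sr; apply: (raise_chain _ _ _ (perm_refl _)).
- by lia.
- have := @catalan_full r.+1 (ys1 ++ ys2) _ N lo hi lohi.
  by rewrite size_cat /= -addnS; apply.
- move=> y ys' p; have -> : (lo <= hi) = true by lia.
  have -> : (N + r.+2 = N.+2 + r)%N by lia.
  apply: catalan_full; last by lia.
  by have := perm_size p; rewrite size_cat sr => -[].
Qed.

End CatalanExponents.

(** * Simplicial vertices *)

Lemma fproper_witness (T : choiceType) (A B : {fset T}) : (A `<` B)%fset ->
  exists2 x, x \in B & x \notin A.
Proof. by rewrite fproperE => /andP[_ /fsubsetPn]. Qed.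

Section Tails.
Variables (F : numFieldType) (V : vectType F) (z : 'Hom(V, F^o)).
Implicit Types (W X : {vspace V}) (y a b g h : 'Hom(V, F^o)).
Implicit Types (L ys : seq 'Hom(V, F^o)) (tail : seq ('Hom(V, F^o) * {fset int})).
Local Notation pt := (point_form z).
Local Notation df := (diff_form z).
Local Notation indep := (indep z).
Local Notation free_over := (free_over z).
Local Notation G := (G z).

Lemma separate W ys (S : seq int) : indep W ys -> uniq S ->
  exists2 v, v \in W & uniq [seq g v : F | g : 'Hom(V, F^o) <-
    ys ++ [seq y + z | y <- ys] ++ [seq s%:~R *: z | s <- S]].
Proof.
move=> [uy hW] uS; have [M hM] := int_bound S.
have [v vW [zv yv]] := hW 1 (fun y => (M + (index y ys).*2%:Z)%:~R).
exists v => //.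
have -> : [seq g v : F | g : 'Hom(V, F^o) <-
    ys ++ [seq y + z | y <- ys] ++ [seq s%:~R *: z | s <- S]] =
  [seq s%:~R | s : int <- [seq M + (index y ys).*2%:Z | y <- ys] ++
     [seq M + (index y ys).*2%:Z + 1 | y <- ys] ++ S].
  rewrite !map_cat -!map_comp; congr (_ ++ (_ ++ _)).
  - by apply/eq_in_map => y /yv.
  - by apply/eq_in_map => y yys /=; rewrite add_lfunE zv yv // [RHS]intrD.
  - by apply: eq_map => s /=; rewrite scale_lfunE zv /GRing.scale /= mulr1.
rewrite map_inj_uniq; last exact: intr_inj.
have I (k : int) : {in ys &, injective (fun y => M + (index y ys).*2%:Z + k)}.
  by move=> y y' yys y's e; apply: (index_inj y yys y's); lia.
rewrite !cat_uniq uS andbT; apply/and4P; split.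
- by rewrite map_inj_in_uniq // => y y' yys y's e; apply: (I 0 _ _ yys y's); rewrite /= !addr0.
- apply/hasPn => x; rewrite mem_cat => /orP[/mapP[y _ ->]|/hM xM]; apply/mapP => -[y' _]; lia.
- by rewrite map_inj_in_uniq //; apply: I.
- by apply/hasPn => x /hM xM; apply/mapP => -[y' _]; lia.
Qed.

Definition next_set tail : {fset int} := if tail is u :: _ then u.2 else fset0.

Fixpoint strict_chain tail :=
  if tail is u :: tl then (next_set tl `<` u.2)%fset && strict_chain tl else true.

Fixpoint tail_forms ys tail : seq 'Hom(V, F^o) :=
  if tail is u :: tl then
    [seq u.1 - g | g <- ys ++ [seq s%:~R *: z | s <- u.2]] ++ tail_forms (u.1 :: ys) tl
  else [::].

Fixpoint tail_exps n tail : seq nat :=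
  if tail is u :: tl then (n + #|` u.2|)%N :: tail_exps n.+1 tl else [::].

Lemma tail_free tail ys L e :
  free_over ys L e -> {in L, forall b, span_of z ys b} -> z \in L ->
  {in ys &, forall y y', present L (y - y')} ->
  (forall y s, y \in ys -> s \in next_set tail -> present L (pt y s)) ->
  strict_chain tail ->
  free_over ([seq u.1 | u <- tail] ++ ys) (tail_forms ys tail ++ L)
    (tail_exps (size ys) tail ++ e).
Proof.
elim: tail ys L e => [//|[y S] tl IH] ys L e hL Ls zL Ld Lp /= /andP[/fproper_sub SS' ch].
pose E := ys ++ [seq s%:~R *: z | s <- S].
have h1 : free_over (y :: ys) ([seq y - g | g <- E] ++ L) (size E :: e).
  apply: free_over_add => //.
  - move=> g; rewrite mem_cat => /orP[/span_vertex //|/mapP[s _ ->]].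
    by move=> v zv _; rewrite scale_lfunE zv scaler0.
  - move=> W iW; have [v vW vu] := separate iW (fset_uniq S); exists v => //.
    apply: subseq_uniq vu; apply: map_subseq; apply: cat_subseq; first exact: subseq_refl.
    exact: suffix_subseq.
  - move=> g g'; rewrite !mem_cat => /orP[gys|/mapP[s sS ->]] /orP[g'ys|/mapP[s' s'S ->]].
    + exact: Ld.
    + exact: Lp.
    + by apply: present_opp (Lp _ _ g'ys sS) => v; rewrite ptE !add_lfunE !opp_lfunE !scale_lfunE opprB.
    + apply: (present_scale (k := s%:~R - s'%:~R) zL) => v.
      by rewrite add_lfunE opp_lfunE !scale_lfunE -scalerBl.
have := IH (y :: ys) _ _ h1; rewrite /= => h.
apply: free_over_perm (h _ _ _ _ _).
- by rewrite perm_sym -cat1s perm_catCA.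
- by move=> a; rewrite !mem_cat; do ![case: (a \in _) => //=].
- by rewrite size_cat size_map; apply/seq.permP => q; rewrite /= !count_cat /=; lia.
- move=> b; rewrite mem_cat => /orP[/mapP[g gE ->]|/Ls h']; last first.
    by apply: span_subset h' => x xs; rewrite in_cons xs orbT.
  rewrite -scaleN1r; apply: span_comb; first by apply: span_vertex; rewrite mem_head.
  move: gE; rewrite mem_cat => /orP[gys|/mapP[s _ ->]].
    by apply: span_vertex; rewrite in_cons gys orbT.
  by move=> v zv _; rewrite scale_lfunE zv scaler0.
- by rewrite mem_cat zL orbT.
- have py g : g \in ys -> present ([seq y - g0 | g0 <- E] ++ L) (y - g).
    by move=> gys; apply: present_mem; rewrite mem_cat (map_f (fun g => y - g)) // mem_cat gys.
  move=> x x'; rewrite !in_cons => /orP[/eqP ->|xs] /orP[/eqP ->|x's].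
  + by left=> v; rewrite add_lfunE opp_lfunE subrr.
  + exact: py.
  + by apply: present_opp (py _ xs) => v; rewrite !add_lfunE !opp_lfunE opprB.
  + by apply: present_subset (Ld _ _ xs x's) => b bL; rewrite mem_cat bL orbT.
- move=> x s; rewrite in_cons => /orP[/eqP ->|xs] /(fsubsetP SS') sS.
    apply: present_mem; rewrite mem_cat; apply/orP; left.
    by apply: map_f; rewrite mem_cat; apply/orP; right; apply: map_f.
  by apply: present_subset (Lp _ _ xs sS) => b bL; rewrite mem_cat bL orbT.
- exact: ch.
Qed.

Definition add_point (t : int) tail := [seq (u.1, (t |` u.2)%fset) | u <- tail].

Lemma tail_restrict X x (t : int) tail ys ys' : ys =i x :: ys' ->
  (forall v, v \in X -> x v = t%:~R * z v) ->
  sub_arr X (tail_forms ys tail) (tail_forms ys' (add_point t tail)) /\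
  sub_arr X (tail_forms ys' (add_point t tail)) (tail_forms ys tail).
Proof.
move=> ysE xE; have p1 := oner_neq0 F.
elim: tail ys ys' ysE => [|[y S] tl IH] ys ys' ysE; first by split.
have [|IH1 IH2] := IH (y :: ys) (y :: ys').
  by move=> a; rewrite !in_cons ysE in_cons orbCA.
split; rewrite /=; apply: sub_arr_cat.
- move=> _ /mapP[g gE ->].
  suff [g' g'E gg'] : exists2 g', g' \in ys' ++ [seq s%:~R *: z | s <- (t |` S)%fset] &
      forall v, v \in X -> g v = g' v.
    apply: (vanish_or_mem (b := y - g') p1).
      by rewrite mem_cat; apply/orP; left; apply: (map_f (fun g => y - g)).
    by move=> v vX; rewrite !add_lfunE !opp_lfunE gg' // mul1r.
  move: gE; rewrite mem_cat ysE in_cons -orbA => /or3P[/eqP ->|gys|/mapP[s sS ->]].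
  + exists (t%:~R *: z); last by move=> v vX; rewrite xE // scale_lfunE.
    rewrite mem_cat; apply/orP; right; apply: (map_f (fun s : int => s%:~R *: z)).
    by rewrite fset1U1.
  + by exists g; rewrite // mem_cat gys.
  + exists (s%:~R *: z) => //; rewrite mem_cat; apply/orP; right.
    by apply: (map_f (fun s : int => s%:~R *: z)); rewrite fset1Ur.
- exact: sub_arr_catl.
- move=> _ /mapP[g gE ->].
  suff [g' g'E gg'] : exists2 g', g' \in ys ++ [seq s%:~R *: z | s <- S] &
      forall v, v \in X -> g v = g' v.
    apply: (vanish_or_mem (b := y - g') p1).
      by rewrite mem_cat; apply/orP; left; apply: (map_f (fun g => y - g)).
    by move=> v vX; rewrite !add_lfunE !opp_lfunE gg' // mul1r.
  move: gE; rewrite mem_cat => /orP[gys|/mapP[s]].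
    by exists g; rewrite // mem_cat ysE in_cons gys orbT.
  rewrite in_fset1U => /orP[/eqP ->|sS] ->.
    exists x; first by rewrite mem_cat ysE mem_head.
    by move=> v vX; rewrite xE // scale_lfunE.
  exists (s%:~R *: z) => //; rewrite mem_cat; apply/orP; right.
  exact: (map_f (fun s : int => s%:~R *: z)).
- exact: sub_arr_catl.
Qed.

Lemma next_add t tail : next_set (add_point t tail) =
  if tail is u :: _ then (t |` u.2)%fset else fset0.
Proof. by case: tail. Qed.

Lemma strict_chain_add t tail : strict_chain tail -> t \notin next_set tail ->
  strict_chain (add_point t tail).
Proof.
elim: tail => [//|[y S] tl IH] /= /andP[SS' ch] tS.
have tS' : t \notin next_set tl.
  by apply: contra tS; apply/fsubsetP/fproper_sub.
rewrite IH // andbT; case: tl {IH ch} SS' tS' => [|[y' S'] tl] /= SS' tS'.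
  by rewrite fproperEneq fsub0set andbT; apply/eqP => e; have := fset1U1 t S; rewrite -e inE.
have [s sS sS'] := fproper_witness SS'; rewrite fproperE; apply/andP; split.
  apply/fsubsetP => x; rewrite !in_fset1U => /orP[->//|].
  by move/(fsubsetP (fproper_sub SS')) => ->; rewrite orbT.
apply/fsubsetPn; exists s; first by rewrite in_fset1U sS orbT.
by rewrite in_fset1U negb_or sS' andbT; apply: contraNneq tS => <-.
Qed.

Lemma tail_exps_add t n tail : strict_chain tail -> t \notin next_set tail ->
  tail_exps n (add_point t tail) = tail_exps n.+1 tail.
Proof.
elim: tail n => [//|[y S] tl IH] n /= /andP[SS' ch] tS.
rewrite IH //; last by apply: contra tS; apply/fsubsetP/fproper_sub.
by rewrite cardfsU1 tS add1n addnS.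
Qed.

Lemma flag_step W L0 L a e E : sub_arr W L0 L -> sub_arr W L L0 -> a \in L ->
  ~~ (W <= lker a)%VS -> ifr W L (1%N :: e :: E) ->
  flag_free L0 (W :&: lker a) E -> flag_free L0 W (e :: E).
Proof.
move=> s1 s2 aL na hW hX.
have /arrP[b bL [ab nb]] : (W :&: lker a)%VS \in arr W L0.
  by apply: arr_sub s2 _ _; apply/arrP; exists a.
rewrite ab in hX; apply: (flag_free_cons bL nb _ hX).
exact: ifr_eq s1 s2 hW.
Qed.

Lemma pt_hyperplane W ys y s : indep W (y :: ys) ->
  [/\ ~~ (W <= lker (pt y s))%VS, indep (W :&: lker (pt y s)) ys &
      (\dim (W :&: lker (pt y s))).+1 = \dim W].
Proof.
move=> iW; have sz : span_of z ys (s%:~R *: z).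
  by move=> v zv _; rewrite scale_lfunE zv scaler0.
by split; rewrite /point_form; [apply: vertex_not_sub iW _ sz | apply: indep_restrict |
  apply: dim_restrict iW _ sz].
Qed.

Lemma pt_zero W y s v : v \in (W :&: lker (pt y s))%VS -> y v = s%:~R * z v.
Proof. by rewrite memv_cap memv_ker ptE subr_eq0 => /andP[_ /eqP]. Qed.

Lemma add_point_vertices t tail : [seq u.1 | u <- add_point t tail] = [seq u.1 | u <- tail].
Proof. by rewrite /add_point -map_comp. Qed.

Lemma chain_flag tail W L0 : indep W [seq u.1 | u <- tail] -> \dim W = (size tail).+1 ->
  strict_chain tail -> sub_arr W L0 (tail_forms [::] tail ++ [:: z]) ->
  sub_arr W (tail_forms [::] tail ++ [:: z]) L0 -> flag_free L0 W (tail_exps 0 tail).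
Proof.
have [n] := ubnP (size tail); elim: n tail W => // n IH tail W; rewrite ltnS => tn iW dW ch s1 s2.
have hz : free_over [::] [:: z] [::] by apply: (free_over_nil (fun=> [::])).
have hW : ifr W (tail_forms [::] tail ++ [:: z]) (1%N :: tail_exps 0 tail).
  have := @tail_free tail [::] [:: z] [::] hz _ _ _ _ ch W 0%N.
  rewrite !cats0 /= size_map; apply=> //; first by move=> b; rewrite inE => /eqP ->; apply: span_z.
  exact: mem_head.
case: tail tn iW dW ch s1 s2 hW => [|[y S] tl] tn iW dW /= ch s1 s2 hW.
  by apply: flag_free_line; [exact: dW | exact: ifr_eq s1 s2 hW].
have /andP[/fproper_witness[s sS sS'] ch'] := ch.
have [nX iX dX] := pt_hyperplane s iW.
apply: (flag_step s1 s2 _ nX hW).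
  rewrite mem_cat; apply/orP; left; rewrite mem_cat; apply/orP; left.
  exact: (map_f (fun g => y - g) (map_f (fun s : int => s%:~R *: z) sS)).
rewrite -(tail_exps_add (t := s)) //.
have [t1 t2] := @tail_restrict (W :&: lker (pt y s))%VS y s tl [:: y] [::]
  (fun _ => erefl) (@pt_zero W y s).
have sX : (W :&: lker (pt y s) <= W)%VS by apply: capvSl.
apply: IH.
- by rewrite size_map.
- by rewrite add_point_vertices.
- by rewrite size_map; move: dX; rewrite dW => -[].
- exact: strict_chain_add.
- apply: sub_arr_trans (sub_arrS sX s1) _; rewrite -catA; apply: sub_arr_cat.
    move=> _ /mapP[g /mapP[s' s'S ->] ->].
    apply: (vanish_or_z (z := z) (k := s%:~R - s'%:~R)); first by rewrite mem_cat mem_head orbT.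
    by move=> v /pt_zero yv; rewrite add_lfunE opp_lfunE scale_lfunE yv mulrBl.
  by apply: sub_arr_cat; [apply: sub_arr_catr | apply: sub_arr_catl; apply: sub_arr_incl].
- apply: sub_arr_trans (sub_arrS sX s2); apply: sub_arr_cat.
    apply: sub_arr_trans t2 _; apply: sub_arr_incl => a aL.
    by rewrite !mem_cat aL orbT.
  by apply: sub_arr_incl => a aL; rewrite !mem_cat aL !orbT.
Qed.

End Tails.

Definition catalan_exps (p q N : nat) : seq nat :=
  rev (iota (N + p + q.*2 - 1) p) ++ rev (iota (N + p + q) q).

Lemma iota_rcons a n : iota a n.+1 = rcons (iota a n) (a + n)%N.
Proof. by rewrite -cats1 -[n.+1]addn1 iotaD. Qed.

Lemma catalan_exps_perm p q N r : (p + q = r.+1)%N ->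
  perm_eq (catalan_exps p q N.+1) ((N + r.+1 + q)%N :: iota (N + r.+2) r).
Proof.
rewrite /catalan_exps; case: p => [|p] pq.
  have -> : q = r.+1 by lia.
  rewrite /= perm_rev; have -> : (N.+1 + 0 + r.+1 = N + r.+2)%N by lia.
  rewrite -[X in perm_eq X _]/(iota _ r.+1) iota_rcons perm_rcons.
  by have -> : (N + r.+2 + r = N + r.+1 + r.+1)%N by lia.
have -> : (N.+1 + p.+1 + q.*2 - 1 = N + r.+1 + q)%N by lia.
have -> : (N.+1 + p.+1 + q = N + r.+2)%N by lia.
have -> : r = (q + p)%N by lia.
apply: (perm_trans (y := iota (N + (q + p).+1 + q) p.+1 ++ iota (N + (q + p).+2) q)).
  by apply: perm_cat; rewrite perm_rev.
rewrite /= perm_cons iotaD perm_catC perm_cat2l.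
by have -> : (N + (q + p).+2 + q = (N + (q + p).+1 + q).+1)%N by lia.
Qed.

Lemma catalan_exps_left p q N :
  catalan_exps p.+1 q N.+1 = (N + p.*2 + q.*2 + 1)%N :: catalan_exps p q N.+2.
Proof.
rewrite /catalan_exps iota_rcons rev_rcons cat_cons; congr (_ :: rev _ ++ rev _); first lia.
  by congr iota; lia.
by congr iota; lia.
Qed.

Lemma catalan_exps_right q N :
  catalan_exps 0 q.+1 N.+1 = (N + q.*2 + 2)%N :: catalan_exps 0 q N.+2.
Proof.
rewrite /catalan_exps /= -[X in rev X]/(iota _ q.+1) iota_rcons rev_rcons.
by congr (_ :: rev _); [lia | congr iota; lia].
Qed.

Lemma perm_move (T : eqType) (x d : T) s t : perm_eq (x :: s ++ d :: t) (d :: x :: s ++ t).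
Proof. by apply/seq.permP => b /=; rewrite !count_cat /=; lia. Qed.

Lemma hat_exps_base p q r N : (p + q = r)%N ->
  perm_eq (r.*2 + N.+1 :: catalan_exps p q N.+2)%N ((N + r.+1 + q)%N :: catalan_exps 0 r N.+2).
Proof.
case: r => [|r] rE.
  have -> : p = 0%N by lia.
  have -> : q = 0%N by lia.
  by have -> : (0.*2 + N.+1 = N + 1 + 0)%N by lia.
have e2 := catalan_exps_perm N.+1 rE; have e3 := catalan_exps_perm N.+1 (add0n r.+1).
have -> : (r.+1.*2 + N.+1 = N.+1 + r.+1 + r.+1)%N by lia.
have -> : (N + r.+2 + q = N.+1 + r.+1 + q)%N by lia.
apply/seq.permP => b; have /seq.permP/(_ b) := e2; have /seq.permP/(_ b) := e3.
by move=> /= -> ->; lia.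
Qed.

Lemma hat_exps_top p q r N : (p + q = r)%N ->
  perm_eq (catalan_exps p q.+1 N.+1) ((N + r.+1 + q).+1 :: catalan_exps 0 r N.+2).
Proof.
move=> rE; have e3 : (p + q.+1)%N = r.+1 by rewrite addnS rE.
apply: perm_trans (catalan_exps_perm N e3) _.
rewrite addnS perm_cons /catalan_exps /= perm_sym perm_rev.
by have -> : (N.+2 + 0 + r = N + r.+2)%N by lia.
Qed.

Lemma fset_range_card (S : {fset int}) lo hi n :
  (forall s, (s \in S) = (lo <= s <= hi)) -> hi - lo + 1 = n%:Z -> #|` S| = n.
Proof.
move=> hS hn.
have -> : S = [fset s in int_range lo hi]%fset.
  by apply/fsetP => s; rewrite inE mem_int_range hS.
rewrite card_fseq undup_id.
  by rewrite size_map size_iota; case: ifP; lia.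
by rewrite map_inj_uniq ?iota_uniq // => i j /addrI [].
Qed.

Section Flags.
Variables (F : numFieldType) (V : vectType F) (z : 'Hom(V, F^o)).
Implicit Types (W X : {vspace V}) (y a b g h : 'Hom(V, F^o)).
Implicit Types (L ys : seq 'Hom(V, F^o)) (tail : seq ('Hom(V, F^o) * {fset int})).
Local Notation pt := (point_form z).
Local Notation df := (diff_form z).
Local Notation indep := (indep z).
Local Notation free_over := (free_over z).
Local Notation G := (G z).

Lemma catalan_free ys1 ys2 lo hi N : hi - lo + 1 = N.+1%:Z ->
  free_over (ys1 ++ ys2) (G (ys1 ++ ys2) (bound lo hi ys1))
    (catalan_exps (size ys1) (size ys2) N.+1).
Proof.
move=> lohi; case E : (size ys1 + size ys2)%N => [|r].
  have /andP[/nilP -> /nilP ->] : nilp ys1 && nilp ys2 by rewrite /nilp; lia.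
  exact: free_over_nil.
move=> W n0 iW dW; apply: ifr_perm (catalan_part lohi E iW dW).
by rewrite perm_cons perm_cat2l catalan_exps_perm.
Qed.

Lemma G_present_diff ys (S : 'Hom(V, F^o) -> seq int) : {in ys &, forall y y', present (G ys S) (y - y')}.
Proof.
move=> y y' yys y's; apply: present_eq (present_mem (G_memdf z S yys y's (_ : -1 <= 0 <= 1))) => //.
by move=> v; rewrite dfE add_lfunE opp_lfunE mul0r subr0.
Qed.



Lemma catalan_tail_free ys1 ys2 lo hi N tail : hi - lo + 1 = N.+1%:Z -> strict_chain tail ->
  (forall s, s \in next_set tail -> lo <= s <= hi) ->
  free_over ([seq u.1 | u <- tail] ++ ys1 ++ ys2)
    (tail_forms z (ys1 ++ ys2) tail ++ G (ys1 ++ ys2) (bound lo hi ys1))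
    (catalan_exps (size ys1) (size ys2) N.+1 ++ tail_exps (size ys1 + size ys2) tail).
Proof.
move=> lohi ch hS.
apply: free_over_perm (tail_free (catalan_free (ys1 := ys1) (ys2 := ys2) lohi) _ _ _ _ ch) => //.
- by rewrite size_cat perm_catC.
- exact: G_span.
- exact: G_memz.
- exact: G_present_diff.
- move=> y s yys /hS hs; apply/present_mem/G_mempt => //.
  by rewrite /bound mem_int_range; case: ifP; lia.
Qed.

Lemma catalan_restrict X x ys1 ys2 ys1' ys2' lo hi : lo + 1 <= hi ->
  perm_eq (ys1 ++ ys2) (x :: ys1' ++ ys2') -> uniq (ys1 ++ ys2) ->
  {in ys1' ++ ys2', forall y, (y \in ys1) = (y \in ys1')} ->
  (forall v, v \in X -> x v = lo%:~R * z v) ->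
  sub_arr X (G (ys1 ++ ys2) (bound lo hi ys1)) (G (ys1' ++ ys2') (bound (lo - 1) hi ys1')) /\
  sub_arr X (G (ys1' ++ ys2') (bound (lo - 1) hi ys1')) (G (ys1 ++ ys2) (bound lo hi ys1)).
Proof.
move=> lohi p un ye xE.
have [||s1 s2] := @G_restrict _ _ z X x (ys1' ++ ys2') (bound lo hi ys1) (bound (lo - 1) hi ys1') lo.
- exact: xE.
- move=> y s yys; rewrite /bound -ye //; case: ifP => _; rewrite !mem_int_range;
  by apply/idP/idP; lia.
have e : G (ys1 ++ ys2) (bound lo hi ys1) =i G (x :: ys1' ++ ys2') (bound lo hi ys1).
  by apply: G_eq => // y; apply: perm_mem.
split; first by apply: sub_arr_trans s1; apply: sub_arr_incl => a; rewrite e.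
by apply: sub_arr_trans s2 _; apply: sub_arr_incl => a; rewrite e.
Qed.

Lemma sub_arr_cat2 W L1 L2 L1' L2' : sub_arr W L1 L1' -> sub_arr W L2 L2' ->
  sub_arr W (L1 ++ L2) (L1' ++ L2').
Proof.
by move=> h1 h2; apply: sub_arr_cat; [apply: sub_arr_catr | apply: sub_arr_catl].
Qed.

Definition next_vertex ys1 ys2 x ys1' ys2' :=
  [/\ perm_eq (ys1 ++ ys2) (x :: ys1' ++ ys2'),
      {in ys1' ++ ys2', forall y, (y \in ys1) = (y \in ys1')}, (ys2 = [::] -> ys2' = [::]) &
      (size ys1 = (size ys1').+1 /\ size ys2 = size ys2') \/
      [/\ size ys1 = 0, size ys1' = 0 & size ys2 = (size ys2').+1]%N].

Lemma pick_vertex ys1 ys2 n : (size ys1 + size ys2)%N = n.+1 -> uniq (ys1 ++ ys2) ->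
  exists x ys1' ys2', next_vertex ys1 ys2 x ys1' ys2'.
Proof.
case: ys1 => [|x ys1]; last first.
  move=> /= [sn] /andP[xn un]; exists x, ys1, ys2; split=> //; last by left.
  by move=> y yys; rewrite in_cons; case: eqP => // yx; rewrite -yx yys in xn.
by case: ys2 => [//|x ys2] /= [sn] _; exists x, [::], ys2; split=> //; right.
Qed.

Lemma catalan_flag n ys1 ys2 lo hi N tail W L0 : (size ys1 + size ys2)%N = n ->
  hi - lo + 1 = N.+2%:Z -> indep W ([seq u.1 | u <- tail] ++ ys1 ++ ys2) ->
  \dim W = (size tail + n).+1 -> strict_chain tail ->
  (forall s, s \in next_set tail -> lo + 1 <= s <= hi) ->
  sub_arr W L0 (tail_forms z (ys1 ++ ys2) tail ++ G (ys1 ++ ys2) (bound lo hi ys1)) ->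
  sub_arr W (tail_forms z (ys1 ++ ys2) tail ++ G (ys1 ++ ys2) (bound lo hi ys1)) L0 ->
  flag_free L0 W (catalan_exps (size ys1) (size ys2) N.+2 ++ tail_exps n tail).
Proof.
elim: n ys1 ys2 lo hi N tail W => [|n IH] ys1 ys2 lo hi N tail W sn lohi iW dW ch hS s1 s2.
  have y1 : ys1 = [::] by apply/nilP; rewrite /nilp; clear -sn; lia.
  have y2 : ys2 = [::] by apply/nilP; rewrite /nilp; clear -sn; lia.
  subst ys1 ys2; apply: (chain_flag (z := z) _ _ ch s1 s2); last by rewrite dW addn0.
  by move: iW; rewrite /= cats0.
have [uW _] := iW; have un : uniq (ys1 ++ ys2) by move: uW; rewrite cat_uniq => /and3P[].
have [x [ys1' [ys2' [p ye _ sz]]]] := pick_vertex sn un.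
have [m mE] : exists m, catalan_exps (size ys1) (size ys2) N.+2 =
    m :: catalan_exps (size ys1') (size ys2') N.+3.
  case: sz => [[-> ->]|[-> -> ->]]; eexists; first exact: catalan_exps_left.
  exact: catalan_exps_right.
have sn' : (size ys1' + size ys2')%N = n by move: sz sn; clear => -[[]|[]]; lia.
have iW' : indep W (x :: [seq u.1 | u <- tail] ++ ys1' ++ ys2').
  apply: indep_perm iW; rewrite (perm_catl _ p) -cat1s -[x :: _ ++ _]cat1s.
  by rewrite perm_catCA.
have [nX iX dX] := pt_hyperplane lo iW'.
have hW : ifr W (tail_forms z (ys1 ++ ys2) tail ++ G (ys1 ++ ys2) (bound lo hi ys1))
    (1%N :: catalan_exps (size ys1) (size ys2) N.+2 ++ tail_exps n.+1 tail).
  rewrite -sn; apply: (catalan_tail_free (n0 := 0) lohi ch _ iW).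
    by move=> s /hS; clear; lia.
  by rewrite dW !size_cat size_map sn.
have lo_next : lo \notin next_set tail by apply/negP => /hS; clear; lia.
rewrite mE /= in hW *.
apply: (flag_step s1 s2 _ nX hW).
  rewrite mem_cat; apply/orP; right; apply: G_mempt.
    by rewrite (perm_mem p) mem_head.
  by rewrite /bound mem_int_range; case: ifP => _; clear -lohi; lia.
rewrite -(tail_exps_add (t := lo)) //.
have sX : (W :&: lker (pt x lo) <= W)%VS by apply: capvSl.
have [t1 t2] := @tail_restrict _ _ z (W :&: lker (pt x lo))%VS x lo tail (ys1 ++ ys2)
  (ys1' ++ ys2') (perm_mem p) (@pt_zero _ _ z W x lo).
have lohi1 : lo + 1 <= hi by clear -lohi; lia.
have [c1 c2] := catalan_restrict lohi1 p un ye (@pt_zero _ _ z W x lo).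
apply: (IH ys1' ys2' (lo - 1) hi) => //.
- by clear -lohi; lia.
- by rewrite add_point_vertices.
- by rewrite size_map; move: dX; rewrite dW addnS => -[].
- exact: strict_chain_add.
- move=> s; rewrite next_add; case: (tail) hS => [|u tl] /= hS'; first by rewrite inE.
  by rewrite in_fset1U => /orP[/eqP ->|/hS']; clear -lohi; lia.
- by apply: sub_arr_trans (sub_arrS sX s1) _; apply: sub_arr_cat2.
- by apply: sub_arr_trans (sub_arrS sX s2); apply: sub_arr_cat2.
Qed.

Definition hat_edges ys (S : seq int) : seq 'Hom(V, F^o) :=
  ys ++ [seq x + z | x <- ys] ++ [seq s%:~R *: z | s <- S].

Variant hat_edge_spec ys (S : seq int) g : Prop :=
| Hat_vertex x (t : int) of x \in ys & 0 <= t <= 1 & (forall v, g v = x v + t%:~R * z v)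
| Hat_point s of s \in S & (forall v, g v = s%:~R * z v).

Lemma hat_edgeP ys S g : g \in hat_edges ys S -> hat_edge_spec ys S g.
Proof.
rewrite !mem_cat => /or3P[gys|/mapP[x xys ->]|/mapP[s sS ->]].
- by apply: (Hat_vertex (t := 0) S gys) => // v; rewrite mul0r addr0.
- by apply: (Hat_vertex (t := 1) S xys) => // v; rewrite add_lfunE mul1r.
- by apply: (Hat_point ys sS) => v; rewrite scale_lfunE.
Qed.

Lemma hat_edge_span ys S : {in hat_edges ys S, forall g, span_of z ys g}.
Proof.
move=> g /hat_edgeP[x t xys _ gE|s _ gE] v zv yv; rewrite gE zv mulr0 //.
by rewrite addr0 yv.
Qed.

Lemma hat_present ys1 ys2 lo hi :
  {in hat_edges (ys1 ++ ys2) (int_range (lo + 1) hi) &, forall g g',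
    present (G (ys1 ++ ys2) (bound lo hi ys1)) (g - g')}.
Proof.
have xs x (t s : int) : x \in ys1 ++ ys2 -> 0 <= t <= 1 -> s \in int_range (lo + 1) hi ->
    present (G (ys1 ++ ys2) (bound lo hi ys1)) (pt x (s - t)).
  rewrite mem_int_range => xys tt ss; apply/present_mem/G_mempt => //.
  by rewrite /bound mem_int_range; case: ifP; lia.
move=> g g' /hat_edgeP[x t xys tt gE|s ss gE] /hat_edgeP[x' t' x'ys tt' g'E|s' s's g'E].
- apply: present_eq (present_mem (G_memdf z _ xys x'ys (_ : -1 <= t' - t <= 1))); last by lia.
  by move=> v; rewrite dfE add_lfunE opp_lfunE gE g'E intrB; ring.
- apply: present_eq (xs x t s' xys tt s's) => v.
  by rewrite ptE add_lfunE opp_lfunE gE g'E intrB; ring.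
- apply: present_opp (xs x' t' s x'ys tt' ss) => v.
  by rewrite ptE add_lfunE opp_lfunE gE g'E intrB; ring.
- apply: (present_scale (G_memz _ _ _) (k := s%:~R - s'%:~R)) => v.
  by rewrite add_lfunE opp_lfunE gE g'E; ring.
Qed.

Lemma size_int_range lo hi n : hi - lo + 1 = n%:Z -> size (int_range lo hi) = n.
Proof. by rewrite size_map size_iota; case: ifP; lia. Qed.

Lemma uniq_int_range lo hi : uniq (int_range lo hi).
Proof. by rewrite map_inj_uniq ?iota_uniq // => i j /addrI []. Qed.

Lemma hat_free0 ys1 ys2 y lo hi N : hi - lo + 1 = N.+2%:Z ->
  free_over (y :: ys1 ++ ys2)
    ([seq y - g | g <- hat_edges (ys1 ++ ys2) (int_range (lo + 1) hi)] ++
      G (ys1 ++ ys2) (bound lo hi ys1))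
    ((size (ys1 ++ ys2)).*2 + N.+1 :: catalan_exps (size ys1) (size ys2) N.+2)%N.
Proof.
move=> lohi; have -> : ((size (ys1 ++ ys2)).*2 + N.+1)%N =
    size (hat_edges (ys1 ++ ys2) (int_range (lo + 1) hi)).
  rewrite /hat_edges !size_cat !size_map -size_cat -/(int_range _ _).
  by rewrite -(size_map (fun n : nat => lo + 1 + n%:Z)) (@size_int_range _ _ N.+1) ?size_cat; lia.
apply: free_over_add.
- exact: catalan_free lohi.
- exact: G_span.
- exact: hat_edge_span.
- by move=> W iW; apply: separate iW (uniq_int_range _ _).
- exact: hat_present.
Qed.

(* With the last point [hi + 1] on [y], the restriction to it fills up all the
   points [hi + 1] of the other vertices. *)
Lemma hat_free1 ys1 ys2 y lo hi N : hi - lo + 1 = N.+2%:Z ->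
  free_over (y :: ys1 ++ ys2)
    (pt y (hi + 1) :: [seq y - g | g <- hat_edges (ys1 ++ ys2) (int_range (lo + 1) hi)] ++
      G (ys1 ++ ys2) (bound lo hi ys1))
    (catalan_exps (size ys1) (size ys2).+1 N.+1).
Proof.
move=> lohi W n0 iW dW; set ys := ys1 ++ ys2 in iW dW *.
pose r := size ys; have p1 := oner_neq0 F.
have rE : (size ys1 + size ys2)%N = r by rewrite /r size_cat.
have sz : span_of z ys ((hi + 1)%:~R *: z) by move=> v zv _; rewrite scale_lfunE zv scaler0.
have us : uniq (hi + 1 :: int_range (lo + 1) hi).
  by rewrite cons_uniq uniq_int_range mem_int_range; lia.
have [v vW vu] := separate (indep_tail iW) us.
have hr : free_over ys (G ys (fun=> int_range lo (hi + 1))) (catalan_exps 0 r N.+2).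
  have := @catalan_free [::] ys lo hi N.+1 lohi.
  by rewrite cat0s; apply: free_over_perm => //; apply: G_eq.
pose d := (N + r.+1 + size ys2)%N.
have e1 := hat_exps_base N rE; have e2 := hat_exps_top N rE.
apply: (ifr_add (d := d) (e' := 1%N :: nseq n0 0%N ++ ((size ys).*2 + N.+1)%N ::
    catalan_exps (size ys1) (size ys2) N.+2) (e'' := 1%N :: nseq n0 0%N ++ catalan_exps 0 r N.+2)).
- exact: vertex_not_sub iW _ sz.
- apply: (new_edge iW (@G_span _ _ z _ _) sz (@hat_edge_span _ _) vW) => g gE.
  have : perm_eq (ys ++ [seq x + z | x <- ys] ++ [seq s%:~R *: z | s <- hi + 1 :: int_range (lo + 1) hi])
      ((hi + 1)%:~R *: z :: hat_edges ys (int_range (lo + 1) hi)).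
    by apply/seq.permP => b; rewrite /= !count_cat /=; clear; lia.
  move=> /(perm_map (fun g : 'Hom(V, F^o) => g v : F)) /perm_uniq; rewrite vu => /esym /= /andP[vn _].
  by apply: contraNneq vn => ->; apply: (map_f (fun g : 'Hom(V, F^o) => g v : F)).
- exact: hat_free0 lohi W n0 iW dW.
- have yE u : u \in (W :&: lker (pt y (hi + 1)))%VS -> y u = (hi + 1)%:~R * z u := @pt_zero _ _ z _ _ _ u.
  apply: (ifr_eq (L' := G ys (fun=> int_range lo (hi + 1)))).
  + apply: sub_arr_cat; last first.
      apply: sub_arr_incl; apply: G_subset => // x xys s.
      by rewrite /bound !mem_int_range; case: ifP => _; clear; lia.
    move=> _ /mapP[g /hat_edgeP[x t xys tt gE|s ss gE] ->].
      apply: (vanish_or_mem (b := pt x (hi + 1 - t)) (k := -1)); first by rewrite oppr_eq0.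
        by apply: G_mempt => //; rewrite mem_int_range; clear -lohi tt; lia.
      by move=> u /yE yu; rewrite ptE add_lfunE opp_lfunE yu gE intrB; ring.
    apply: (vanish_or_z (z := z) (k := (hi + 1 - s)%:~R)); first exact: G_memz.
    by move=> u /yE yu; rewrite add_lfunE opp_lfunE yu gE intrB; ring.
  + move=> a /GP[->|x x' t xys x'ys tt ->|x s xys ss ->].
    * by apply: (vanish_or_mem (b := z) p1) => [|u _]; rewrite ?mul1r // mem_cat G_memz orbT.
    * apply: (vanish_or_mem (b := df x x' t) p1) => [|u _]; rewrite ?mul1r //.
      by rewrite mem_cat G_memdf ?orbT.
    * have [se|sn] := eqVneq s (hi + 1).
        apply: (vanish_or_mem (b := y - x) (k := -1)); first by rewrite oppr_eq0.
          by rewrite mem_cat; apply/orP; left; apply: (map_f (fun g => y - g)); rewrite mem_cat xys.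
        by move=> u /yE yu; rewrite ptE add_lfunE opp_lfunE yu se; ring.
      apply: (vanish_or_mem (b := pt x s) p1) => [|u _]; rewrite ?mul1r //.
      rewrite mem_cat; apply/orP; right; apply: G_mempt => //.
      by move: ss sn; rewrite /bound !mem_int_range; case: ifP => _; clear; lia.
  + apply: hr; first exact: (indep_restrict iW sz).
    by have := dim_restrict iW sz; rewrite dW /= addnS => -[].
- apply: (perm_trans (y := 1%N :: nseq n0 0%N ++ (d :: catalan_exps 0 r N.+2))).
    by rewrite perm_cons perm_cat2l.
  exact: perm_move.
- apply: (perm_trans (y := 1%N :: nseq n0 0%N ++ (d.+1 :: catalan_exps 0 r N.+2))).
    by rewrite perm_cons perm_cat2l.
  exact: perm_move.
Qed.

Lemma hat_free ys1 ys2 y lo hi N (top : bool) (S : {fset int}) : hi - lo + 1 = N.+2%:Z ->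
  (top \/ ys2 = [::]) -> (forall s, (s \in S) = (lo + 1 <= s <= hi + (top : nat)%:Z)) ->
  free_over (y :: ys1 ++ ys2)
    ([seq y - g | g <- hat_edges (ys1 ++ ys2) S] ++ G (ys1 ++ ys2) (bound lo hi ys1))
    (catalan_exps (size ys1 + ~~ top) (size ys2 + top) N.+1).
Proof.
move=> lohi ht hS.
have mapE (s : int) : (y - s%:~R *: z \in [seq y - g | g <- hat_edges (ys1 ++ ys2) S]) || ~~ (s \in S).
  case sS: (s \in S); rewrite /= ?orbT // orbF; apply: (map_f (fun g => y - g)).
  by rewrite !mem_cat; apply/or3P/Or33; apply: (map_f (fun s : int => s%:~R *: z)).
case: top ht hS => ht hS.
  rewrite addn0 addn1; apply: free_over_perm (@hat_free1 ys1 ys2 y lo hi N lohi) => // a.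
  rewrite in_cons !mem_cat orbA; congr (_ || _); apply/idP/idP.
    case/orP=> [/eqP ->|/mapP[g gE ->]].
      by have := mapE (hi + 1); rewrite hS; have -> : lo + 1 <= hi + 1 <= hi + 1 by [lia]; rewrite orbF.
    apply: (map_f (fun g => y - g)); move: gE; rewrite !mem_cat => /or3P[->//|->|]; rewrite ?orbT //.
    move=> /mapP[s]; rewrite mem_int_range => ss ->; apply/or3P/Or33.
    by apply: (map_f (fun s : int => s%:~R *: z)); rewrite hS; lia.
  move=> /mapP[g gE ->]; move: gE; rewrite !mem_cat => /or3P[g1|g1|].
  - by apply/orP; right; apply: (map_f (fun g => y - g)); rewrite !mem_cat g1.
  - by apply/orP; right; apply: (map_f (fun g => y - g)); rewrite !mem_cat g1 orbT.
  move=> /mapP[s sS ->]; have [->|sn] := eqVneq s (hi + 1); first by rewrite eqxx.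
  apply/orP; right; apply: (map_f (fun g => y - g)); rewrite !mem_cat; apply/or3P/Or33.
  by apply: (map_f (fun s : int => s%:~R *: z)); move: sS; rewrite hS mem_int_range; lia.
case: ht => // y2; rewrite y2 addn0 addn1 catalan_exps_left cats0 /=.
have := @hat_free0 ys1 [::] y lo hi N lohi; rewrite cats0 => h.
apply: free_over_perm h => //; last first.
  by have -> : (N + (size ys1).*2 + 0 + 1 = (size ys1).*2 + N.+1)%N by lia.
move=> a; rewrite !mem_cat; congr (_ || _).
have eS : hat_edges ys1 (int_range (lo + 1) hi) =i hat_edges ys1 S.
  move=> b; rewrite !mem_cat; congr (_ || (_ || _)); apply: eq_mem_map => s.
  by rewrite hS mem_int_range addr0.
exact: (eq_mem_map (fun g => y - g) eS).
Qed.

Lemma hat_restrict X x y lo ys ys' (S : {fset int}) : ys =i x :: ys' ->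
  lo + 1 \in S -> (forall v, v \in X -> x v = lo%:~R * z v) ->
  sub_arr X [seq y - g | g <- hat_edges ys S] [seq y - g | g <- hat_edges ys' (lo |` S)%fset] /\
  sub_arr X [seq y - g | g <- hat_edges ys' (lo |` S)%fset] [seq y - g | g <- hat_edges ys S].
Proof.
move=> ysE lS xE; have p1 := oner_neq0 F.
have edge_sub (E E' : seq 'Hom(V, F^o)) : (forall g, g \in E -> exists2 g', g' \in E' & forall v, v \in X -> g v = g' v) ->
    sub_arr X [seq y - g | g <- E] [seq y - g | g <- E'].
  move=> h _ /mapP[g /h[g' g'E gg'] ->].
  apply: (vanish_or_mem (b := y - g') p1); first exact: (map_f (fun g => y - g)).
  by move=> v vX; rewrite !add_lfunE !opp_lfunE gg' // mul1r.
have pS s (T : {fset int}) ys0 : s \in T -> s%:~R *: z \in hat_edges ys0 T.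
  by move=> sT; rewrite !mem_cat; apply/or3P/Or33; apply: (map_f (fun s : int => s%:~R *: z)).
split; apply: edge_sub => g; rewrite !mem_cat => /or3P[|/mapP[x']|/mapP[s]].
- rewrite ysE in_cons => /orP[/eqP ->|gys]; last by exists g; rewrite // mem_cat gys.
  exists (lo%:~R *: z); first by apply: pS; rewrite fset1U1.
  by move=> v vX; rewrite xE // scale_lfunE.
- rewrite ysE in_cons => /orP[/eqP ->|x'ys] ->.
    exists ((lo + 1)%:~R *: z); first by apply: pS; rewrite fset1Ur.
    by move=> v vX; rewrite add_lfunE scale_lfunE xE // intrD /GRing.scale /=; ring.
  by exists (x' + z); rewrite // !mem_cat (map_f (fun x => x + z)) ?orbT.
- by move=> sS ->; exists (s%:~R *: z); rewrite // pS // fset1Ur.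
- by move=> gys; exists g; rewrite // mem_cat ysE in_cons gys orbT.
- move=> x'ys ->; exists (x' + z) => //; rewrite !mem_cat (map_f (fun x => x + z)) ?orbT //.
  by rewrite ysE in_cons x'ys orbT.
- rewrite in_fset1U => /orP[/eqP ->|sS] ->; last by exists (s%:~R *: z); rewrite // pS.
  exists x; first by rewrite mem_cat ysE mem_head.
  by move=> v vX; rewrite xE // scale_lfunE.
Qed.

Lemma hat_tail_free ys1 ys2 y lo hi N (top : bool) (S : {fset int}) tail :
  hi - lo + 1 = N.+2%:Z -> (top \/ ys2 = [::]) ->
  (forall s, (s \in S) = (lo + 1 <= s <= hi + (top : nat)%:Z)) ->
  strict_chain ((y, S) :: tail) -> (forall s, s \in next_set tail -> lo + 1 <= s <= hi) ->
  free_over ([seq u.1 | u <- tail] ++ y :: ys1 ++ ys2)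
    (tail_forms z (y :: ys1 ++ ys2) tail ++
      [seq y - g | g <- hat_edges (ys1 ++ ys2) S] ++ G (ys1 ++ ys2) (bound lo hi ys1))
    (catalan_exps (size ys1 + ~~ top) (size ys2 + top) N.+1 ++
      tail_exps (size ys1 + size ys2).+1 tail).
Proof.
move=> lohi ht hS /= /andP[/fproper_sub/fsubsetP nS ch] hN.
set ys := ys1 ++ ys2; set L := _ ++ G ys _.
have zL : z \in L by rewrite mem_cat G_memz orbT.
have py g : g \in hat_edges ys S -> present L (y - g).
  by move=> gE; apply: present_mem; rewrite mem_cat; apply/orP; left; apply: (map_f (fun g => y - g)).
have GL : {subset G ys (bound lo hi ys1) <= L} by move=> a aG; rewrite mem_cat aG orbT.
have Ls : {in L, forall b, span_of z (y :: ys) b}.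
  move=> b; rewrite mem_cat => /orP[/mapP[g gE ->]|/G_span h']; last first.
    by apply: span_subset h' => x xs; rewrite in_cons xs orbT.
  rewrite -scaleN1r; apply: span_comb; first by apply: span_vertex; rewrite mem_head.
  by apply: span_subset (hat_edge_span gE) => x xs; rewrite in_cons xs orbT.
have Ld : {in y :: ys &, forall x x', present L (x - x')}.
  move=> x x'; rewrite !in_cons => /orP[/eqP ->|xs] /orP[/eqP ->|x's].
  - by left=> v; rewrite add_lfunE opp_lfunE subrr.
  - by apply: py; rewrite mem_cat x's.
  - have xE : x \in hat_edges ys S by rewrite mem_cat xs.
    by apply: present_opp (py _ xE) => v; rewrite !add_lfunE !opp_lfunE opprB.
  - by apply: present_subset GL (G_present_diff _ xs x's).
have Lp x s : x \in y :: ys -> s \in next_set tail -> present L (pt x s).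
  rewrite in_cons => /orP[/eqP ->|xs] sN.
    apply: py; rewrite !mem_cat; apply/or3P/Or33; apply: (map_f (fun s : int => s%:~R *: z)).
    exact: nS.
  apply/present_mem/GL/G_mempt => //.
  by have := hN s sN; rewrite /bound mem_int_range; case: ifP; lia.
have h := tail_free (hat_free (y := y) lohi ht hS) Ls zL Ld Lp ch.
apply: free_over_perm h; [exact: perm_refl | by [] |].
by rewrite /= size_cat perm_catC.
Qed.

Lemma hat_flag n ys1 ys2 y lo hi N (top : bool) (S : {fset int}) tail W L0 :
  (size ys1 + size ys2)%N = n ->
  hi - lo + 1 = N.+2%:Z -> (top \/ ys2 = [::]) ->
  (forall s, (s \in S) = (lo + 1 <= s <= hi + (top : nat)%:Z)) ->
  indep W ([seq u.1 | u <- tail] ++ y :: ys1 ++ ys2) ->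
  \dim W = (size tail + n.+1).+1 -> strict_chain ((y, S) :: tail) ->
  (forall s, s \in next_set tail -> lo + 1 <= s <= hi) ->
  sub_arr W L0 (tail_forms z (y :: ys1 ++ ys2) tail ++
      [seq y - g | g <- hat_edges (ys1 ++ ys2) S] ++ G (ys1 ++ ys2) (bound lo hi ys1)) ->
  sub_arr W (tail_forms z (y :: ys1 ++ ys2) tail ++
      [seq y - g | g <- hat_edges (ys1 ++ ys2) S] ++ G (ys1 ++ ys2) (bound lo hi ys1)) L0 ->
  flag_free L0 W (catalan_exps (size ys1 + ~~ top) (size ys2 + top) N.+1 ++ tail_exps n.+1 tail).
Proof.
elim: n ys1 ys2 lo hi N S tail W => [|n IH] ys1 ys2 lo hi N S tail W sn lohi ht hS iW dW ch hN s1 s2.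
  have y1 : ys1 = [::] by apply/nilP; rewrite /nilp; clear -sn; lia.
  have y2 : ys2 = [::] by apply/nilP; rewrite /nilp; clear -sn; lia.
  subst ys1 ys2.
  have -> : catalan_exps (size (Nil 'Hom(V, F^o)) + ~~ top) (size (Nil 'Hom(V, F^o)) + top) N.+1 =
      [:: #|` S|].
    rewrite (fset_range_card (n := N.+1 + top) hS); last by clear -lohi; case: top; lia.
    by rewrite /= !add0n; clear; case: top; rewrite /catalan_exps /= /rev /=; congr [:: _]; lia.
  apply: (@chain_flag _ _ z ((y, S) :: tail) W L0) => //.
  - apply: indep_perm iW; rewrite /= -cat1s perm_catC; exact: perm_refl.
  - by rewrite dW /= addn1.
  - apply: sub_arr_trans s1 _; apply: sub_arr_incl => a; rewrite /= !mem_cat.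
    by do ![case: (a \in _) => //=].
  - apply: sub_arr_trans s2; apply: sub_arr_incl => a; rewrite /= !mem_cat.
    by do ![case: (a \in _) => //=].
have [uW _] := iW.
have un : uniq (ys1 ++ ys2) by move: uW; rewrite cat_uniq => /and3P[_ _ /= /andP[]].
have [x [ys1' [ys2' [p ye y2' sz]]]] := pick_vertex sn un.
have [m mE] : exists m, catalan_exps (size ys1 + ~~ top) (size ys2 + top) N.+1 =
    m :: catalan_exps (size ys1' + ~~ top) (size ys2' + top) N.+2.
  case: sz => [[-> ->]|[-> -> sz]]; first by eexists; exact: catalan_exps_left.
  case: ht => [tt|y2]; last by rewrite y2 in sz.
  by rewrite tt sz; eexists; exact: catalan_exps_right.
have sn' : (size ys1' + size ys2')%N = n by move: sz sn; clear => -[[]|[]]; lia.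
have iW' : indep W (x :: [seq u.1 | u <- tail] ++ y :: ys1' ++ ys2').
  apply: indep_perm iW; apply/seq.permP => b; have /seq.permP/(_ b) := p.
  by rewrite /= !count_cat /= !count_cat; clear; lia.
have [nX iX dX] := pt_hyperplane lo iW'.
have hW : ifr W (tail_forms z (y :: ys1 ++ ys2) tail ++
      [seq y - g | g <- hat_edges (ys1 ++ ys2) S] ++ G (ys1 ++ ys2) (bound lo hi ys1))
    (1%N :: catalan_exps (size ys1 + ~~ top) (size ys2 + top) N.+1 ++ tail_exps n.+2 tail).
  rewrite -sn; apply: (hat_tail_free (n0 := 0) lohi ht hS ch hN iW).
  by rewrite dW !size_cat size_map /= size_cat sn.
have lo_next : lo \notin next_set tail by apply/negP => /hN; clear; lia.
have lo_S : lo \notin S by rewrite hS; clear; lia.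
rewrite mE /= in hW *.
apply: (flag_step s1 s2 _ nX hW).
  rewrite !mem_cat; apply/orP; right; apply/orP; right; apply: G_mempt.
    by rewrite (perm_mem p) mem_head.
  by rewrite /bound mem_int_range; case: ifP => _; clear -lohi; lia.
have /andP[_ ch'] := ch.
rewrite -(tail_exps_add (t := lo)) //.
have sX : (W :&: lker (pt x lo) <= W)%VS by apply: capvSl.
have xE := @pt_zero _ _ z W x lo.
have yys : y :: ys1 ++ ys2 =i x :: y :: ys1' ++ ys2'.
  by move=> a; rewrite !in_cons (perm_mem p) in_cons orbCA.
have [t1 t2] := tail_restrict tail yys xE.
have lohi1 : lo + 1 <= hi by clear -lohi; lia.
have [c1 c2] := catalan_restrict lohi1 p un ye xE.
have lS : lo + 1 \in S by rewrite hS; clear -lohi; lia.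
have [h1 h2] := hat_restrict y (perm_mem p) lS xE.
apply: (IH ys1' ys2' (lo - 1) hi _ (lo |` S)%fset (add_point lo tail)) => //.
- by clear -lohi; lia.
- by case: ht => [tt|/y2' ->]; [left | right].
- by move=> s; rewrite in_fset1U hS; clear -lohi; apply/idP/idP; lia.
- by rewrite add_point_vertices.
- by rewrite size_map; move: dX; rewrite dW addnS => -[].
- exact: (strict_chain_add ch lo_S).
- move=> s; rewrite next_add; case: (tail) hN => [|u tl] /= hS'; first by rewrite inE.
  by rewrite in_fset1U => /orP[/eqP ->|/hS']; clear -lohi; lia.
- apply: sub_arr_trans (sub_arrS sX s1) _; apply: sub_arr_cat2 => //; exact: sub_arr_cat2.
- apply: sub_arr_trans (sub_arrS sX s2); apply: sub_arr_cat2 => //; exact: sub_arr_cat2.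
Qed.

End Flags.

(** * The two families *)

Lemma catalan_exps_map p q N : catalan_exps p q N.+1 =
  [seq (N + (p + q).*2 - i.+1 + (p <= i))%N | i <- iota 0 (p + q)].
Proof.
rewrite iotaD map_cat /catalan_exps; congr (_ ++ _); apply: (@eq_from_nth _ 0%N);
  rewrite ?size_rev ?size_map ?size_iota // => i hi; rewrite nth_rev ?size_iota //;
  rewrite (nth_map 0%N) ?size_iota // !nth_iota //; lia.
Qed.

Lemma catalan_exps_sorted p q N : sorted leq (1%N :: rev (catalan_exps p q N.+1)).
Proof.
rewrite /catalan_exps rev_cat !revK sorted_pairwise; last exact: leq_trans.
rewrite /= pairwise_cat; apply/and4P; split.
- by apply/allP => x; rewrite mem_cat !mem_iota; lia.
- by apply/allrelP => x y; rewrite !mem_iota; lia.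
- by rewrite -sorted_pairwise; [exact: iota_sorted | exact: leq_trans].
- by rewrite -sorted_pairwise; [exact: iota_sorted | exact: leq_trans].
Qed.

Section Segments.
Variable l : nat.

Definition seg (a b : nat) : seq 'I_l := [seq i : 'I_l <- enum 'I_l | (a <= i < b)%N].

Lemma mem_seg a b (i : 'I_l) : (i \in seg a b) = (a <= i < b)%N.
Proof. by rewrite mem_filter mem_enum andbT. Qed.

Lemma seg_uniq a b : uniq (seg a b).
Proof. by rewrite filter_uniq // enum_uniq. Qed.

Lemma val_seg a b : (a <= b <= l)%N -> map val (seg a b) = iota a (b - a).
Proof.
move=> /andP[ab bl]; transitivity [seq i <- map (@nat_of_ord l) (enum 'I_l) | (a <= i < b)%N].
  by rewrite filter_map.
rewrite val_enum_ord.
have -> : l = (a + ((b - a) + (l - b)))%N by lia.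
rewrite !iotaD !filter_cat; do 2 rewrite [X in _ ++ X]/=.
rewrite (@eq_in_filter _ _ pred0 (iota 0 a)) ?filter_pred0; last first.
  by move=> i; rewrite mem_iota /=; lia.
rewrite (@eq_in_filter _ _ predT (iota _ (b - a))) ?filter_predT; last first.
  by move=> i; rewrite mem_iota /=; lia.
rewrite (@eq_in_filter _ _ pred0 (iota _ (l - b))) ?filter_pred0 ?cats0 ?add0n //.
by move=> i; rewrite mem_iota /=; lia.
Qed.

Lemma size_seg a b : (a <= b <= l)%N -> size (seg a b) = (b - a)%N.
Proof. by move=> h; rewrite -(size_map val) val_seg // size_iota. Qed.

Lemma seg_cons a b (ab : (a < b)%N) (bl : (b <= l)%N) :
  seg a b = Ordinal (leq_trans ab bl) :: seg a.+1 b.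
Proof.
apply: (inj_map val_inj); rewrite /= !val_seg ?ab ?bl ?(ltnW ab) //.
by have -> : (b - a = (b - a.+1).+1)%N by lia.
Qed.

Lemma seg_nil a : seg a a = [::].
Proof.
rewrite /seg (@eq_in_filter _ _ pred0) ?filter_pred0 // => i _ /=; lia.
Qed.

End Segments.

Section Cones.
Variables (F : numFieldType) (l : nat).
Local Notation V := 'rV[F]_(l + 1).

Definition entry (j : 'I_(l + 1)) (v : V) : F^o := v 0 j.

Lemma entry_linear j : linear (entry j).
Proof. by move=> k u v; rewrite /entry !mxE. Qed.

HB.instance Definition _ j := GRing.isLinear.Build F V F^o _ (entry j) (entry_linear j).

Definition crd (i : 'I_l) : 'Hom(V, F^o) := linfun (entry (lshift 1 i)).
Definition zcrd : 'Hom(V, F^o) := linfun (entry (rshift l ord0)).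

Lemma crdE i v : crd i v = v 0 (lshift 1 i). Proof. by rewrite lfunE. Qed.
Lemma zcrdE v : zcrd v = v 0 (rshift l ord0). Proof. by rewrite lfunE. Qed.

Definition eq_form (h : affine_equation F l) : 'Hom(V, F^o) :=
  \sum_i h.1 0 i *: crd i - h.2 *: zcrd.

Lemma eq_formE h v : eq_form h v = \sum_i h.1 0 i * crd i v - h.2 * zcrd v.
Proof.
rewrite /eq_form add_lfunE opp_lfunE scale_lfunE sum_lfunE; congr (_ - _).
by apply: eq_bigr => i _; rewrite scale_lfunE.
Qed.

Lemma eq_form_diff i j t v : eq_form (eq_diff i j t) v = crd i v - crd j v - t * zcrd v.
Proof.
rewrite eq_formE /=; congr (_ - _).
transitivity (\sum_k ((k == i)%:R * crd k v - (k == j)%:R * crd k v)).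
  by apply: eq_bigr => k _; rewrite !mxE mulrBl eqxx.
rewrite sumrB (bigD1 i) //= [X in _ - X](bigD1 j) //= !eqxx !mul1r.
by rewrite !big1 ?addr0 // => k /negbTE ->; rewrite mul0r.
Qed.

Lemma eq_form_coord i s v : eq_form (eq_coord F i s) v = crd i v - s%:~R * zcrd v.
Proof.
rewrite eq_formE /=; congr (_ - _); rewrite (bigD1 i) //= big1 => [|k ki].
  by rewrite mxE !eqxx mul1r addr0.
by rewrite mxE (negbTE ki) andbF mul0r.
Qed.

Lemma crd_values (c : 'I_l -> F) z0 : exists v, (forall i, crd i v = c i) /\ zcrd v = z0.
Proof.
exists (row_mx (\row_i c i) (z0%:M)); split=> [i|].
  by rewrite crdE row_mxEl mxE.
by rewrite zcrdE row_mxEr mxE mulr1n.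
Qed.

Lemma crd_inj : injective crd.
Proof.
move=> i j e; have [v [vc _]] := crd_values (fun k => (k == i)%:R) 0.
have : crd i v = crd j v by rewrite e.
by rewrite !vc eqxx; case: eqP => // _ /eqP; rewrite oner_eq0.
Qed.

Lemma crd_indep (s : seq 'I_l) : uniq s -> indep zcrd fullv (map crd s).
Proof.
move=> us; split; first by rewrite map_inj_uniq //; exact: crd_inj.
move=> z0 c; have [v [vc vz]] := crd_values (fun i => c (crd i)) z0.
by exists v; rewrite ?memvf //; split=> // _ /mapP[i _ ->].
Qed.

Lemma cone_hyperplaneE h : cone_hyperplane h = lker (eq_form h).
Proof.
apply/vspaceP => v; rewrite [RHS]memv_ker eq_formE subr_eq0.
have -> : v = row_mx (lsubmx v) ((v 0 (rshift l ord0))%:M).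
  rewrite -[LHS]hsubmxK; congr row_mx; apply/matrixP => i j.
  by rewrite !ord1 !mxE eqxx mulr1n.
rewrite mem_cone_hyperplane zcrdE row_mxEr mxE eqxx mulr1n; congr (_ == _).
by apply: eq_bigr => i _; rewrite crdE row_mxEl.
Qed.

Lemma hyperplane_at_infinityE : hyperplane_at_infinity F l = lker zcrd.
Proof.
apply/vspaceP => v; rewrite [RHS]memv_ker zcrdE.
have -> : v = row_mx (lsubmx v) ((v 0 (rshift l ord0))%:M).
  rewrite -[LHS]hsubmxK; congr row_mx; apply/matrixP => i j.
  by rewrite !ord1 !mxE eqxx mulr1n.
by rewrite mem_hyperplane_at_infinity row_mxEr mxE eqxx mulr1n.
Qed.

Lemma cone_arr (s : seq (affine_equation F l)) : {in s, forall h, h.1 != 0} ->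
  cone s = arr fullv (zcrd :: map eq_form s).
Proof.
move=> s0; have nz : ~~ (fullv <= lker zcrd)%VS.
  have [v [_ vz]] := crd_values (fun=> 0) 1.
  by apply/subvPn; exists v; rewrite ?memvf // memv_ker vz oner_eq0.
have nh h : h \in s -> ~~ (fullv <= lker (eq_form h))%VS.
  move=> /s0 /rV0Pn[j hj]; have [v [vc vz]] := crd_values (fun k => (k == j)%:R) 0.
  apply/subvPn; exists v; rewrite ?memvf // memv_ker eq_formE vz mulr0 subr0 (bigD1 j) //= big1.
    by rewrite vc eqxx mulr1 addr0.
  by move=> k /negbTE kj; rewrite vc kj mulr0.
apply/fsetP => H; rewrite /cone inE.
have -> : (H \in [fset x in [seq cone_hyperplane h | h <- s]]%fset) =
  (H \in [seq cone_hyperplane h | h <- s]) by rewrite inE.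
apply/orP/arrP.
  case=> [/eqP ->|/mapP[h hs ->]].
    exists zcrd; rewrite ?mem_head //; split=> //; by rewrite hyperplane_at_infinityE capfv.
  exists (eq_form h); first by rewrite in_cons map_f ?orbT.
  by split; [rewrite cone_hyperplaneE capfv | exact: nh].
move=> [a]; rewrite in_cons => /orP[/eqP ->|/mapP[h hs ->]] [-> _]; rewrite capfv.
  by left; rewrite hyperplane_at_infinityE.
by right; rewrite -cone_hyperplaneE map_f.
Qed.

End Cones.

Arguments eq_form {F l} h.

Section ShiFamilies.
Variables (F : numFieldType) (m c k l p : nat).
Local Notation V := 'rV[F]_(l + 1).
Local Notation z := (zcrd F l).
Local Notation x := (crd F (l := l)).

Definition tail_points (i : 'I_l) : {fset int} :=
  [fset s in int_range (- c%:Z - (l - i.+1)%N%:Z) ((d_ p m i.+1)%:Z + (l - i.+1)%N%:Z)]%fset.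

Lemma tail_pointsE i s : (s \in tail_points i) =
  (- c%:Z - (l - i.+1)%N%:Z <= s <= m%:Z + (p <= i)%N%:Z + (l - i.+1)%N%:Z).
Proof.
rewrite inE mem_int_range /d_ ltnNge; have -> // : ((if ~~ (p <= i)%N then m else m.+1)%:Z = m%:Z + (p <= i)%N%:Z)%R.
by case: (p <= i)%N => /=; lia.
Qed.

Definition vertex_tail a : seq ('Hom(V, F^o) * {fset int}) :=
  [seq (x i, tail_points i) | i <- seg l a l].

Definition exponent i := (m + c + l.*2 - i.+1 + (p <= i))%N.

Lemma next_vertex_tail a (al : (a < l)%N) :
  next_set (vertex_tail a) = tail_points (Ordinal al).
Proof.
rewrite /vertex_tail (seg_cons al (leqnn l)) /=; congr tail_points.
exact: val_inj.
Qed.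

Lemma vertex_tail_cons a (al : (a < l)%N) :
  vertex_tail a = (x (Ordinal al), tail_points (Ordinal al)) :: vertex_tail a.+1.
Proof.
rewrite /vertex_tail (seg_cons al (leqnn l)) /=.
by have -> : Ordinal (leq_trans al (leqnn l)) = Ordinal al by apply: val_inj.
Qed.

Lemma vertex_tail_nil : vertex_tail l = [::].
Proof. by rewrite /vertex_tail seg_nil. Qed.

Lemma seg_ind (P : nat -> Prop) : P l -> (forall a, (a < l)%N -> P a.+1 -> P a) ->
  forall a, (a <= l)%N -> P a.
Proof.
move=> Pl PS a al; have [n] : exists n, (l - a)%N = n by eexists.
elim: n a al => [|n IH] a al e; first by have -> : a = l by lia.
by apply: PS; [lia | apply: IH; lia].
Qed.

Lemma strict_chain_tail a : (a <= l)%N -> strict_chain (vertex_tail a).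
Proof.
move: a; apply: seg_ind => [|a al IH]; first by rewrite vertex_tail_nil.
rewrite (vertex_tail_cons al) /= IH andbT fproperE; apply/andP; split.
  have [al'|al'] := ltnP a.+1 l; last first.
    have -> : a.+1 = l by lia.
    by rewrite vertex_tail_nil fsub0set.
  by rewrite (next_vertex_tail al'); apply/fsubsetP => s; rewrite !tail_pointsE /=; lia.
apply/fsubsetPn; exists (- c%:Z - (l - a.+1)%N%:Z).
  by rewrite tail_pointsE /=; lia.
have [al'|al'] := ltnP a.+1 l; last first.
  have -> : a.+1 = l by lia.
  by rewrite vertex_tail_nil inE.
by rewrite (next_vertex_tail al') tail_pointsE /=; lia.
Qed.

Lemma tail_exps_tail a : (a <= l)%N ->
  tail_exps a (vertex_tail a) = [seq exponent i | i <- iota a (l - a)].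
Proof.
move: a; apply: seg_ind => [|a al IH]; first by rewrite vertex_tail_nil subnn.
rewrite (vertex_tail_cons al) /= IH; have -> : (l - a = (l - a.+1).+1)%N by lia.
rewrite /=; congr (_ :: _).
rewrite (fset_range_card (n := (m + (p <= a) + c + (l - a.+1).*2 + 1)%N) (tail_pointsE _)) /exponent /=; lia.
Qed.

Lemma tail_forms_tail Y a b : (a <= l)%N -> (forall i, (x i \in Y) = (i < a)%N) ->
  (forall g, g \in Y -> exists i, g = x i) -> b \in tail_forms z Y (vertex_tail a) ->
  (exists i j : 'I_l, [/\ (i < j)%N, (a <= j)%N & b = x j - x i]) \/
  (exists (j : 'I_l) s, [/\ (a <= j)%N, s \in tail_points j & b = x j - s%:~R *: z]).
Proof.
move=> al; move: a al Y b; apply: seg_ind => [|a al IH] Y b Ya Yx.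
  by rewrite vertex_tail_nil.
rewrite (vertex_tail_cons al) /= mem_cat => /orP[/mapP[g gE ->]|].
  move: gE; rewrite mem_cat => /orP[gY|/mapP[s sT ->]].
    have [i gi] := Yx g gY; left; exists i, (Ordinal al); split=> //; last by rewrite gi.
    by rewrite -Ya -gi.
  by right; exists (Ordinal al), s.
move=> /IH [||[i [j [ij aj ->]]]|[j [s [aj sT ->]]]].
- by move=> i; rewrite in_cons Ya (inj_eq (@crd_inj F l)) -val_eqE /= ltnS [RHS]leq_eqVlt.
- by move=> g; rewrite in_cons => /orP[/eqP ->|/Yx //]; exists (Ordinal al).
- by left; exists i, j; split=> //; lia.
- by right; exists j, s; split=> //; lia.
Qed.

Lemma tail_forms_diff Y a (i j : 'I_l) : (a <= l)%N -> (forall i, (x i \in Y) = (i < a)%N) ->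
  (i < j)%N -> (a <= j)%N -> x j - x i \in tail_forms z Y (vertex_tail a).
Proof.
move=> al; move: a al Y; apply: seg_ind => [|a al IH] Y Ya ij aj; first by have := ltn_ord j; lia.
rewrite (vertex_tail_cons al) /= mem_cat; apply/orP.
have [ja|ja] := eqVneq (nat_of_ord j) a.
  have -> : j = Ordinal al by apply: val_inj.
  left; apply: (map_f (fun g => x (Ordinal al) - g)); rewrite mem_cat Ya; apply/orP; left; lia.
right; apply: IH => //; last lia.
by move=> i'; rewrite in_cons Ya (inj_eq (@crd_inj F l)) -val_eqE /= ltnS [RHS]leq_eqVlt.
Qed.

Lemma tail_forms_point Y a (j : 'I_l) s : (a <= l)%N ->
  (a <= j)%N -> s \in tail_points j -> x j - s%:~R *: z \in tail_forms z Y (vertex_tail a).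
Proof.
move=> al; move: a al Y; apply: seg_ind => [|a al IH] Y aj sT; first by have := ltn_ord j; lia.
rewrite (vertex_tail_cons al) /= mem_cat; apply/orP.
have [ja|ja] := eqVneq (nat_of_ord j) a.
  have je : j = Ordinal al by apply: val_inj.
  rewrite -je; left; apply: (map_f (fun g => x j - g)); rewrite mem_cat; apply/orP; right.
  exact: (map_f (fun s : int => s%:~R *: z)).
by right; apply: IH => //; lia.
Qed.

Lemma mem_pairs b (i j : 'I_l) : ((i, j) \in pairs_upto l b) = (i < j)%N && (j < b)%N.
Proof. by rewrite mem_filter mem_enum andbT. Qed.

Definition cat_left r := [seq x i | i <- seg l 0 (minn p r)].
Definition cat_right r := [seq x i | i <- seg l (minn p r) r].

Lemma mem_cat_left r i : (x i \in cat_left r) = (i < minn p r)%N.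
Proof. by rewrite (mem_map (@crd_inj F l)) mem_seg. Qed.

Lemma mem_cat_right r i : (x i \in cat_right r) = (minn p r <= i < r)%N.
Proof. by rewrite (mem_map (@crd_inj F l)) mem_seg. Qed.

Lemma mem_cats r i : (x i \in cat_left r ++ cat_right r) = (i < r)%N.
Proof. by rewrite mem_cat mem_cat_left mem_cat_right; lia. Qed.

Lemma catsP r g : g \in cat_left r ++ cat_right r -> exists2 i : 'I_l, (i < r)%N & g = x i.
Proof.
by rewrite mem_cat => /orP[] /mapP[i]; rewrite mem_seg => h ->; exists i => //; lia.
Qed.

Lemma size_cat_left r : (r <= l)%N -> size (cat_left r) = minn p r.
Proof. by move=> rl; rewrite size_map size_seg; lia. Qed.

Lemma size_cat_right r : (r <= l)%N -> size (cat_right r) = (r - minn p r)%N.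
Proof. by move=> rl; rewrite size_map size_seg; lia. Qed.

Lemma mem_bound r lo hi (i : 'I_l) s : (i < r)%N ->
  (s \in bound lo hi (cat_left r) (x i)) = (lo <= s <= hi + (p <= i)%N%:Z).
Proof.
move=> ir; rewrite /bound mem_int_range mem_cat_left; case: ltnP => h.
  by have -> : (p <= i)%N = false by [lia]; rewrite addr0.
by have -> : (p <= i)%N = true by lia.
Qed.

Lemma present_df L r : (forall i j : 'I_l, (i < j)%N -> (j < r)%N -> forall t : int, -1 <= t <= 1 ->
    present L (diff_form z (x i) (x j) t)) -> z \in L ->
  forall i j : 'I_l, (i < r)%N -> (j < r)%N -> forall t : int, -1 <= t <= 1 ->
    present L (diff_form z (x i) (x j) t).
Proof.
move=> h zL i j ir jr t tt; case: (ltngtP i j) => ij; first exact: h.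
  apply: present_opp (h j i ij ir (- t) _); last by lia.
  by move=> v; rewrite !dfE intrN; ring.
have -> : i = j by apply: val_inj.
by apply: (present_scale zL (k := - t%:~R)) => v; rewrite dfE; ring.
Qed.

Lemma sub_arr_present L L' : {in L, forall a, present L' a} -> sub_arr (fullv : {vspace V}) L L'.
Proof.
move=> h a /h[a0|[b bL [e e0 aE]]]; first by left.
by right; exists b => //; exists e.
Qed.

Lemma vertices_perm r : (r <= l)%N ->
  perm_eq ([seq u.1 | u <- vertex_tail r] ++ cat_left r ++ cat_right r)
    (map x (enum 'I_l)).
Proof.
move=> rl; rewrite /vertex_tail -map_comp -!map_cat.
rewrite (@perm_map _ _ x (seg l r l ++ seg l 0 (minn p r) ++ seg l (minn p r) r)) //.
apply: uniq_perm; rewrite ?enum_uniq //.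
  rewrite !cat_uniq !seg_uniq /= !andbT; apply/andP; split.
    by apply/hasPn => i; rewrite mem_cat !mem_seg; lia.
  by apply/hasPn => i; rewrite !mem_seg; lia.
by move=> i; rewrite !mem_cat !mem_seg mem_enum /=; have := ltn_ord i; rewrite !inE; lia.
Qed.

Lemma exponents_perm (e := [:: 1%N, ((m + l + c - 1) + l - p + 1)%N &
    [seq ((m + l + c - 1) + i)%N | i <- iota 2 (l - 1)]]) :
  (1 <= l)%N -> (p <= l)%N -> perm_eq e (1%N :: catalan_exps p (l - p) (m + c).+1).
Proof.
move=> l1 pl; rewrite /e perm_cons perm_sym.
have h : (p + (l - p))%N = (l - 1).+1 by lia.
apply: perm_trans (catalan_exps_perm (m + c) h) _.
have -> : (m + l + c - 1 + l - p + 1 = m + c + (l - 1).+1 + (l - p))%N by lia.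
rewrite perm_cons.
have -> : [seq (m + l + c - 1 + i)%N | i <- iota 2 (l - 1)] = iota (m + c + (l - 1).+2) (l - 1).
  rewrite -(iotaDl (m + l + c - 1) 2); congr iota; lia.
exact: perm_refl.
Qed.

Lemma exponents_split r N : (r <= l)%N -> (N + r.*2 = m + c + l.*2)%N ->
  catalan_exps (minn p r) (r - minn p r) N.+1 ++ [seq exponent i | i <- iota r (l - r)] =
  catalan_exps (minn p l) (l - minn p l) (m + c).+1.
Proof.
move=> rl Nr; rewrite !catalan_exps_map !subnKC ?geq_minr //.
have -> : iota 0 l = iota 0 r ++ iota r (l - r) by rewrite -{1}(subnKC rl) iotaD.
rewrite map_cat; congr (_ ++ _); apply/eq_in_map => i; rewrite mem_iota => hi.
  by rewrite Nr; congr (_ + nat_of_bool _)%N; lia.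
by rewrite /exponent; congr (_ + nat_of_bool _)%N; lia.
Qed.

End ShiFamilies.

Section Final.
Variables (F : numFieldType) (m c k l p : nat).
Hypotheses (hc : (1 <= c)%N) (hk : (1 <= k <= l)%N) (hp : (p <= l)%N).
Local Notation V := 'rV[F]_(l + 1).
Local Notation z := (zcrd F l).
Local Notation x := (crd F (l := l)).
Local Notation vertex_tail := (vertex_tail F m c l p).
Local Notation tail_points := (@tail_points m c l p).
Local Notation cat_left := (cat_left F l p).
Local Notation cat_right := (cat_right F l p).

Lemma dim_full : \dim (fullv : {vspace V}) = l.+1.
Proof. by rewrite dimvf /dim /= mul1n addn1. Qed.

Lemma present_diff0 L (i j : 'I_l) : present L (x j - x i) -> present L (eq_form (eq_diff i j 0)).
Proof.
by apply: present_opp => v; rewrite eq_form_diff add_lfunE opp_lfunE; ring.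
Qed.

Lemma eq_diff_neq0 (i j : 'I_l) (t : F) : i != j -> (eq_diff i j t).1 != 0.
Proof.
by move=> ij; apply/rV0Pn; exists i; rewrite !mxE !eqxx (negbTE ij) subr0 oner_neq0.
Qed.

Lemma eq_coord_neq0 (i : 'I_l) s : (eq_coord F i s).1 != 0.
Proof. by apply/rV0Pn; exists i; rewrite !mxE !eqxx oner_neq0. Qed.

Lemma d_E (i : 'I_l) : (d_ p m i.+1)%:Z = m%:Z + (p <= i)%N%:Z.
Proof. by rewrite /d_; case: leqP; case: leqP => //=; lia. Qed.

Variant R_spec h : Prop :=
| R_diff0 (i j : 'I_l) of (i < j)%N & h = eq_diff i j 0
| R_diff1 (i j : 'I_l) of (i < j)%N & (j < l - k + 1)%N & h = eq_diff i j 1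
| R_diffN1 (i j : 'I_l) of (i < j)%N & (j < l - k + 1)%N & h = eq_diff i j (-1)
| R_coord (i : 'I_l) s of
    (1 - (mu_ l k i.+1)%:Z - c%:Z <= s <= (d_ p m i.+1)%:Z + (mu_ l k i.+1)%:Z - 1) &
    h = eq_coord F i s.

Lemma arrRP h : h \in arrR F l p k c m <-> R_spec h.
Proof.
rewrite !mem_cat; split.
  case/or4P=> [/mapP[[i j]]|/mapP[[i j]]|/mapP[[i j]]|/allpairsPdep[i [s [_ ss ->]]]].
  - by rewrite mem_pairs => /andP[ij _] ->; apply: (R_diff0 ij).
  - by rewrite mem_pairs => /andP[ij jr] ->; apply: (R_diff1 ij jr).
  - by rewrite mem_pairs => /andP[ij jr] ->; apply: (R_diffN1 ij jr).
  - by apply: (@R_coord _ i s); rewrite // -mem_int_range.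
case=> [i j ij ->|i j ij jr ->|i j ij jr ->|i s ss ->]; apply/or4P.
- by apply/Or41/mapP; exists (i, j); rewrite // mem_pairs ij ltn_ord.
- by apply/Or42/mapP; exists (i, j); rewrite // mem_pairs ij jr.
- by apply/Or43/mapP; exists (i, j); rewrite // mem_pairs ij jr.
- by apply/Or44/allpairsPdep; exists i, s; rewrite mem_enum mem_int_range.
Qed.

Lemma arrR_neq0 : {in arrR F l p k c m, forall h, h.1 != 0}.
Proof.
move=> h; case/arrRP=> [i j ij ->|i j ij _ ->|i j ij _ ->|i t _ ->]; last exact: eq_coord_neq0.
- by apply: eq_diff_neq0; rewrite -val_eqE /= ltn_eqF.
- by apply: eq_diff_neq0; rewrite -val_eqE /= ltn_eqF.
- by apply: eq_diff_neq0; rewrite -val_eqE /= ltn_eqF.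
Qed.

Definition accurate (s : seq (affine_equation F l)) :=
  ind_flag_accurate fullv (cone s) /\
  forall e, perm_eq e (1%N :: catalan_exps p (l - p) (m + c).+1) ->
    free_with_exponents fullv (cone s) e.

Lemma flag_accurate s : {in s, forall h, h.1 != 0} ->
  flag_free (z :: map eq_form s) fullv (catalan_exps p (l - p) (m + c).+1) -> accurate s.
Proof.
move=> s0 fl; rewrite /accurate cone_arr //; apply: flag_free_accurate fl _.
exact: catalan_exps_sorted.
Qed.

Lemma R_accurate : accurate (arrR F l p k c m).
Proof.
pose r := (l - k + 1)%N; pose lo : int := 1 - k%:Z - c%:Z; pose hi : int := m%:Z + k%:Z - 1.
pose N := (m + c + k.*2 - 3)%N.
have rl : (r <= l)%N by rewrite /r; lia.
set s := arrR F l p k c m; set L0 := z :: map eq_form s.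
set Y := cat_left r ++ cat_right r.
set LL := tail_forms z Y (vertex_tail r) ++ G z Y (bound lo hi (cat_left r)).
have lohi : hi - lo + 1 = N.+2%:Z by rewrite /hi /lo /N; lia.
have coordR (i : 'I_l) t : (i < r)%N ->
    (1 - (mu_ l k i.+1)%:Z - c%:Z <= t <= (d_ p m i.+1)%:Z + (mu_ l k i.+1)%:Z - 1) =
    (t \in bound lo hi (cat_left r) (x i)).
  move=> ir; rewrite mem_bound // d_E /lo /hi; have -> : mu_ l k i.+1 = k.
    by rewrite /mu_ /r in ir *; lia.
  by apply/idP/idP; lia.
have coordT (i : 'I_l) t : (r <= i)%N ->
    (1 - (mu_ l k i.+1)%:Z - c%:Z <= t <= (d_ p m i.+1)%:Z + (mu_ l k i.+1)%:Z - 1) =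
    (t \in tail_points i).
  move=> ir; rewrite tail_pointsE d_E; have -> : mu_ l k i.+1 = (l - i.+1).+1.
    by have := ltn_ord i; rewrite /mu_ /r in ir *; lia.
  by apply/idP/idP; lia.
have Ym i : (x i \in Y) = (i < r)%N by apply: mem_cats.
have zLL : z \in LL by rewrite mem_cat G_memz orbT.
have GLL : {subset G z Y (bound lo hi (cat_left r)) <= LL} by move=> a aG; rewrite mem_cat aG orbT.
have TLL : {subset tail_forms z Y (vertex_tail r) <= LL} by move=> a aT; rewrite mem_cat aT.
have L0LL : {in L0, forall a, present LL a}.
  have dfp (i j : 'I_l) (t : int) : (i < r)%N -> (j < r)%N -> -1 <= t <= 1 ->
      present LL (eq_form (eq_diff i j t%:~R)).
    move=> ir jr tt; apply: present_eq (present_mem (GLL _ (G_memdf z _ _ _ tt))).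
    - by move=> v; rewrite eq_form_diff; apply: esym; apply: dfE.
    - by rewrite Ym.
    - by rewrite Ym.
  move=> a; rewrite in_cons => /orP[/eqP ->|/mapP[h /arrRP hs ->]]; first exact: present_mem.
  case: hs => [i j ij ->|i j ij jr ->|i j ij jr ->|i t ti ->].
  - have [jr|jr] := ltnP j r; first by apply: (dfp i j 0) => //; lia.
    by apply/present_diff0/present_mem/TLL/tail_forms_diff.
  - by apply: (dfp i j 1) => //; rewrite /r; lia.
  - by apply: (dfp i j (-1)) => //; rewrite /r; lia.
  - have [ir|ir] := ltnP i r.
      rewrite coordR // in ti.
      apply: present_eq (present_mem (GLL _ (G_mempt z _ ti))); last by rewrite Ym.
      by move=> v; rewrite eq_form_coord ptE.
    rewrite coordT // in ti.
    apply: present_eq (present_mem (TLL _ (tail_forms_point Y rl ir ti))) => v.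
    by rewrite eq_form_coord add_lfunE opp_lfunE scale_lfunE.
have sL h : R_spec h -> present L0 (eq_form h).
  by move=> /arrRP hs; apply: present_mem; rewrite in_cons map_f ?orbT.
have zL0 : z \in L0 by apply: mem_head.
have dL (i j : 'I_l) : (i < j)%N -> present L0 (x j - x i).
  move=> ij; apply: present_opp (sL _ (R_diff0 ij erefl)) => v.
  by rewrite eq_form_diff add_lfunE opp_lfunE; ring.
have cL (i : 'I_l) t : (1 - (mu_ l k i.+1)%:Z - c%:Z <= t <= (d_ p m i.+1)%:Z + (mu_ l k i.+1)%:Z - 1) ->
    present L0 (x i - t%:~R *: z).
  move=> ti; apply: present_eq (sL _ (R_coord ti erefl)) => v.
  by rewrite eq_form_coord add_lfunE opp_lfunE scale_lfunE.
have LLL0 : {in LL, forall a, present L0 a}.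
  move=> a; rewrite mem_cat => /orP[|/GP[->|y y' t yY y'Y tt ->|y t yY ty ->]].
  - move=> /(tail_forms_tail rl Ym)[|[i [j [ij _ ->]]]|[j [t [rj tj ->]]]].
    + by move=> g /catsP[i _ ->]; exists i.
    + exact: dL.
    + by apply: cL; rewrite coordT.
  - exact: present_mem.
  - have [i ir ->] := catsP yY; have [j jr ->] := catsP y'Y.
    apply: (present_df (r := r)) => // {i ir j jr yY y'Y tt t} i j ij jr t tt.
    have : [\/ t = 0, t = 1 | t = -1] by case: (t =P 0); case: (t =P 1); case: (t =P -1); try (by [constructor]); lia.
    case=> ->.
    + apply: present_eq (sL _ (R_diff0 ij erefl)) => v; by rewrite eq_form_diff dfE.
    + apply: present_eq (sL _ (R_diff1 ij jr erefl)) => v; by rewrite eq_form_diff dfE.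
    + apply: present_eq (sL _ (R_diffN1 ij jr erefl)) => v; by rewrite eq_form_diff dfE.
  - have [i ir ye] := catsP yY; rewrite ye in ty *.
    by apply: cL; rewrite coordR.
apply: (flag_accurate arrR_neq0).
have := @catalan_flag F V z r (cat_left r) (cat_right r) lo hi N (vertex_tail r) fullv L0 _ lohi.
rewrite tail_exps_tail // size_cat_left // size_cat_right //.
rewrite (@exponents_split m c l p r N.+1) //; last by rewrite /N /r; lia.
have -> : minn p l = p by lia.
apply.
- by lia.
- apply: indep_perm (crd_indep F (enum_uniq 'I_l)); rewrite perm_sym; exact: vertices_perm.
- by rewrite dim_full size_map size_seg; lia.
- exact: strict_chain_tail.
- have [rl'|rl'] := ltnP r l; last first.
    have -> : r = l by lia.
    by rewrite vertex_tail_nil => t; rewrite inE.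
  by rewrite (next_vertex_tail _ _ _ _ rl') => t; rewrite tail_pointsE /= /lo /hi /r; lia.
- exact: sub_arr_present.
- exact: sub_arr_present.
Qed.

Section Hat.
Hypothesis hk' : (k <= l - 1)%N.

Variant Rhat_spec h : Prop :=
| Rhat_diff0 (i j : 'I_l) of (i < j)%N & h = eq_diff i j 0
| Rhat_diff1 (i j : 'I_l) of (i < j)%N & (j < l - k)%N & h = eq_diff i j 1
| Rhat_diffN1 (i j : 'I_l) of (i < j)%N & (j < l - k)%N & h = eq_diff i j (-1)
| Rhat_edge (i j : 'I_l) of (j : nat) = (l - k)%N & (i < l - k)%N & h = eq_diff j i 1
| Rhat_coord (i : 'I_l) s of
    (- c%:Z - (minn k (l - i.+1))%:Z <= s <= (d_ p m i.+1)%:Z + (minn (k - 1) (l - i.+1))%:Z) &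
    h = eq_coord F i s.

Lemma arrRhatP h : h \in arrRhat F l p k c m <-> Rhat_spec h.
Proof.
rewrite !mem_cat; split.
  case/orP=> [/mapP[[i j]]|].
    by rewrite mem_pairs => /andP[ij _] ->; apply: (Rhat_diff0 ij).
  case/or4P=> [/mapP[[i j]]|/mapP[[i j]]|/mapP[[j i]]|/allpairsPdep[i [s [_ ss ->]]]].
  - by rewrite mem_pairs => /andP[ij jr] ->; apply: (Rhat_diff1 ij jr).
  - by rewrite mem_pairs => /andP[ij jr] ->; apply: (Rhat_diffN1 ij jr).
  - rewrite mem_filter /= => /andP[/andP[jn ir] _] ->.
    by apply: (@Rhat_edge _ i j) => //; lia.
  - by apply: (@Rhat_coord _ i s); rewrite // -mem_int_range.
case=> [i j ij ->|i j ij jr ->|i j ij jr ->|i j jn ir ->|i s ss ->].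
- by apply/orP; left; apply/mapP; exists (i, j); rewrite // mem_pairs ij ltn_ord.
- by apply/orP; right; apply/or4P/Or41/mapP; exists (i, j); rewrite // mem_pairs ij jr.
- by apply/orP; right; apply/or4P/Or42/mapP; exists (i, j); rewrite // mem_pairs ij jr.
- apply/orP; right; apply/or4P/Or43/mapP; exists (j, i) => //.
  by rewrite mem_filter mem_enum /= jn addn1 eqxx ir.
- apply/orP; right; apply/or4P/Or44/allpairsPdep; exists i, s.
  by rewrite mem_enum mem_int_range.
Qed.

Lemma arrRhat_neq0 : {in arrRhat F l p k c m, forall h, h.1 != 0}.
Proof.
move=> h; case/arrRhatP=> [i j ij ->|i j ij _ ->|i j ij _ ->|i j jn ir ->|i t _ ->].
- by apply: eq_diff_neq0; rewrite -val_eqE /= ltn_eqF.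
- by apply: eq_diff_neq0; rewrite -val_eqE /= ltn_eqF.
- by apply: eq_diff_neq0; rewrite -val_eqE /= ltn_eqF.
- by apply: eq_diff_neq0; rewrite -val_eqE /= gtn_eqF // jn.
- exact: eq_coord_neq0.
Qed.

Lemma Rhat_accurate : accurate (arrRhat F l p k c m).
Proof.
pose n := (l - k)%N; pose lo : int := - c%:Z - k%:Z; pose hi : int := m%:Z + k%:Z - 1.
pose N := (m + c + k.*2 - 2)%N; pose top := (p <= n)%N.
have nl : (n < l)%N by rewrite /n; lia.
pose o := Ordinal nl; pose y := x o; pose S := tail_points o.
set s := arrRhat F l p k c m; set L0 := z :: map eq_form s.
set Y := cat_left n ++ cat_right n.
set LL := tail_forms z (y :: Y) (vertex_tail n.+1) ++ [seq y - g | g <- hat_edges z Y S] ++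
  G z Y (bound lo hi (cat_left n)).
have lohi : hi - lo + 1 = N.+2%:Z by rewrite /hi /lo /N; lia.
have hS t : (t \in S) = (lo + 1 <= t <= hi + (top : nat)%:Z).
  by rewrite tail_pointsE /lo /hi /top /= /n; apply/idP/idP; lia.
have coordR (i : 'I_l) t : (i < n)%N ->
    (- c%:Z - (minn k (l - i.+1))%:Z <= t <= (d_ p m i.+1)%:Z + (minn (k - 1) (l - i.+1))%:Z) =
    (t \in bound lo hi (cat_left n) (x i)).
  move=> ir; rewrite mem_bound // d_E /lo /hi.
  have -> : minn k (l - i.+1) = k by rewrite /n in ir; lia.
  have -> : minn (k - 1) (l - i.+1) = (k - 1)%N by rewrite /n in ir; lia.
  by apply/idP/idP; lia.
have coordT (i : 'I_l) t : (n <= i)%N ->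
    (- c%:Z - (minn k (l - i.+1))%:Z <= t <= (d_ p m i.+1)%:Z + (minn (k - 1) (l - i.+1))%:Z) =
    (t \in tail_points i).
  move=> ir; rewrite tail_pointsE d_E.
  have -> : minn k (l - i.+1) = (l - i.+1)%N by have := ltn_ord i; rewrite /n in ir *; lia.
  by have -> : minn (k - 1) (l - i.+1) = (l - i.+1)%N by have := ltn_ord i; rewrite /n in ir *; lia.
have Ym i : (x i \in Y) = (i < n)%N by apply: mem_cats.
have yYm i : (x i \in y :: Y) = (i < n.+1)%N.
  by rewrite in_cons Ym (inj_eq (@crd_inj F l)) -val_eqE /= ltnS [RHS]leq_eqVlt.
have rl : (n.+1 <= l)%N by [].
have zLL : z \in LL by rewrite !mem_cat G_memz !orbT.
have GLL : {subset G z Y (bound lo hi (cat_left n)) <= LL}.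
  by move=> a aG; rewrite !mem_cat aG !orbT.
have TLL : {subset tail_forms z (y :: Y) (vertex_tail n.+1) <= LL} by move=> a aT; rewrite mem_cat aT.
have ELL g : g \in hat_edges z Y S -> y - g \in LL.
  move=> gE; rewrite !mem_cat; apply/orP; right; apply/orP; left.
  exact: (map_f (fun g => y - g)).
have o_eq (i : 'I_l) : (i : nat) = n -> i = o by move=> e; apply: val_inj.
have L0LL : {in L0, forall a, present LL a}.
  have dfp (i j : 'I_l) (t : int) : (i < n)%N -> (j < n)%N -> -1 <= t <= 1 ->
      present LL (eq_form (eq_diff i j t%:~R)).
    move=> ir jr tt; apply: present_eq (present_mem (GLL _ (G_memdf z _ _ _ tt))).
    - by move=> v; rewrite eq_form_diff; apply: esym; apply: dfE.
    - by rewrite Ym.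
    - by rewrite Ym.
  move=> a; rewrite in_cons => /orP[/eqP ->|/mapP[h /arrRhatP hs ->]]; first exact: present_mem.
  case: hs => [i j ij ->|i j ij jr ->|i j ij jr ->|i j jn ir ->|i t ti ->].
  - case: (ltngtP j n) => jn.
    + by apply: (dfp i j 0) => //; lia.
    + by apply/present_diff0/present_mem/TLL/tail_forms_diff.
    + rewrite (o_eq j jn); apply/present_diff0/present_mem/ELL.
      by rewrite mem_cat Ym; apply/orP; left; lia.
  - by apply: (dfp i j 1) => //; lia.
  - by apply: (dfp i j (-1)) => //; lia.
  - rewrite (o_eq j jn).
    have iE : x i + z \in hat_edges z Y S.
      by rewrite !mem_cat (map_f (fun g => g + z)) ?orbT // Ym.
    apply: present_eq (present_mem (ELL _ iE)) => v.
    by rewrite eq_form_diff !add_lfunE opp_lfunE add_lfunE; ring.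
  - have [ir|ir] := ltnP i n.
      rewrite coordR // in ti.
      apply: present_eq (present_mem (GLL _ (G_mempt z _ ti))); last by rewrite Ym.
      by move=> v; rewrite eq_form_coord ptE.
    rewrite coordT // in ti; move: ir; rewrite leq_eqVlt => /orP[/eqP/esym/o_eq ie|ir].
      rewrite ie in ti *; have tE : t%:~R *: z \in hat_edges z Y S.
        by rewrite !mem_cat (map_f (fun s : int => s%:~R *: z)) ?orbT.
      apply: present_eq (present_mem (ELL _ tE)) => v.
      by rewrite eq_form_coord add_lfunE opp_lfunE scale_lfunE.
    apply: present_eq (present_mem (TLL _ (tail_forms_point (y :: Y) rl ir ti))) => v.
    by rewrite eq_form_coord add_lfunE opp_lfunE scale_lfunE.
have sL h : Rhat_spec h -> present L0 (eq_form h).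
  by move=> /arrRhatP hs; apply: present_mem; rewrite in_cons map_f ?orbT.
have zL0 : z \in L0 by apply: mem_head.
have dL (i j : 'I_l) : (i < j)%N -> present L0 (x j - x i).
  move=> ij; apply: present_opp (sL _ (Rhat_diff0 ij erefl)) => v.
  by rewrite eq_form_diff add_lfunE opp_lfunE; ring.
have cL (i : 'I_l) t :
    (- c%:Z - (minn k (l - i.+1))%:Z <= t <= (d_ p m i.+1)%:Z + (minn (k - 1) (l - i.+1))%:Z) ->
    present L0 (x i - t%:~R *: z).
  move=> ti; apply: present_eq (sL _ (Rhat_coord ti erefl)) => v.
  by rewrite eq_form_coord add_lfunE opp_lfunE scale_lfunE.
have LLL0 : {in LL, forall a, present L0 a}.
  move=> a; rewrite !mem_cat => /or3P[|/mapP[g /hat_edgeP[w t wY tt gE|t tS gE] ->]|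
      /GP[->|w w' t wY w'Y tt ->|w t wY tw ->]].
  - move=> /(tail_forms_tail rl yYm)[|[i [j [ij _ ->]]]|[j [t [rj tj ->]]]].
    + by move=> g; rewrite in_cons => /orP[/eqP ->|/catsP[i _ ->]]; [exists o | exists i].
    + exact: dL.
    + by apply: cL; rewrite coordT // ltnW.
  - have [i ir we] := catsP wY.
    have [t0|t1] : t = 0 \/ t = 1 by lia.
      apply: present_eq (dL i o _) => // v.
      by rewrite !add_lfunE !opp_lfunE gE t0 we mul0r addr0.
    apply: present_eq (sL _ (@Rhat_edge _ i o erefl ir erefl)) => v.
    by rewrite eq_form_diff add_lfunE opp_lfunE gE t1 we /y; ring.
  - apply: present_eq (cL o t _) => [v|]; last by rewrite coordT.
    by rewrite !add_lfunE !opp_lfunE gE scale_lfunE.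
  - exact: present_mem.
  - have [i ir ->] := catsP wY; have [j jr ->] := catsP w'Y.
    apply: (present_df (r := n)) => // {i ir j jr wY w'Y tt t} i j ij jr t tt.
    have : [\/ t = 0, t = 1 | t = -1].
      by case: (t =P 0); case: (t =P 1); case: (t =P -1); try (by [constructor]); lia.
    case=> ->.
    + apply: present_eq (sL _ (Rhat_diff0 ij erefl)) => v; by rewrite eq_form_diff dfE.
    + apply: present_eq (sL _ (Rhat_diff1 ij jr erefl)) => v; by rewrite eq_form_diff dfE.
    + apply: present_eq (sL _ (Rhat_diffN1 ij jr erefl)) => v; by rewrite eq_form_diff dfE.
  - have [i ir we] := catsP wY; rewrite we in tw *.
    by apply: cL; rewrite coordR.
apply: (flag_accurate arrRhat_neq0).
have ch : strict_chain ((y, S) :: vertex_tail n.+1).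
  by have := strict_chain_tail F m c p (ltnW nl); rewrite (vertex_tail_cons _ _ _ _ nl).
have topR : top \/ cat_right n = [::].
  rewrite /top; case: leqP => [|pn]; [by left | right].
  by rewrite /cat_right; have -> : minn p n = n by [lia]; rewrite seg_nil.
have := @hat_flag F V z n (cat_left n) (cat_right n) y lo hi N top S (vertex_tail n.+1) fullv L0 _ lohi
  topR hS.
rewrite tail_exps_tail // size_cat_left ?size_cat_right ?(ltnW nl) //.
have -> : (minn p n + ~~ top)%N = minn p n.+1 by rewrite /top; lia.
have -> : (n - minn p n + top)%N = (n.+1 - minn p n.+1)%N by rewrite /top; lia.
rewrite (@exponents_split m c l p n.+1 N) //; last by rewrite /N /n; lia.
have -> : minn p l = p by lia.
apply.
- by lia.
- apply: indep_perm (crd_indep F (enum_uniq 'I_l)); rewrite perm_sym.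
  apply: perm_trans (vertices_perm F m c p (ltnW nl)).
  by rewrite (vertex_tail_cons _ _ _ _ nl) /= perm_sym -cat1s perm_catCA.
- by rewrite dim_full size_map size_seg; lia.
- exact: ch.
- have [rl'|rl'] := ltnP n.+1 l; last first.
    have -> : n.+1 = l by lia.
    by rewrite vertex_tail_nil => t; rewrite inE.
  by rewrite (next_vertex_tail _ _ _ _ rl') => t; rewrite tail_pointsE /= /lo /hi /n; lia.
- exact: sub_arr_present.
- exact: sub_arr_present.
Qed.

End Hat.
End Final.

Local Close Scope ring_scope.

Theorem theorem7p31 (R : realType) (m c k l p : nat)
    (hc : (1 <= c)%N) (hk : (1 <= k <= l)%N) (hp : (p <= l)%N) :
  let q := (m + l + c - 1)%N in
  let e := [:: 1%N, (q + l - p + 1)%N & [seq (q + i)%N | i <- iota 2 (l - 1)]] in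
  (ind_flag_accurate fullv (cone (arrR R l p k c m)) /\
   free_with_exponents fullv (cone (arrR R l p k c m)) e) /\
  ((k <= l - 1)%N ->
   ind_flag_accurate fullv (cone (arrRhat R l p k c m)) /\
   free_with_exponents fullv (cone (arrRhat R l p k c m)) e).
Proof.
move=> q e; have pe : perm_eq e (1%N :: catalan_exps p (l - p) (m + c).+1).
  by apply: exponents_perm => //; case/andP: hk => h1 h2; apply: leq_trans h2.
split; first by have [h1 h2] := @R_accurate R m c k l p hc hk hp; split=> //; apply: h2.
by move=> hk'; have [h1 h2] := @Rhat_accurate R m c k l p hc hk hp hk'; split=> //; apply: h2.
Qed.
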